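(* Let $\sigma_E^2=b\,\sigma_A^2$ for a fixed constant $b\in(0,\infty)$. Then, as $|\rho|\to1$ and $\sigma_A^2\to0$, $$I(\hat R_A;\hat R_E)-\Big[\tfrac12\log_2\!\Big(\frac{p}{p(1-|\rho|^2)+\sigma_A^2+\sigma_E^2}\Big)-\chi\Big]\longrightarrow0,\qquad \chi=\tfrac12\log_2\!\Big(\frac{4\pi}{e^{1+\gamma}}\Big)\approx0.69,$$ where $\gamma$ is the Euler–Mascheroni constant. The same holds for $I(\hat R_B;\hat R_E)$ with $A$ replaced by $B$, under $\sigma_E^2=b'\sigma_B^2$ for a fixed $b'\in(0,\infty)$.
   Context: Fix $p>0$, $\rho\in\mathbb C$ with $|\rho|<1$, and $\sigma_A^2,\sigma_B^2,\sigma_E^2>0$. Let $(H,H_E)$ be a zero-mean circularly-symmetric complex Gaussian (ZMCSCG) vector with covariance $p\begin{pmatrix}1&\rho\\ \bar\rho&1\end{pmatrix}$; let $W_A,W_B,W_E$ be ZMCSCG with variances $\sigma_A^2,\sigma_B^2,\sigma_E^2$, mutually independent and independent of $(H,H_E)$. Define $\hat H_A=H+W_A$, $\hat H_B=H+W_B$, $\hat H_E=H_E+W_E$ and envelopes $\hat R_X=|\hat H_X|$ for $X\in\{A,B,E\}$. Mutual information is in bits; $e$ is Euler's number. *)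

(* Defs.v *)
From HB Require Import structures.
From mathcomp Require Import all_boot all_order all_algebra.
From mathcomp Require Import all_classical all_reals all_analysis.
From mathcomp Require Import complex.
Set Implicit Arguments.
Unset Strict Implicit.
Unset Printing Implicit Defensive.
Import Order.TTheory GRing.Theory Num.Theory.
Import numFieldNormedType.Exports.
Local Open Scope classical_set_scope.
Local Open Scope ring_scope.

Section Defs.
Context {R : realType}.

Definition cabs (z : R[i]) : R := Num.sqrt (complex.Re z ^+ 2 + complex.Im z ^+ 2).

Definition log2 (x : R) : R := ln x / ln 2.

Definition euler_gamma : R :=
  lim ((fun n : nat => \sum_(0 <= k < n) (k.+1%:R)^-1 - ln n%:R) @ \oo).

Definition chi : R := log2 (4 * pi / expR (1 + euler_gamma)) / 2.

Definition corr_mx (rho : R[i]) : 'M[R[i]]_2 :=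
  \matrix_(i < 2, j < 2)
     (if i == j then 1 else if i == ord0 then rho else conjc rho).

Context {d : measure_display} {T : measurableType d} (P : probability T R).

(** A vector z = (z_1..z_n) of complex random variables is zero-mean
    circularly-symmetric complex Gaussian with (Hermitian) covariance K
    (i.e. K = E[z z^H]) iff its characteristic function is
    E[exp(i Re(w^H z))] = exp(-(1/4) w^H K w) for all w in C^n,
    i.e. (Re z, Im z) is a real Gaussian vector with covariance
    1/2 [[Re K, -Im K],[Im K, Re K]]. *)
Definition zmcscg (n : nat) (z : 'I_n -> T -> R[i]) (K : 'M[R[i]]_n) : Prop :=
  (forall i, measurable_fun setT (fun w => complex.Re (z i w))) /\
  (forall i, measurable_fun setT (fun w => complex.Im (z i w))) /\
  forall wv : 'I_n -> R[i],
    let q := complex.Re (\sum_(i < n) \sum_(j < n) conjc (wv i) * K i j * wv j) in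
    (\int[P]_x (cos (complex.Re (\sum_(i < n) conjc (wv i) * z i x)))%:E
       = (expR (- q / 4))%:E)%E /\
    (\int[P]_x (sin (complex.Re (\sum_(i < n) conjc (wv i) * z i x)))%:E = 0)%E.

Definition zmcscg1 (z : T -> R[i]) (s : R) : Prop :=
  zmcscg (fun _ : 'I_1 => z) ((s%:C)%C)%:M.

Definition cev (X : T -> R[i]) (A B : set R) : set T :=
  (fun w => complex.Re (X w)) @^-1` A `&` (fun w => complex.Im (X w)) @^-1` B.

(** mutual independence of (H,H_E), W_A, W_B, W_E (tested on products of
    Borel sets of the real and imaginary parts, which generate the Borel
    sigma-algebras of C^2 and C; taking some sets to be setT gives the
    product rule for every subfamily) *)
Definition model_indep (H HE WA WB WE : T -> R[i]) : Prop :=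
  forall A1 A2 A3 A4 A5 A6 A7 A8 A9 A10 : set R,
    measurable A1 -> measurable A2 -> measurable A3 -> measurable A4 ->
    measurable A5 -> measurable A6 -> measurable A7 -> measurable A8 ->
    measurable A9 -> measurable A10 ->
    (P (cev H A1 A2 `&` cev HE A3 A4 `&` cev WA A5 A6 `&` cev WB A7 A8
          `&` cev WE A9 A10)
     = P (cev H A1 A2 `&` cev HE A3 A4) * P (cev WA A5 A6)
       * P (cev WB A7 A8) * P (cev WE A9 A10))%E.

Definition channel_model (p : R) (rho : R[i]) (sA sB sE : R)
    (H HE WA WB WE : T -> R[i]) : Prop :=
  zmcscg (fun i : 'I_2 => if i == ord0 then H else HE) ((p%:C)%C *: corr_mx rho) /\
  zmcscg1 WA sA /\ zmcscg1 WB sB /\ zmcscg1 WE sE /\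
  model_indep H HE WA WB WE.

Definition envelope (X W : T -> R[i]) : T -> R := fun w => cabs (X w + W w).

Definition joint_density (X Y : T -> R) (f : R -> R -> R) : Prop :=
  (forall x y, 0 <= f x y) /\
  measurable_fun setT (fun z : R * R => f z.1 z.2) /\
  forall A B : set R, measurable A -> measurable B ->
    P (X @^-1` A `&` Y @^-1` B)
    = (\int[(@lebesgue_measure R \x @lebesgue_measure R)%E]_(z in A `*` B)
         (f z.1 z.2)%:E)%E.

End Defs.

Section MI.
Context {R : realType}.

Definition marg1 (f : R -> R -> R) (x : R) : R :=
  fine (\int[@lebesgue_measure R]_y (f x y)%:E)%E.
Definition marg2 (f : R -> R -> R) (y : R) : R :=
  fine (\int[@lebesgue_measure R]_x (f x y)%:E)%E.

Definition mutual_info (f : R -> R -> R) : \bar R :=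
  (\int[(@lebesgue_measure R \x @lebesgue_measure R)%E]_z
     (f z.1 z.2 * log2 (f z.1 z.2 / (marg1 f z.1 * marg2 f z.2)))%:E)%E.

Definition mi_approx (p : R) (rho : R[i]) (sX sE : R) : R :=
  log2 (p / (p * (1 - cabs rho ^+ 2) + sX + sE)) / 2 - chi.

End MI.

(* Main.v *)
Require Import Defs.
From HB Require Import structures.
From mathcomp Require Import all_boot all_order all_algebra.
From mathcomp Require Import all_classical all_reals all_analysis.
From mathcomp Require Import complex.
From mathcomp Require Import measurable_realfun ring lra.
Import Order.TTheory GRing.Theory Num.Theory.
Import numFieldNormedType.Exports.
Local Open Scope classical_set_scope.
Local Open Scope ring_scope.
Set Implicit Arguments.
Unset Strict Implicit.
Unset Printing Implicit Defensive.

(* A density f of the pair of envelopes is unique almost everywhere, so it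
   suffices to exhibit one and to compute with it.  Writing exp(-a |z|^2) as a
   Gaussian average of cos(Re(w^* z)) turns the characteristic function of the
   noisy channel vector into the Laplace transform of the squared envelopes,
   1 / ((1 + a S_A)(1 + b S_E) - a b c), with S_A, S_E the noisy variances and
   c = (p |rho|)^2; this is also the Laplace transform of the bivariate Rayleigh
   density 4 x y / D * exp(-(S_E x^2 + S_A y^2) / D) * I_0(2 sqrt c x y / D),
   D = S_A S_E - c, and Laplace transforms of finite measures are injective.
   For this density, with r^2 = c / (S_A S_E), the mutual information in nats is
   - ln (1 - r^2) - 2 r^2 / (1 - r^2) + E ln I_0.  The asymptotics
   ln I_0(z) = z - ln (2 pi z) / 2 + o(1), the logarithmic Rayleigh moment
   (which produces Euler's constant) and E[X Y] (a hypergeometric series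
   controlled by Wallis-type bounds) reduce it to
   - ln (1 - r^2) / 2 - ln (4 pi) / 2 + (1 + gamma) / 2 + O(sqrt (1 - r^2)),
   and 1 - r^2 is equivalent to (p (1 - |rho|^2) + s_X + s_E) / p. *)

(** The limit has to be uniform over all models, so every estimate carries an explicit error,
    finally a function of y = 1 - r^2 alone. Two terms of order 1/y, coming from the squares and
    from E[X Y], cancel, and the 1/2 nat inside [chi] is what they leave behind. For this reason the
    coefficients of the E[X Y] series must be known up to O(1/k), not merely to leading order. The
    error of the expansion of ln I_0 is kept in the weak form 5 / sqrt z, valid for every z > 0: by
    AM-GM it is at most a combination of 1/X and 1/Y, whose means depend only on the marginals, so
    no region of small X Y has to be cut out. No multivariate inversion theorem is used: the four
    real coordinates are turned into Gaussian factors one at a time, and uniqueness for the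
    two-variable Laplace transform is the one-variable statement applied twice, the other variable
    staying inside a weight. *)

Section integrable_EFin.
Context d (T : measurableType d) (R : realType) (mu : {measure set T -> \bar R}).
Variables (D : set T) (mD : measurable D).
Implicit Types f g : T -> R.

Lemma integrable_EFinD f g : mu.-integrable D (EFin \o f) ->
  mu.-integrable D (EFin \o g) -> mu.-integrable D (EFin \o (fun x => f x + g x)).
Proof. by move=> fi gi; exact: (integrableD mD fi gi). Qed.

Lemma integrable_EFinB f g : mu.-integrable D (EFin \o f) ->
  mu.-integrable D (EFin \o g) -> mu.-integrable D (EFin \o (fun x => f x - g x)).
Proof. by move=> fi gi; exact: (integrableB mD fi gi). Qed.

Lemma integrable_EFinZ k f : mu.-integrable D (EFin \o f) ->
  mu.-integrable D (EFin \o (fun x => k * f x)).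
Proof. by move=> fi; exact: (integrableZl mD k fi). Qed.

End integrable_EFin.

(** * Gaussian moments on the half-line *)

Section halfline.
Context {R : realType}.
Notation mu := (@lebesgue_measure R).
Local Notation hl := (`](0%R : R), +oo[%classic).
Implicit Types lam x : R.

Lemma near_infty_natSS_ger (r : R) : \forall n \near \oo, r <= n.+2%:R.
Proof.
near=> n; apply: (@le_trans _ _ n%:R); last by rewrite ler_nat ltnW.
by near: n; exact: nbhs_infty_ger.
Unshelve. all: by end_near. Qed.

Lemma is_deriveP (F : R -> R) (x a : R) :
  is_derive x 1 F a -> derivable F x 1 /\ 'D_1 F x = a.
Proof. by move=> [? ?]; split. Qed.

Lemma is_derive_mul (F G : R -> R) (x a b : R) :
  is_derive x 1 F a -> is_derive x 1 G b ->
  is_derive x 1 (fun y => F y * G y) (a * G x + F x * b).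
Proof.
move=> dF dG; apply: (@is_derive_eq R R^o R^o _ _ _ _ (F x *: b + G x *: a)).
by rewrite /GRing.scale/=; ring.
Qed.

Lemma is_derive_exprn n (x : R) :
  is_derive x 1 (fun y => y ^+ n) (n%:R * x ^+ n.-1).
Proof.
split; first exact: exprn_derivable.
by rewrite exp_derive/GRing.scale/= mulr1.
Qed.

Lemma integral_FTC_0y (F f : R -> R) (l0 l1 : R) :
  (forall x : R, 0 < x -> derivable F x 1 /\ 'D_1 F x = f x) ->
  (forall x : R, 0 < x -> {for x, continuous f}) ->
  mu.-integrable hl (EFin \o f) ->
  F x @[x --> 0^'+] --> l0 -> F x @[x --> +oo] --> l1 ->
  (\int[mu]_(x in hl) (f x)%:E = (l1 - l0)%:E)%E.
Proof.
move=> dF cf intf F0 Fy.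
(* Starting at 2 gives a n < 1 < b n, so every interval is nondegenerate, even for n = 0. *)
pose a (n : nat) : R := n.+2%:R^-1; pose b (n : nat) : R := n.+2%:R.
have a0 n : 0 < a n by rewrite invr_gt0.
have ab n : a n < b n.
  rewrite /a /b (@lt_trans _ _ 1)//; first by rewrite invf_lt1// ltr1n.
  by rewrite ltr1n.
have FE n : (\int[mu]_(x in `[a n, b n]) (f x)%:E = (F (b n) - F (a n))%:E)%E.
  rewrite (continuous_FTC2 (ab n) (F := F))//.
  - apply: continuous_in_subspaceT => x; rewrite inE/= in_itv/= => /andP[ax _].
    exact/cf/(lt_le_trans (a0 n)).
  - have Fc (x : R) : 0 < x -> F @ x --> F x.
      move=> x0; apply: differentiable_continuous; apply/derivable1_diffP.
      by have [] := dF _ x0.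
    split.
    + move=> x; rewrite in_itv/= => /andP[ax _].
      by have [] := dF _ (lt_trans (a0 n) ax).
    + exact/cvg_at_right_filter/Fc.
    + exact/cvg_at_left_filter/Fc/(lt_trans (a0 n)).
  - move=> x; rewrite in_itv/= => /andP[ax _].
    by rewrite derive1E; have [_ ->] := dF _ (lt_trans (a0 n) ax).
have mf : measurable_fun hl f.
  by apply/measurable_EFinP; exact: measurable_int intf.
have sab n : `[a n, b n] `<=` hl.
  move=> x /=; rewrite !in_itv/= andbT => /andP[ax _]; exact: lt_le_trans ax.
pose g (n : nat) : R -> \bar R := ((EFin \o f) \_ `[a n, b n]).
have lim1 : (\int[mu]_(x in hl) g n x)%E @[n --> \oo] -->
    (\int[mu]_(x in hl) (EFin \o f) x)%E.
  apply: (@dominated_cvg _ _ _ mu hl _ g (EFin \o f) (abse \o (EFin \o f))) => //=.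
  - move=> n; apply/measurable_restrict => //.
    by apply/measurable_EFinP; apply: measurable_funS mf => // x [].
  - move=> x; rewrite in_itv/= andbT => x0.
    apply: cvg_near_cst; near=> n; rewrite /g patchE ifT// inE/= in_itv/=.
    rewrite /a /b; apply/andP; split.
      rewrite -[leRHS]invrK lef_pV2 ?posrE ?invr_gt0//.
      by near: n; exact: near_infty_natSS_ger.
    by near: n; exact: near_infty_natSS_ger.
  - exact: integrable_abse.
  - move=> n x _; rewrite /g patchE; case: ifPn => // _.
    (* Outside its interval the restriction takes the default value [point], which is 0 here. *)
    by rewrite (_ : (point : \bar R) = 0%E)// abse0 lee_fin.
have {}lim1 : ((F (b n) - F (a n))%:E @[n --> \oo] -->
    \int[mu]_(x in hl) (f x)%:E)%E.
  apply: cvg_trans lim1; apply: near_eq_cvg; apply: nearW => n.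
  by rewrite -FE /g -integral_mkcondr setIidr.
have lim2 : (F (b n) - F (a n))%:E @[n --> \oo] --> (l1 - l0)%:E.
  apply: cvg_EFin; first by apply: nearW.
  have bc : b n @[n --> \oo] --> +oo%R.
    by rewrite (_ : b = (fun n => (n + 2)%:R)) ?cvg_shiftn; [exact: cvgr_idn|
       apply/funext => n; rewrite addn2].
  apply: cvgB; first by move/cvg_pinftyP : Fy; exact.
  move/cvg_at_rightP : F0; apply; split => //.
  by rewrite (_ : a = unstable.inv_fun b)//; apply/gtr0_cvgV0 => //; exact: nearW.
exact: cvg_unique lim1 lim2.
Unshelve. all: by end_near. Qed.

Lemma cvgy0_le_inv (g : R -> R) (K : R) :
  (forall x, 1 <= x -> `|g x| <= K / x) -> g x @[x --> +oo] --> 0.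
Proof.
move=> gK; apply/cvgrPdist_le => /= e e0; near=> x.
have x1 : 1 <= x by near: x; exact: nbhs_pinfty_ge.
have x0 : 0 < x by exact: lt_le_trans x1.
rewrite sub0r normrN (le_trans (gK _ x1))// ler_pdivrMr// mulrC -ler_pdivrMr//.
Unshelve. all: by end_near. Qed.

Lemma cvg0_right_le (g : R -> R) (K : R) :
  (forall x, 0 < x -> x < 1 -> `|g x| <= K * x) -> g x @[x --> 0^'+] --> 0.
Proof.
move=> gK; apply/cvgrPdist_le => /= e e0; near=> x.
have x0 : 0 < x by [].
have K0 : 0 < `|K| + 1 by rewrite ltr_wpDl.
rewrite sub0r normrN (le_trans (gK _ _ _))//.
rewrite (@le_trans _ _ ((`|K| + 1) * x))//.
  by rewrite ler_wpM2r// ?(ltW x0)// (le_trans (ler_norm _))// lerDl.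
by rewrite -ler_pdivlMl// mulrC; near: x; apply: nbhs_right_le; rewrite divr_gt0.
Unshelve. all: by end_near. Qed.

(** t^m / m! is a single term of the exponential series. *)
Lemma exprn_le_fact_expR (t : R) m : 0 <= t -> t ^+ m <= m`!%:R * expR t.
Proof.
move=> t0; rewrite -ler_pdivrMl; last by rewrite ltr0n fact_gt0.
apply: (@le_trans _ _ (series (exp_coeff t) m.+1)).
  rewrite seriesEord/= big_ord_recr/= exp_coeffE/= lerDr sumr_ge0// => i _.
  by rewrite mulr_ge0 ?exprn_ge0// invr_ge0.
apply: nondecreasing_cvgn_le; last exact: is_cvg_series_exp_coeff.
by apply: nondecreasing_series => i _ _; exact: exp_coeff_ge0.
Qed.

Definition gw (lam x : R) := expR (- lam * x ^+ 2).

Lemma gw_ge0 lam x : 0 <= gw lam x. Proof. exact: expR_ge0. Qed.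

Lemma gw_le1 lam x : 0 <= lam -> gw lam x <= 1.
Proof. by move=> l0; rewrite expR_le1 mulNr oppr_le0 mulr_ge0// sqr_ge0. Qed.

Lemma is_derive_gw lam x : is_derive x 1 (gw lam) (- (2 * lam * x) * gw lam x).
Proof.
apply: (@is_derive_eq R R^o R^o _ _ _ _ (expR (- lam * x ^+ 2) * (- lam * (2 * x)))).
  apply: (@is_derive1_comp _ expR (fun y : R => - lam * y ^+ 2)).
  apply: is_derive_eq; rewrite /GRing.scale/=; ring.
by rewrite /gw; ring.
Qed.

Lemma continuous_gw lam : continuous (gw lam).
Proof.
move=> x; apply: differentiable_continuous; apply/derivable1_diffP.
by have [] := is_derive_gw lam x.
Qed.

Lemma measurable_gw lam : measurable_fun setT (gw lam).
Proof. apply: continuous_measurable_fun; exact: continuous_gw. Qed.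

Lemma integral_gwT lam : 0 < lam ->
  (\int[mu]_x (gw lam x)%:E = (Num.sqrt (pi / lam))%:E)%E.
Proof.
move=> l0; pose s : R := (Num.sqrt (2 * lam))^-1.
have s0 : s != 0 by rewrite invr_eq0 gt_eqF// sqrtr_gt0 mulr_gt0.
have s2 : s ^+ 2 = (2 * lam)^-1.
  by rewrite exprVn sqr_sqrtr// mulr_ge0// ltW.
have pk : normal_peak s = (Num.sqrt (pi / lam))^-1.
  rewrite /normal_peak s2; congr (Num.sqrt _)^-1.
  by rewrite -mulr_natr; field; rewrite gt_eqF.
have := @integral_normal_pdf R 0 s; rewrite normal_pdfE//.
under eq_integral do rewrite EFinM.
rewrite ge0_integralZl//; last 3 first.
  - by apply/measurable_EFinP; exact: measurable_normal_fun.
  - by move=> x _; rewrite lee_fin normal_fun_ge0.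
  - by rewrite lee_fin normal_peak_ge0.
have -> : normal_fun 0 s = gw lam.
  apply/funext => x; rewrite /normal_fun/gw s2 subr0; congr expR.
  by rewrite -mulr_natr; field; rewrite gt_eqF.
rewrite pk => /(congr1 (fun y => (Num.sqrt (pi / lam))%:E * y)%E).
by rewrite muleA -EFinM divff ?mul1e ?mule1// gt_eqF// sqrtr_gt0 divr_gt0// pi_gt0.
Qed.

Lemma integrable_gwT lam : 0 < lam -> mu.-integrable setT (EFin \o gw lam).
Proof.
move=> l0; apply/integrableP; split; first by apply/measurable_EFinP; exact: measurable_gw.
under eq_integral do rewrite /= ger0_norm ?gw_ge0//.
by rewrite integral_gwT// ltry.
Qed.

Lemma integral_gw lam : 0 < lam ->
  (\int[mu]_(x in hl) (gw lam x)%:E = (Num.sqrt (pi / lam) / 2)%:E)%E.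
Proof.
move=> l0; have := integral_gwT l0.
rewrite ge0_symfun_integralT//=; last 3 first.
- by move=> x; exact: gw_ge0.
- exact: continuous_gw.
- by move=> x; rewrite /gw/= sqrrN.
rewrite (_ : [set x | _] = `[0, +oo[%classic); last first.
  by apply/seteqP; split => x/=; rewrite in_itv/= andbT.
rewrite -integral_itv_obnd_cbnd; last first.
  by apply/measurable_EFinP/measurable_funTS; exact: measurable_gw.
move=> /(congr1 (fun y => (2^-1)%:E * y)%E).
by rewrite muleA -!EFinM mulVf// mul1e mulrC.
Qed.

(** Half of the exponent is spent on absorbing the power, through t^m <= m! e^t at t = lam x^2 /
    2. *)
Lemma exprn_gw_le lam m x : 0 < lam ->
  x ^+ (2 * m) * gw lam x <= m`!%:R * (2 / lam) ^+ m * gw (lam / 2) x.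
Proof.
move=> l0; have t0 : 0 <= lam / 2 * x ^+ 2.
  by rewrite mulr_ge0 ?sqr_ge0// divr_ge0// ltW.
have -> : gw lam x = gw (lam / 2) x * gw (lam / 2) x.
  by rewrite /gw -expRD; congr expR; field.
rewrite mulrA ler_wpM2r ?gw_ge0// /gw mulNr expRN ler_pdivrMr ?expR_gt0//.
have l2 : 0 <= 2 / lam by rewrite divr_ge0// ltW.
have h := ler_wpM2l (exprn_ge0 m l2) (exprn_le_fact_expR m t0).
 rewrite exprM -mulrA mulrCA; apply: le_trans h.
rewrite -exprMn le_eqVlt; apply/orP; left; apply/eqP; congr (_ ^+ m).
by field; rewrite gt_eqF.
Qed.

(** One growth condition that yields both integrability against a Gaussian and decay at infinity.
    Only positive arguments are constrained, which admits functions singular or negative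
    elsewhere. *)
Definition polybound (f : R -> R) C m :=
  forall x, 0 < x -> `|f x| <= C * (1 + x ^+ (2 * m)).

Lemma polybound_gw f C m lam x : 0 < lam -> polybound f C m -> 0 < x ->
  `|f x * gw lam x| <= C * (1 + m`!%:R * (2 / lam) ^+ m) * gw (lam / 2) x.
Proof.
move=> l0 fC x0; rewrite normrM (ger0_norm (gw_ge0 _ _)).
have C0 : 0 <= C.
  have := le_trans (normr_ge0 _) (fC _ x0); rewrite pmulr_lge0//.
  by rewrite ltr_pwDl// exprn_ge0// ltW.
apply: (le_trans (ler_wpM2r (gw_ge0 _ _) (fC _ x0))).
rewrite -!mulrA ler_wpM2l// mulrDl mul1r mulrDl mul1r lerD ?exprn_gw_le//.
by rewrite ler_expR !mulNr lerN2 ler_wpM2r ?sqr_ge0//; lra.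
Qed.

Lemma integrable_polybound f C m lam : 0 < lam ->
  measurable_fun hl f -> polybound f C m ->
  mu.-integrable hl (EFin \o (fun x => f x * gw lam x)).
Proof.
move=> l0 mf fC; have l20 : 0 < lam / 2 by rewrite divr_gt0.
pose K := C * (1 + m`!%:R * (2 / lam) ^+ m).
apply: (@le_integrable _ _ _ mu hl _ _ (fun x : R => K%:E * (gw (lam / 2) x)%:E)%E) => //.
- apply/measurable_EFinP; apply: measurable_funM => //.
  by apply: measurable_funTS; exact: measurable_gw.
- move=> x/=; rewrite in_itv/= andbT => x0; rewrite lee_fin.
  by rewrite (le_trans (polybound_gw l0 fC x0))// ler_norm.
- apply: integrableZl => //; apply: (@integrableS _ _ _ _ setT) => //.
  exact: integrable_gwT.
Qed.

Lemma cvgy_polybound f C m lam : 0 < lam -> polybound f C m ->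
  f x * gw lam x @[x --> +oo] --> 0.
Proof.
move=> l0 fC; pose K := C * (1 + m`!%:R * (2 / lam) ^+ m).
apply: (@cvgy0_le_inv _ (`|K| * (2 / lam))) => x x1.
have x0 : 0 < x by exact: lt_le_trans x1.
apply: (le_trans (polybound_gw l0 fC x0)).
rewrite -/K -(mulrA `|K|) (le_trans (ler_wpM2r (gw_ge0 _ _) (ler_norm K)))//.
rewrite ler_wpM2l// /gw mulNr expRN -[2 / lam]invf_div -invfM lef_pV2 ?posrE ?expR_gt0//; last first.
  by rewrite mulr_gt0// divr_gt0.
apply: le_trans (expR_ge1Dx _).
rewrite (@le_trans _ _ (lam / 2 * x ^+ 2))// ?lerDr//.
rewrite ler_wpM2l// ?divr_ge0 ?(ltW l0)//.
by rewrite expr2 ler_peMl// ltW.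
Qed.

Lemma polybound_exprn n : polybound (fun x => x ^+ n) 1 n.
Proof.
move=> x x0; rewrite mul1r ger0_norm ?exprn_ge0 ?(ltW x0)//.
have [x1|x1] := leP x 1.
  by rewrite (le_trans (exprn_ile1 _ _ _))// ?(ltW x0)// lerDl exprn_ge0// ltW.
rewrite (@le_trans _ _ (x ^+ (2 * n)))// ?lerDr//.
by rewrite ler_eXn2l// mul2n -addnn leq_addr.
Qed.

Definition hmom lam n := \int[mu]_(x in hl) (x ^+ n * gw lam x).

Lemma integrable_hmom lam n : 0 < lam ->
  mu.-integrable hl (EFin \o (fun x => x ^+ n * gw lam x)).
Proof.
move=> l0; apply: (integrable_polybound l0 _ (@polybound_exprn n)).
by apply: measurable_funX.
Qed.

Lemma hmomE lam n : 0 < lam ->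
  (\int[mu]_(x in hl) (x ^+ n * gw lam x)%:E = (hmom lam n)%:E)%E.
Proof. by move=> l0; rewrite fineK//; apply: integrable_fin_num => //; exact: integrable_hmom. Qed.

(** Integration by parts: x^(n+1) exp(-lam x^2) vanishes at both ends of the half-line. *)
Lemma hmom_rec lam n : 0 < lam ->
  hmom lam n.+2 = n.+1%:R / (2 * lam) * hmom lam n.
Proof.
move=> l0.
have h : (\int[mu]_(x in hl)
   (n.+1%:R * (x ^+ n * gw lam x) - 2 * lam * (x ^+ n.+2 * gw lam x)) = 0)%R.
  rewrite /Rintegral (@integral_FTC_0y (fun x => x ^+ n.+1 * gw lam x) _ 0 0) ?subr0//.
  - move=> x x0; apply: is_deriveP; have := is_derive_gw lam x => d.
    apply: (is_derive_eq (is_derive_mul (is_derive_exprn n.+1 x) d)).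
    by rewrite /= !exprS; ring.
  - move=> x _; apply: cvgB; apply: cvgM; try exact: cvg_cst;
      by apply: cvgM; [exact: exprn_continuous|exact: continuous_gw].
  - by apply: integrable_EFinB => //; apply: integrable_EFinZ => //; exact: integrable_hmom.
  - apply: (@cvg0_right_le _ 1) => x x0 x1; rewrite mul1r ger0_norm; last first.
      by rewrite mulr_ge0 ?gw_ge0// exprn_ge0// ltW.
    rewrite -[leRHS]mulr1 ler_pM ?gw_ge0 ?gw_le1 ?exprn_ge0 ?(ltW x0) ?(ltW l0)//.
    by rewrite exprS -[leRHS]mulr1 ler_wpM2l ?(ltW x0)// exprn_ile1 ?(ltW x0) ?(ltW x1).
  - exact: (cvgy_polybound l0 (@polybound_exprn _)).
move: h; rewrite RintegralB//; last 2 first.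
  by apply: integrable_EFinZ => //; exact: integrable_hmom.
  by apply: integrable_EFinZ => //; exact: integrable_hmom.
rewrite !RintegralZl//; [|exact: integrable_hmom|exact: integrable_hmom].
rewrite -/(hmom lam n) -/(hmom lam n.+2) => h.
have -> : hmom lam n.+2 = (2 * lam * hmom lam n.+2) / (2 * lam) by field; lra.
have -> : 2 * lam * hmom lam n.+2 = n.+1%:R * hmom lam n by lra.
by field; lra.
Qed.

Lemma hmom0 lam : 0 < lam -> hmom lam 0 = Num.sqrt pi / (2 * Num.sqrt lam).
Proof.
move=> l0; apply: EFin_inj; rewrite -hmomE//.
under eq_integral do rewrite expr0 mul1r.
rewrite integral_gw// sqrtrM ?pi_ge0// sqrtrV ?(ltW l0)//; congr (_%:E).
by field; rewrite gt_eqF// sqrtr_gt0.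
Qed.

Lemma hmom1 lam : 0 < lam -> hmom lam 1 = (2 * lam)^-1.
Proof.
move=> l0; apply: EFin_inj; rewrite -hmomE//.
rewrite (@integral_FTC_0y (fun x => - (2 * lam)^-1 * gw lam x) _ (- (2 * lam)^-1) 0) ?sub0r ?opprK//.
- move=> x x0; apply: is_deriveP; have := is_derive_gw lam x => d.
  apply: is_derive_eq; rewrite /GRing.scale/=; field; lra.
- by move=> x _; apply: cvgM; [exact: exprn_continuous|exact: continuous_gw].
- exact: integrable_hmom.
- rewrite [X in _ --> X](_ : _ = - (2 * lam)^-1 * gw lam 0); last first.
    by rewrite /gw expr0n/= mulr0 expR0 mulr1.
  apply: cvgM; first exact: cvg_cst.
  by apply: cvg_at_right_filter; exact: continuous_gw.
- rewrite -[X in _ --> X](mulr0 (- (2 * lam)^-1)); apply: cvgM; first exact: cvg_cst.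
  have := cvgy_polybound l0 (@polybound_exprn 0).
  by under eq_fun do rewrite expr0 mul1r.
Qed.

Lemma hmom_odd lam k : 0 < lam -> hmom lam (2 * k).+1 = k`!%:R / (2 * lam ^+ k.+1).
Proof.
move=> l0; elim: k => [|k ih]; first by rewrite muln0 hmom1// fact0 div1r expr1.
rewrite mulnS -[(2 + 2 * k).+1]/((2 * k).+1.+2) hmom_rec// ih factS natrM.
rewrite (_ : (2 * k).+2%:R = 2 * k.+1%:R :> R); last by rewrite -natrM mulnS.
rewrite !exprS; field; rewrite expf_neq0 ?gt_eqF//; lra.
Qed.

(** The normalised central binomial coefficient binom(2k, k) / 4^k, of order 1 / sqrt (pi k). *)
Definition wallis k : R := (2 * k)`!%:R / (4 ^+ k * k`!%:R ^+ 2).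

Lemma wallis_gt0 k : 0 < wallis k.
Proof.
by rewrite divr_gt0 ?mulr_gt0 ?exprn_gt0 ?ltr0n ?fact_gt0.
Qed.

Lemma wallis0 : wallis 0 = 1.
Proof. by rewrite /wallis muln0 fact0 expr0 expr1n mul1r divr1. Qed.

Lemma wallisS k : wallis k.+1 = wallis k * ((2 * k).+1%:R / (2 * k).+2%:R).
Proof.
rewrite /wallis mulnS !factS !natrM (_ : (2 * k).+2%:R = 2 * k.+1%:R :> R); last first.
  by rewrite -natrM mulnS.
have fk : k`!%:R != 0 :> R by rewrite pnatr_eq0 -lt0n fact_gt0.
have K0 : k.+1%:R != 0 :> R by rewrite pnatr_eq0.
have F0 : 4 ^+ k != 0 :> R by rewrite expf_neq0.
rewrite exprS; move: (4 ^+ k) F0 k.+1%:R K0 k`!%:R fk => a a0 b b0 c c0.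
by field; rewrite a0 b0 c0.
Qed.

Lemma hmom_even lam k : 0 < lam ->
  hmom lam (2 * k) = Num.sqrt pi * wallis k * k`!%:R / (2 * lam ^+ k * Num.sqrt lam).
Proof.
move=> l0; have s0 : Num.sqrt lam != 0 by rewrite gt_eqF// sqrtr_gt0.
have l0' : lam != 0 by rewrite gt_eqF.
elim: k => [|k ih]; first by rewrite muln0 hmom0// wallis0 fact0 expr0; field.
rewrite mulnS -[(2 + 2 * k)%N]/((2 * k).+2) hmom_rec// ih wallisS factS natrM.
rewrite (_ : (2 * k).+2%:R = 2 * k.+1%:R :> R); last by rewrite -natrM mulnS.
have K0 : k.+1%:R != 0 :> R by rewrite pnatr_eq0.
have F0 : lam ^+ k != 0 by rewrite expf_neq0.
rewrite exprS; move: (lam ^+ k) F0 k.+1%:R K0 => a a0 b b0.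
by field; rewrite s0 l0' a0 b0.
Qed.

Lemma hmom_gt0 lam n : 0 < lam -> 0 < hmom lam n.
Proof.
move=> l0; elim/ltn_ind: n => -[|[|n]] ih.
- by rewrite hmom0// divr_gt0 ?mulr_gt0 ?sqrtr_gt0 ?pi_gt0.
- by rewrite hmom1// invr_gt0 mulr_gt0.
- by rewrite hmom_rec// mulr_gt0// ?ih// divr_gt0// mulr_gt0.
Qed.

(* AM-GM under the integral. *)
Lemma hmom_logconvex n : hmom 1 n.+1 ^+ 2 <= hmom 1 n * hmom 1 n.+2.
Proof.
have key t : 0 < t -> 2 * hmom 1 n.+1 <= t * hmom 1 n + t^-1 * hmom 1 n.+2.
  move=> t0.
  rewrite -!RintegralZl//; try exact: integrable_hmom.
  rewrite -RintegralD//; try (by apply: integrable_EFinZ => //; exact: integrable_hmom).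
  apply: le_Rintegral => //.
  - by apply: integrable_EFinZ => //; exact: integrable_hmom.
  - by apply: integrable_EFinD => //; apply: integrable_EFinZ => //; exact: integrable_hmom.
  move=> x; rewrite /= in_itv/= andbT => x0.
  rewrite -subr_ge0 (_ : _ - _ = x ^+ n * t^-1 * (x - t) ^+ 2 * gw 1 x); last first.
    by rewrite (exprS x n.+1) (exprS x n); field; rewrite gt_eqF.
  by rewrite mulr_ge0 ?gw_ge0// mulr_ge0 ?sqr_ge0// mulr_ge0 ?invr_ge0 ?exprn_ge0 ?(ltW x0) ?(ltW t0).
have p1 := hmom_gt0 n.+1 (ltr01 : 0 < 1 :> R).
have p0 := hmom_gt0 n (ltr01 : 0 < 1 :> R).
(* This choice makes the first term on the right equal to [hmom 1 n.+1]; what remains is the claim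
   divided by that moment, with no square root. *)
have := key (hmom 1 n.+1 / hmom 1 n) (divr_gt0 p1 p0).
rewrite divfK ?gt_eqF// -subr_ge0 => h; rewrite -subr_ge0.
have -> : hmom 1 n * hmom 1 n.+2 - hmom 1 n.+1 ^+ 2 = hmom 1 n.+1 *
   (hmom 1 n.+1 + (hmom 1 n.+1 / hmom 1 n)^-1 * hmom 1 n.+2 - 2 * hmom 1 n.+1).
  by field; rewrite !gt_eqF.
by rewrite mulr_ge0// ltW.
Qed.

(** Even Gaussian moments contain sqrt pi times [wallis k], odd ones only factorials. Log-convexity
    centred at an odd moment gives the lower bound, centred at an even one the upper bound. *)
Lemma wallis_sqr_bounds k : (k%:R + 2^-1)^-1 <= pi * wallis k ^+ 2 <=
  (k%:R + 1) / (k%:R + 2^-1) ^+ 2.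
Proof.
have kf : 0 < k`!%:R :> R by rewrite ltr0n fact_gt0.
have k0 : 0 <= k%:R :> R by [].
have spi : Num.sqrt pi ^+ 2 = pi :> R by rewrite sqr_sqrtr// pi_ge0.
have e2 : hmom 1 (2 * k).+2 = (k%:R + 2^-1) * hmom 1 (2 * k).
  by rewrite hmom_rec// mulr1 -natr1 natrM; field.
have e0 : hmom 1 (2 * k) = Num.sqrt pi * wallis k * k`!%:R / 2.
  by rewrite hmom_even// expr1n sqrtr1 !mulr1.
have e1 : hmom 1 (2 * k).+1 = k`!%:R / 2.
  by rewrite hmom_odd// expr1n mulr1.
have e3 : hmom 1 (2 * k).+3 = (k%:R + 1) * k`!%:R / 2.
  by rewrite hmom_rec// e1 mulr1 -2!natr1 natrM; field.
apply/andP; split.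
  have := hmom_logconvex (2 * k); rewrite e1 e2 e0 => h.
  rewrite -subr_ge0 (_ : _ - _ = ((Num.sqrt pi * wallis k * k`!%:R / 2) *
     ((k%:R + 2^-1) * (Num.sqrt pi * wallis k * k`!%:R / 2)) - (k`!%:R / 2) ^+ 2) *
     (4 / (k`!%:R ^+ 2 * (k%:R + 2^-1)))); last first.
    by rewrite -{1}spi; field; rewrite (gt_eqF kf)/=; lra.
  rewrite mulr_ge0 ?subr_ge0// divr_ge0// mulr_ge0 ?sqr_ge0//; lra.
have := hmom_logconvex (2 * k).+1; rewrite e1 e2 e0 e3 => h.
rewrite -subr_ge0 (_ : _ - _ = (k`!%:R / 2 * ((k%:R + 1) * k`!%:R / 2) -
   ((k%:R + 2^-1) * (Num.sqrt pi * wallis k * k`!%:R / 2)) ^+ 2) *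
   (4 / (k`!%:R ^+ 2 * (k%:R + 2^-1) ^+ 2))); last first.
  by rewrite -{1}spi; field; rewrite (gt_eqF kf)/=; lra.
rewrite mulr_ge0 ?subr_ge0// divr_ge0// mulr_ge0 ?sqr_ge0//.
Qed.
End halfline.

(** * The logarithmic moment and Euler's constant *)

Section logmoments.
Context {R : realType}.
Notation mu := (@lebesgue_measure R).
Local Notation hl := (`](0%R : R), +oo[%classic).
Implicit Types lam x t : R.

Lemma ln_le_tangent (m t : R) : 0 < m -> 0 < t -> ln t <= ln m + t / m - 1.
Proof.
move=> m0 t0; have -> : ln t = ln m + ln (1 + (t / m - 1)).
  by rewrite (_ : 1 + _ = t / m) ?ln_div ?posrE//; lra.
rewrite -addrA lerD2l le_ln1Dx//.
by rewrite ltrBrDr addNr divr_gt0.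
Qed.

Lemma abs_ln_le t : 0 < t -> `|ln t| <= t + 2 / Num.sqrt t.
Proof.
move=> t0; have s0 : 0 < Num.sqrt t by rewrite sqrtr_gt0.
have p : 0 < 2 / Num.sqrt t by rewrite divr_gt0.
rewrite ler_norml; apply/andP; split.
  rewrite -lerN2 opprK.
  have -> : - ln t = 2 * ln (Num.sqrt t)^-1.
    rewrite lnV ?posrE// -[t in LHS](sqr_sqrtr (ltW t0)) lnXn// -mulr_natl; ring.
  rewrite (@le_trans _ _ (2 / Num.sqrt t))// ?lerDr ?(ltW t0)//.
  by rewrite ler_wpM2l// ltW// ln_sublinear// invr_gt0.
by rewrite (le_trans (ltW (ln_sublinear t0)))// lerDl ltW.
Qed.

Lemma exprn_le_1D x j m : 0 < x -> (j <= 2 * m)%N -> x ^+ j <= 1 + x ^+ (2 * m).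
Proof.
move=> x0 jm; have [x1|x1] := leP x 1.
  by rewrite (le_trans (exprn_ile1 _ _ _))// ?(ltW x0)// lerDl exprn_ge0// ltW.
by rewrite (@le_trans _ _ (x ^+ (2 * m)))// ?lerDr// ler_eXn2l.
Qed.

Lemma abs_ln_sqr_le lam x : 0 < lam -> 0 < x ->
  `|ln (lam * x ^+ 2)| <= lam * x ^+ 2 + 2 / Num.sqrt lam / x.
Proof.
move=> l0 x0; have p : 0 < lam * x ^+ 2 by rewrite mulr_gt0// exprn_gt0.
have := abs_ln_le p; rewrite sqrtrM ?(ltW l0)// sqrtr_sqr (gtr0_norm x0).
by rewrite (_ : 2 / (_ * x) = 2 / Num.sqrt lam / x)// invfM mulrA.
Qed.

(** The singularity of the logarithm at 0 is at most of order 1/x, so one factor x absorbs it; hence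
    the exponent [n.+1]. *)
Lemma polybound_exprn_ln lam n : 0 < lam ->
  polybound (fun x => x ^+ n.+1 * ln (lam * x ^+ 2)) (lam + 2 / Num.sqrt lam) n.+3.
Proof.
move=> l0 x x0; have s0 : 0 < Num.sqrt lam by rewrite sqrtr_gt0.
rewrite normrM ger0_norm; last by rewrite exprn_ge0// ltW.
rewrite (le_trans (ler_wpM2l _ (abs_ln_sqr_le l0 x0)))// ?exprn_ge0 ?(ltW x0)//.
rewrite [leLHS](_ : _ = lam * x ^+ n.+3 + 2 / Num.sqrt lam * x ^+ n); last first.
  by rewrite (exprSr x n.+2) (exprSr x n.+1) (exprSr x n); field; rewrite !gt_eqF.
rewrite [leRHS]mulrDl lerD// ler_wpM2l ?(ltW l0) ?divr_ge0 ?(ltW s0)// exprn_le_1D//.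
  by rewrite mul2n -addnn leq_addr.
by rewrite (@leq_trans n.+3)// ?mul2n -?addnn ?leq_addr// leqW// leqW.
Qed.

Lemma is_derive_ln_sqr lam x : 0 < lam -> 0 < x ->
  is_derive x 1 (fun y => ln (lam * y ^+ 2)) (2 / x).
Proof.
move=> l0 x0; have p : 0 < lam * x ^+ 2 by rewrite mulr_gt0// exprn_gt0.
have d1 : is_derive x 1 (fun y : R => lam * y ^+ 2) (2 * lam * x).
  apply: (is_derive_eq (is_derive_mul (is_derive_cst lam x 1) (is_derive_exprn 2 x))).
  by rewrite /= expr1; ring.
have d2 := @is_derive1_comp _ (@ln R) (fun y : R => lam * y ^+ 2) x _ _ (is_derive1_ln p) d1.
rewrite -[X in is_derive _ _ X _]/(@ln R \o (fun y : R => lam * y ^+ 2)).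
apply: (is_derive_eq d2).
by field; rewrite !gt_eqF.
Qed.

Lemma continuous_exprn_ln lam n x : 0 < lam -> 0 < x ->
  {for x, continuous (fun x => x ^+ n * ln (lam * x ^+ 2) * gw lam x)}.
Proof.
move=> l0 x0.
have c : {for x, continuous (fun y : R => ln (lam * y ^+ 2))}.
  apply: differentiable_continuous; apply/derivable1_diffP.
  by have [] := is_derive_ln_sqr l0 x0.
apply: cvgM; last exact: continuous_gw.
by apply: cvgM => //; exact: exprn_continuous.
Qed.

Lemma measurable_exprn_ln lam n :
  measurable_fun setT (fun x => x ^+ n * ln (lam * x ^+ 2)).
Proof.
apply: measurable_funM; first exact: measurable_funX.
apply: measurableT_comp; first exact: measurable_ln.
by apply: measurable_funM => //; exact: measurable_funX.
Qed.

Definition lnmom lam k := \int[mu]_(x in hl) (x ^+ k * ln (lam * x ^+ 2) * gw lam x).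

Lemma integrable_lnmom lam n : 0 < lam ->
  mu.-integrable hl (EFin \o (fun x => x ^+ n.+1 * ln (lam * x ^+ 2) * gw lam x)).
Proof.
move=> l0; apply: (integrable_polybound l0 _ (polybound_exprn_ln n l0)).
by apply: measurable_funTS; exact: measurable_exprn_ln.
Qed.

(** Integration by parts again; differentiating the logarithm produces the extra moment, which
    becomes the harmonic increment in [nlnmomS]. *)
Lemma lnmom_rec lam n : 0 < lam ->
  lnmom lam n.+3 = (n.+2%:R * lnmom lam n.+1 + 2 * hmom lam n.+1) / (2 * lam).
Proof.
move=> l0.
pose f1 x := x ^+ n.+1 * ln (lam * x ^+ 2) * gw lam x.
pose f2 x := x ^+ n.+1 * gw lam x.
pose f3 x := x ^+ n.+3 * ln (lam * x ^+ 2) * gw lam x.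
have i1 : mu.-integrable hl (EFin \o f1) by exact: integrable_lnmom.
have i2 : mu.-integrable hl (EFin \o f2) by exact: integrable_hmom.
have i3 : mu.-integrable hl (EFin \o f3) by exact: integrable_lnmom.
have h : (\int[mu]_(x in hl) (n.+2%:R * f1 x + 2 * f2 x - 2 * lam * f3 x) = 0)%R.
  rewrite /Rintegral (@integral_FTC_0y _ (fun x => x ^+ n.+2 * ln (lam * x ^+ 2) * gw lam x) _ 0 0) ?subr0//.
  - move=> x x0; apply: is_deriveP.
    apply: (is_derive_eq (is_derive_mul (is_derive_mul (is_derive_exprn n.+2 x)
      (is_derive_ln_sqr l0 x0)) (is_derive_gw lam x))).
    rewrite /f1 /f2 /f3 /= (exprS x n.+2) (exprS x n.+1).
    by field; rewrite gt_eqF.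
  - move=> x x0; apply: cvgB; last first.
      by apply: cvgM; [exact: cvg_cst|exact: continuous_exprn_ln].
    apply: cvgD; apply: cvgM; try exact: cvg_cst; first exact: continuous_exprn_ln.
    by apply: cvgM; [exact: exprn_continuous|exact: continuous_gw].
  - by apply: integrable_EFinB => //; [apply: integrable_EFinD => //|]; exact: integrable_EFinZ.
  - apply: (@cvg0_right_le _ _ (lam + 2 / Num.sqrt lam)) => x x0 x1.
    have s0 : 0 < Num.sqrt lam by rewrite sqrtr_gt0.
    rewrite normrM (ger0_norm (gw_ge0 _ _)) normrM ger0_norm ?exprn_ge0 ?(ltW x0)//.
    rewrite (@le_trans _ _ (x ^+ n.+2 * `|ln (lam * x ^+ 2)|))//.
      by rewrite ler_piMr ?gw_le1 ?(ltW l0)// mulr_ge0// exprn_ge0// ltW.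
    rewrite (le_trans (ler_wpM2l _ (abs_ln_sqr_le l0 x0)))// ?exprn_ge0 ?(ltW x0)//.
    rewrite [leLHS](_ : _ = (lam * x ^+ n.+3 + 2 / Num.sqrt lam * x ^+ n) * x); last first.
      rewrite (exprSr x n.+2) (exprSr x n.+1) (exprSr x n).
      by field; rewrite !gt_eqF.
    rewrite ler_wpM2r ?(ltW x0)// lerD//.
      by rewrite ler_piMr ?(ltW l0)// exprn_ile1 ?(ltW x0) ?(ltW x1).
    by rewrite ler_piMr ?divr_ge0 ?(ltW s0)// exprn_ile1 ?(ltW x0) ?(ltW x1).
  - exact: (cvgy_polybound l0 (@polybound_exprn_ln _ n.+1 l0)).
move: h; rewrite RintegralB//; last 2 first.
  by apply: integrable_EFinD => //; exact: integrable_EFinZ.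
  exact: integrable_EFinZ.
rewrite RintegralD//; try exact: integrable_EFinZ.
rewrite !RintegralZl// -/(lnmom lam n.+1) -/(lnmom lam n.+3) -/(hmom lam n.+1) => h.
have -> : n.+2%:R * lnmom lam n.+1 + 2 * hmom lam n.+1 = 2 * lam * lnmom lam n.+3 by lra.
by field; lra.
Qed.

(** With t = lam x^2 this is the integral of t^k e^(-t) ln t divided by k!, the mean logarithm of a
    Gamma(k+1) variable, that is, the digamma function at k + 1. *)
Definition nlnmom lam k := 2 * lam ^+ k.+1 / k`!%:R * lnmom lam (2 * k).+1.

Lemma nlnmomS lam k : 0 < lam -> nlnmom lam k.+1 = nlnmom lam k + k.+1%:R^-1.
Proof.
move=> l0; rewrite /nlnmom mulnS -[(2 + 2 * k).+1]/((2 * k).+3) lnmom_rec// hmom_odd//.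
rewrite factS natrM (_ : (2 * k).+2%:R = 2 * k.+1%:R :> R); last by rewrite -natrM mulnS.
have K0 : k.+1%:R != 0 :> R by rewrite pnatr_eq0.
have F0 : lam ^+ k != 0 by rewrite expf_neq0// gt_eqF.
have G0 : k`!%:R != 0 :> R by rewrite pnatr_eq0 -lt0n fact_gt0.
rewrite !exprS; move: (lam ^+ k) F0 k.+1%:R K0 k`!%:R G0 => a a0 b b0 c c0.
by field; rewrite c0 b0 a0 gt_eqF.
Qed.

Lemma nlnmom_harmonic lam k : 0 < lam ->
  nlnmom lam k = nlnmom lam 0 + \sum_(0 <= i < k) i.+1%:R^-1.
Proof.
move=> l0; elim: k => [|k ih]; first by rewrite big_geq// addr0.
by rewrite nlnmomS// ih big_nat_recr//= addrA.
Qed.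

(** Jensen for the concave logarithm: the tangent is taken at k + 1, the mean of the Gamma(k+1)
    variable. *)
Lemma nlnmom_le lam k : 0 < lam -> nlnmom lam k <= ln k.+1%:R.
Proof.
move=> l0; set m : R := k.+1%:R; have m0 : 0 < m by rewrite ltr0n.
have h : lnmom lam (2 * k).+1 <= (ln m - 1) * hmom lam (2 * k).+1 + lam / m * hmom lam (2 * k).+3.
  rewrite -!RintegralZl//; try exact: integrable_hmom.
  rewrite -RintegralD//; try by apply: integrable_EFinZ => //; exact: integrable_hmom.
  apply: le_Rintegral => //; first exact: integrable_lnmom.
    by apply: integrable_EFinD => //; apply: integrable_EFinZ => //; exact: integrable_hmom.
  move=> x; rewrite /= in_itv/= andbT => x0.
  have p : 0 < lam * x ^+ 2 by rewrite mulr_gt0// exprn_gt0.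
  rewrite -subr_ge0 (_ : _ - _ = x ^+ (2 * k).+1 * gw lam x *
    (ln m + lam * x ^+ 2 / m - 1 - ln (lam * x ^+ 2))).
    by rewrite mulr_ge0 ?subr_ge0 ?ln_le_tangent// mulr_ge0 ?gw_ge0// exprn_ge0// ltW.
  by rewrite (exprS x (2 * k).+2) (exprS x (2 * k).+1); field; rewrite gt_eqF.
rewrite /nlnmom (le_trans (ler_wpM2l _ h))//.
  by rewrite divr_ge0// mulr_ge0// exprn_ge0// ltW.
rewrite hmom_rec// hmom_odd// (_ : (2 * k).+2%:R = 2 * m :> R); last by rewrite -natrM mulnS.
have F0 : lam ^+ k.+1 != 0 by rewrite expf_neq0// gt_eqF.
have G0 : k`!%:R != 0 :> R by rewrite pnatr_eq0 -lt0n fact_gt0.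
rewrite le_eqVlt; apply/orP; left; apply/eqP.
have m00 : m != 0 by rewrite gt_eqF.
move: m {m0 h} m00 (lam ^+ k.+1) F0 k`!%:R G0 => m m00 a a0 c c0.
by field; rewrite c0 m00 a0 gt_eqF.
Qed.

(** The tangent inequality with its two points exchanged, ln t >= ln m + 1 - m / t, is exact in the
    mean here, since 1/t has mean 1 / (k+1) under Gamma(k+2). *)
Lemma nlnmom_ge lam k : 0 < lam -> ln k.+1%:R <= nlnmom lam k.+1.
Proof.
move=> l0; set m : R := k.+1%:R; have m0 : 0 < m by rewrite ltr0n.
have h : (ln m + 1) * hmom lam (2 * k).+3 - m / lam * hmom lam (2 * k).+1 <= lnmom lam (2 * k).+3.
  rewrite -!RintegralZl//; try exact: integrable_hmom.
  rewrite -RintegralB//; try by apply: integrable_EFinZ => //; exact: integrable_hmom.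
  apply: le_Rintegral => //; last 1 first.
  - move=> x; rewrite /= in_itv/= andbT => x0.
    have p : 0 < lam * x ^+ 2 by rewrite mulr_gt0// exprn_gt0.
    rewrite -subr_ge0 (_ : _ - _ = x ^+ (2 * k).+3 * gw lam x *
      (ln (lam * x ^+ 2) + m / (lam * x ^+ 2) - 1 - ln m)).
      by rewrite mulr_ge0 ?subr_ge0 ?ln_le_tangent// mulr_ge0 ?gw_ge0// exprn_ge0// ltW.
    by rewrite (exprS x (2 * k).+2) (exprS x (2 * k).+1); field; rewrite !gt_eqF.
  - by apply: integrable_EFinB => //; apply: integrable_EFinZ => //; exact: integrable_hmom.
  - exact: integrable_lnmom.
rewrite /nlnmom mulnS -[(2 + 2 * k).+1]/((2 * k).+3).
apply: le_trans (ler_wpM2l _ h); last first.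
  by rewrite divr_ge0// mulr_ge0// exprn_ge0// ltW.
rewrite hmom_rec// hmom_odd// (_ : (2 * k).+2%:R = 2 * m :> R); last by rewrite -natrM mulnS.
rewrite factS natrM -/m (exprS lam k.+1).
have F0 : lam ^+ k.+1 != 0 by rewrite expf_neq0// gt_eqF.
have G0 : k`!%:R != 0 :> R by rewrite pnatr_eq0 -lt0n fact_gt0.
rewrite le_eqVlt; apply/orP; left; apply/eqP.
have m00 : m != 0 by rewrite gt_eqF.
move: m {m0 h} m00 (lam ^+ k.+1) F0 k`!%:R G0 => m m00 a a0 c c0.
by field; rewrite c0 m00 a0 gt_eqF.
Qed.

(** The two logarithmic bounds trap H_n - ln n between a constant and that constant plus 1/n. The
    sequence is shifted by one so that ln 0 never occurs. *)
Lemma nlnmom0 lam : 0 < lam -> nlnmom lam 0 = - euler_gamma.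
Proof.
move=> l0; apply/eqP; rewrite -eqr_oppLR; apply/eqP; rewrite /euler_gamma.
apply/esym/cvg_lim => //.
rewrite -(cvg_shiftS (fun n : nat => _)).
apply: (@squeeze_cvgr _ _ _ _ (fun n => - nlnmom lam 0) (fun n => - nlnmom lam 0 + n.+1%:R^-1)).
- apply: nearW => n.
  have h1 := nlnmom_ge n l0; have h2 := nlnmom_le n.+1 l0.
  rewrite nlnmom_harmonic// in h1 h2.
  have h3 : ln n.+2%:R <= ln n.+1%:R + n.+1%:R^-1 :> R.
    have := @ln_le_tangent n.+1%:R n.+2%:R; rewrite !ltr0n => /(_ isT isT).
    have -> : n.+2%:R / n.+1%:R = 1 + n.+1%:R^-1 :> R.
      by rewrite -addn1 natrD mulrDl divff ?pnatr_eq0// div1r.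
    by rewrite -addrA [1 + _]addrC addrK.
  move: h1 h2 h3; rewrite /=; move: (\sum_(_ <= _ < _) _) (ln n.+2%:R) (ln n.+1%:R).
  by move: (n.+1%:R^-1) (nlnmom lam 0) => a b s l2 l1 ? ? ?; apply/andP; split; lra.
- exact: cvg_cst.
- rewrite -[X in _ --> X]addr0; apply: cvgD; first exact: cvg_cst.
  exact: cvg_harmonic.
Qed.

Lemma lnmom1 lam : 0 < lam -> lnmom lam 1 = - euler_gamma / (2 * lam).
Proof.
move=> l0; rewrite -(nlnmom0 l0) /nlnmom muln0 fact0 expr1.
by field; rewrite gt_eqF.
Qed.

End logmoments.

Ltac nzlra := repeat (apply/andP; split); apply: lt0r_neq0 => //; lra.

(** * Asymptotics of the modified Bessel function *)

Section bessel.
Context {R : realType}.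
Implicit Types u z : R.

Lemma EFin_nneseries (a : nat -> R) : (forall k, 0 <= a k) -> cvgn (series a) ->
  (limn (series a))%:E = (\sum_(0 <= k <oo) (a k)%:E)%E.
Proof.
move=> a0 ca; rewrite -EFin_lim//; congr (limn _); apply/funext => n.
by rewrite /series/= sumEFin.
Qed.

Definition bes_coeff u k : R := u ^+ k / k`!%:R ^+ 2.

(** This is I_0(2 sqrt u), so [bes (z ^+ 2 / 4)] is I_0(z). The argument u avoids square roots
    inside the density. *)
Definition bes u : R := limn (series (bes_coeff u)).

Lemma bes_coeff_ge0 u k : 0 <= u -> 0 <= bes_coeff u k.
Proof. by move=> u0; rewrite divr_ge0 ?exprn_ge0 ?sqr_ge0. Qed.

Lemma is_cvg_series_bes_coeff u : 0 <= u -> cvgn (series (bes_coeff u)).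
Proof.
move=> u0; apply: (series_le_cvg _ _ _ (is_cvg_series_exp_coeff u)).
- by move=> n; exact: bes_coeff_ge0.
- by move=> n; exact: exp_coeff_ge0.
move=> n; rewrite exp_coeffE/= [leRHS]mulrC /bes_coeff ler_wpM2l ?exprn_ge0//.
have f1 : 1 <= n`!%:R :> R by rewrite ler1n fact_gt0.
by rewrite lef_pV2 ?posrE ?exprn_gt0 ?(lt_le_trans ltr01 f1)// expr2 ler_peMl// (le_trans ler01).
Qed.

Lemma EFin_bes u : 0 <= u -> (bes u)%:E = (\sum_(0 <= k <oo) (bes_coeff u k)%:E)%E.
Proof.
move=> u0; apply: EFin_nneseries; last exact: is_cvg_series_bes_coeff.
by move=> k; exact: bes_coeff_ge0.
Qed.

Lemma nondecreasing_series_bes u : 0 <= u -> nondecreasing_seq (series (bes_coeff u)).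
Proof. by move=> u0; apply: nondecreasing_series => k _ _; exact: bes_coeff_ge0. Qed.

Lemma bes_ge1 u : 0 <= u -> 1 <= bes u.
Proof.
move=> u0; apply: (@le_trans _ _ (series (bes_coeff u) 1)).
  by rewrite /series/= big_nat1 /bes_coeff expr0 fact0 expr1n divr1.
by apply: nondecreasing_cvgn_le; [exact: nondecreasing_series_bes|exact: is_cvg_series_bes_coeff].
Qed.

Definition evs z k : R := z ^+ (2 * k) / (2 * k)`!%:R.
Definition ods z k : R := z ^+ (2 * k).+1 / (2 * k).+1`!%:R.

Lemma evs_ge0 z k : 0 <= evs z k.
Proof. by rewrite divr_ge0// exprM exprn_ge0// sqr_ge0. Qed.

Lemma ods_ge0 z k : 0 <= z -> 0 <= ods z k.
Proof. by move=> z0; rewrite divr_ge0// exprn_ge0. Qed.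

Lemma series_evsDods z n : series (evs z) n + series (ods z) n = series (exp_coeff z) (2 * n)%N.
Proof.
rewrite /series/=; elim: n => [|n ih]; first by rewrite !big_geq// addr0.
rewrite mulnS !big_nat_recr//= -ih /evs/ods !exp_coeffE/=; ring.
Qed.

Lemma series_evsBods z n : series (evs z) n - series (ods z) n = series (exp_coeff (- z)) (2 * n)%N.
Proof.
rewrite -series_evsDods; congr (_ + _).
  by congr (series _ n); apply/funext => k; rewrite /evs !exprM sqrrN.
rewrite /series/= -sumrN; apply: eq_bigr => k _.
by rewrite /ods !exprS !exprM sqrrN !mulNr.
Qed.

Lemma cvg_series_exp_even z : series (exp_coeff z) (2 * n)%N @[n --> \oo] --> expR z.
Proof.
have c : series (exp_coeff z) @ \oo --> expR z by exact: is_cvg_series_exp_coeff.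
apply: (cvg_comp (fun n => 2 * n)%N (series (exp_coeff z))); last exact: c.
by apply: cvg_mulnl.
Qed.

Lemma cvg_series_evs z : series (evs z) @ \oo --> (expR z + expR (- z)) / 2.
Proof.
rewrite [X in X @ _ --> _](_ : _ = (fun n => (series (exp_coeff z) (2 * n)%N +
   series (exp_coeff (- z)) (2 * n)%N) / 2)); last first.
  by apply/funext => n; rewrite -series_evsDods -series_evsBods; field.
by apply: cvgM; [apply: cvgD; exact: cvg_series_exp_even|exact: cvg_cst].
Qed.

Lemma cvg_series_ods z : series (ods z) @ \oo --> (expR z - expR (- z)) / 2.
Proof.
rewrite [X in X @ _ --> _](_ : _ = (fun n => (series (exp_coeff z) (2 * n)%N -
   series (exp_coeff (- z)) (2 * n)%N) / 2)); last first.
  by apply/funext => n; rewrite -series_evsDods -series_evsBods; field.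
by apply: cvgM; [apply: cvgB; exact: cvg_series_exp_even|exact: cvg_cst].
Qed.

(** I_0 is the cosh series weighted by [wallis]. Bounds on the weight that are affine in 2k+1, or in
    reciprocals of 2k+1 and (2k+1)(2k+2), therefore sum to cosh and sinh. *)
Lemma bes_coeff_sqr z k : bes_coeff (z ^+ 2 / 4) k = wallis k * evs z k.
Proof.
rewrite /bes_coeff /wallis /evs exprMn exprVn -exprM.
have F0 : 4 ^+ k != 0 :> R by rewrite expf_neq0.
have G0 : k`!%:R != 0 :> R by rewrite pnatr_eq0 -lt0n fact_gt0.
have H0 : (2 * k)`!%:R != 0 :> R by rewrite pnatr_eq0 -lt0n fact_gt0.
by field; rewrite F0 G0 H0.
Qed.

Section asymptotics.
Variables (z : R) (z0 : 0 < z).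
(** The approximate value of [wallis k] at 2k = z, where the terms of the cosh series are largest;
    both bounds below are tight there. *)
Let c := Num.sqrt (2 / (pi * z)).

Let c0 : 0 < c.
Proof. by rewrite sqrtr_gt0 divr_gt0// mulr_gt0// pi_gt0. Qed.

Let c2 : c ^+ 2 = 2 / (pi * z).
Proof. by rewrite sqr_sqrtr// divr_ge0// mulr_ge0 ?pi_ge0// ltW. Qed.

(** The convex function 1 / sqrt v lies above its tangent 3/2 - v/2 at v = 1, used at v = (2k+1) /
    z. *)
Let wallis_ge k : c * (3 / 2 - (2 * k).+1%:R / (2 * z)) <= wallis k.
Proof.
have /andP[h _] := @wallis_sqr_bounds R k.
set v : R := (2 * k).+1%:R / z.
have kz : 0 < (2 * k).+1%:R :> R by rewrite ltr0n.
have v0 : 0 < v by rewrite divr_gt0.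
set s := Num.sqrt v; have s0 : 0 < s by rewrite sqrtr_gt0.
have s2 : s ^+ 2 = v by rewrite sqr_sqrtr// ltW.
apply: (@le_trans _ _ (c / s)).
  rewrite ler_wpM2l ?(ltW c0)// -[leRHS]div1r ler_pdivlMr//.
  rewrite (_ : (2 * k).+1%:R / (2 * z) = s ^+ 2 / 2); last first.
    by rewrite s2 /v; field; rewrite gt_eqF.
  (* The tangent inequality for s = sqrt v, after clearing denominators: s^3 - 3 s + 2 has a double
     root at 1. *)
  have : 0 <= (s - 1) ^+ 2 * (s + 2) by rewrite mulr_ge0 ?sqr_ge0//; lra.
  by rewrite (_ : (s - 1) ^+ 2 * (s + 2) = s ^+ 3 - 3 * s + 2); [move=> ?; lra|ring].
rewrite -(ler_pXn2r (ltn0Sn 1)) ?nnegrE ?(ltW (wallis_gt0 _)) ?divr_ge0 ?(ltW c0) ?(ltW s0)//.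
rewrite -(ler_pM2l (pi_gt0 R)); apply: le_trans h.
rewrite expr_div_n c2 s2 /v (_ : (2 * k).+1%:R = 2 * k%:R + 1 :> R); last by rewrite -addn1 natrD natrM.
rewrite le_eqVlt; apply/orP; left; apply/eqP.
have p0 := pi_gt0 R.
have k0 : 0 <= k%:R :> R by [].
by field; nzlra.
Qed.

(** AM-GM in the form w <= c/2 + w^2 / (2c) replaces the weight by its square. The bound on the
    square is written with 1 / (2k+1) and 1 / ((2k+1)(2k+2)) because these factors only shift the
    index in the cosh series. *)
Let wallis_le k : wallis k <= c / 2 + (2 * c)^-1 *
  (2 / pi * ((2 * k).+1%:R^-1 + 2 / ((2 * k).+1%:R * (2 * k).+2%:R))).
Proof.
have /andP[_ h] := @wallis_sqr_bounds R k.
have p0 := pi_gt0 R.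
have k0 : 0 <= k%:R :> R by [].
apply: (@le_trans _ _ (c / 2 + (2 * c)^-1 * wallis k ^+ 2)).
  rewrite -subr_ge0 (_ : _ - _ = (2 * c)^-1 * (c - wallis k) ^+ 2).
    by rewrite mulr_ge0 ?sqr_ge0// invr_ge0 mulr_ge0// ltW.
  by field; rewrite gt_eqF.
rewrite lerD2l ler_wpM2l ?invr_ge0 ?mulr_ge0 ?(ltW c0)//.
rewrite -(ler_pM2l p0); apply: (le_trans h).
rewrite (_ : (2 * k).+2%:R = 2 * k%:R + 2 :> R); last by rewrite -addn2 natrD natrM.
rewrite (_ : (2 * k).+1%:R = 2 * k%:R + 1 :> R); last by rewrite -addn1 natrD natrM.
rewrite -subr_ge0 (_ : _ - _ = 4 * k%:R / (2 * k%:R + 1) ^+ 2 / (2 * k%:R + 2)); last first.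
  by field; nzlra.
by rewrite !divr_ge0 ?sqr_ge0 ?mulr_ge0 ?addr_ge0 ?mulr_ge0.
Qed.

(** The partial-sum form of (z cosh z)' = z sinh z + cosh z. *)
Let series_natS_evs n : \sum_(0 <= k < n.+1) (2 * k).+1%:R * evs z k =
  z * series (ods z) n + series (evs z) n.+1.
Proof.
rewrite /series/=; elim: n => [|n ih].
  by rewrite !big_nat1 big_geq// mulr0 add0r mul1r.
rewrite big_nat_recr//= ih [in RHS]big_nat_recr//= [in RHS](big_nat_recr n.+1)//=.
have e : (2 * n.+1).+1%:R * evs z n.+1 = z * ods z n + evs z n.+1.
  rewrite -natr1 mulrDl mul1r; congr (_ + _).
  rewrite /evs/ods mulnS (factS (2 * n).+1) natrM (exprS _ (2 * n).+1).
  have H0 : (2 * n).+1`!%:R != 0 :> R by rewrite pnatr_eq0 -lt0n fact_gt0.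
  have K0 : (2 + 2 * n)%:R != 0 :> R by [].
  rewrite -[(2 * n).+2]/(2 + 2 * n)%N; move: _%:R K0 _%:R H0 => a a0 b b0.
  by field; rewrite a0 b0.
by rewrite e; ring.
Qed.

Let C := (expR z + expR (- z)) / 2.
Let S := (expR z - expR (- z)) / 2.

Let series_evs_le n : series (evs z) n <= C.
Proof.
rewrite /C -(cvg_lim _ (@cvg_series_evs z))//; apply: nondecreasing_cvgn_le.
  by apply: nondecreasing_series => k _ _; exact: evs_ge0.
by apply/cvg_ex; exists C; exact: cvg_series_evs.
Qed.

Let series_ods_le n : series (ods z) n <= S.
Proof.
rewrite /S -(cvg_lim _ (@cvg_series_ods z))//; apply: nondecreasing_cvgn_le.
  by apply: nondecreasing_series => k _ _; exact/ods_ge0/ltW.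
by apply/cvg_ex; exists S; exact: cvg_series_ods.
Qed.

Let q := Num.sqrt (2 * pi * z).
Let q0 : 0 < q.
Proof. by rewrite sqrtr_gt0 !mulr_gt0// pi_gt0. Qed.

Let cE : c = 2 / q.
Proof.
apply/eqP; rewrite -(@eqrXn2 _ 2)// ?divr_ge0 ?(ltW c0) ?(ltW q0)//.
have p0 := pi_gt0 R.
rewrite c2 expr_div_n sqr_sqrtr; last by rewrite !mulr_ge0// ltW.
by apply/eqP; field; nzlra.
Qed.

Let zsqr_ge0 : 0 <= z ^+ 2 / 4.
Proof. by rewrite divr_ge0// sqr_ge0. Qed.

Lemma bes_ge : expR z / Num.sqrt (2 * pi * z) * (1 - z^-1) <= bes (z ^+ 2 / 4).
Proof.
apply: (@le_trans _ _ (c * (3 / 2 * C - (z * S + C) / (2 * z)))).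
  rewrite -/q cE /C /S -subr_ge0.
  have e1 : expR (- z) <= expR z by rewrite ler_expR -subr_ge0 opprK addr_ge0// ltW.
  rewrite (_ : _ - _ = q^-1 * (2 * expR (- z) + (expR z - expR (- z)) / (2 * z))).
    rewrite mulr_ge0 ?invr_ge0 ?(ltW q0)// addr_ge0 ?mulr_ge0 ?expR_ge0//.
      by rewrite subr_ge0.
    by rewrite invr_ge0 mulr_ge0// ltW.
  by field; rewrite !gt_eqF.
have lim1 : c * (3 / 2 * series (evs z) n.+1 - (z * series (ods z) n + series (evs z) n.+1) / (2 * z))
    @[n --> \oo] --> c * (3 / 2 * C - (z * S + C) / (2 * z)).
  have h1 : series (evs z) n.+1 @[n --> \oo] --> C.
    by rewrite (cvg_shiftS (series (evs z))); exact: cvg_series_evs.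
  have h2 := @cvg_series_ods z.
  apply: cvgM; first exact: cvg_cst.
  apply: cvgB; first by apply: cvgM => //; exact: cvg_cst.
  apply: cvgM; last exact: cvg_cst.
  by apply: cvgD => //; apply: cvgM => //; exact: cvg_cst.
rewrite -(cvg_lim _ lim1)//; apply: limr_le; first by apply/cvg_ex; eexists; exact: lim1.
apply: nearW => n; apply: (@le_trans _ _ (series (bes_coeff (z ^+ 2 / 4)) n.+1)); last first.
  by apply: nondecreasing_cvgn_le; [exact: nondecreasing_series_bes|exact: is_cvg_series_bes_coeff].
rewrite -series_natS_evs /series/= mulr_sumr mulr_suml -sumrB mulr_sumr.
apply: ler_sum => k _; rewrite bes_coeff_sqr.
rewrite (_ : c * _ = c * (3 / 2 - (2 * k).+1%:R / (2 * z)) * evs z k).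
  by rewrite ler_wpM2r ?evs_ge0.
by field; rewrite gt_eqF.
Qed.

Lemma bes_le : bes (z ^+ 2 / 4) <= expR z / Num.sqrt (2 * pi * z) * (1 + 2 / z).
Proof.
have p0 := pi_gt0 R.
apply: limr_le; first exact: is_cvg_series_bes_coeff.
apply: nearW => n.
pose h k := c / 2 * evs z k + (2 * c)^-1 * (2 / pi) * (z^-1 * ods z k + 2 / z ^+ 2 * evs z k.+1).
apply: (@le_trans _ _ (\sum_(0 <= k < n) h k)).
  apply: ler_sum => k _; rewrite bes_coeff_sqr.
  apply: (le_trans (ler_wpM2r (evs_ge0 _ _) (wallis_le k))).
  rewrite le_eqVlt /h; apply/orP; left; apply/eqP.
  rewrite mulrDl; congr (_ + _); rewrite -!mulrA; congr (_ * (_ * (_ * _))).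
  rewrite /evs /ods mulnS (factS (2 * k).+1) (factS (2 * k)) !natrM !exprS.
  have H0 : (2 * k)`!%:R != 0 :> R by rewrite pnatr_eq0 -lt0n fact_gt0.
  have K0 : (2 * k).+1%:R != 0 :> R by [].
  have K1 : (2 * k).+2%:R != 0 :> R by [].
  move: (2 * k).+2%:R K1 (2 * k).+1%:R K0 (2 * k)`!%:R H0 (z ^+ (2 * k)) => a a0 b b0 d d0 y.
  by field; rewrite a0 b0 d0 gt_eqF.
have -> : \sum_(0 <= k < n) h k = c / 2 * series (evs z) n + (2 * c)^-1 * (2 / pi) *
    (z^-1 * series (ods z) n + 2 / z ^+ 2 * \sum_(0 <= k < n) evs z k.+1).
  by rewrite /h /series/= big_split/= -!mulr_sumr big_split/= -!mulr_sumr.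
apply: (@le_trans _ _ (c / 2 * C + (2 * c)^-1 * (2 / pi) * (z^-1 * S + 2 / z ^+ 2 * C))).
  have cc := c0.
  have ee : \sum_(0 <= k < n) evs z k.+1 <= C.
    apply: le_trans (series_evs_le n.+1); rewrite /series/= big_nat_recl//= lerDr.
    exact: evs_ge0.
  rewrite lerD//; first by rewrite ler_wpM2l ?series_evs_le// divr_ge0// ltW.
  have k1 : 0 <= (2 * c)^-1 * (2 / pi).
    by rewrite mulr_ge0// ?divr_ge0 ?(ltW p0)// invr_ge0 mulr_ge0// ltW.
  rewrite (ler_wpM2l k1)// lerD// ler_wpM2l ?series_ods_le ?invr_ge0 ?(ltW z0)//.
  by rewrite divr_ge0// sqr_ge0.
have e2 : (2 * c)^-1 * (2 / pi) = c * z / 2.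
  have -> : c * z / 2 = c ^+ 2 * z / (2 * c) by field; rewrite gt_eqF.
  by rewrite c2; field; nzlra.
have e1 : expR (- z) <= expR z by rewrite ler_expR -subr_ge0 opprK addr_ge0// ltW.
rewrite e2 -/q cE /C /S -subr_ge0 (_ : _ - _ = (expR z - expR (- z)) / z / q); last first.
  by field; rewrite !gt_eqF.
by rewrite !divr_ge0 ?subr_ge0 ?(ltW z0) ?(ltW q0).
Qed.

(** The rate 1 / sqrt z is weaker than what the two bounds give for large z, but it holds down to z
    = 0 and has a finite mean under the density. *)
Lemma ln_bes_asymp :
  `|ln (bes (z ^+ 2 / 4)) - z + ln (2 * pi * z) / 2| <= 5 / Num.sqrt z.
Proof.
have p0 := pi_gt0 R.
have sz0 : 0 < Num.sqrt z by rewrite sqrtr_gt0.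
have sz2 : Num.sqrt z ^+ 2 = z by rewrite sqr_sqrtr// ltW.
have b1 := bes_ge1 zsqr_ge0; have b0 : 0 < bes (z ^+ 2 / 4) by exact: lt_le_trans b1.
have lq : ln (2 * pi * z) / 2 = ln q.
  rewrite -(sqr_sqrtr (_ : 0 <= 2 * pi * z)) -/q; last by rewrite !mulr_ge0// ltW.
  by rewrite lnXn// -[_ *+ 2]mulr_natr mulfK.
rewrite ler_norml; apply/andP; split; last first.
  have z20 : 0 < 1 + 2 / z by rewrite ltr_pwDl// divr_ge0// ltW.
  have : ln (bes (z ^+ 2 / 4)) <= ln (expR z / q * (1 + 2 / z)).
    by rewrite ler_ln ?posrE ?bes_le// mulr_gt0// divr_gt0// expR_gt0.
  rewrite lnM ?posrE ?divr_gt0 ?expR_gt0// ln_div ?posrE ?expR_gt0// expRK => h.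
  rewrite lq; apply: (@le_trans _ _ (ln (1 + 2 / z))); first by lra.
  (* The square dominates 1 + 2/z for every z > 0 and its logarithm is at most 4 / sqrt z. *)
  apply: (@le_trans _ _ (ln ((1 + 2 / Num.sqrt z) ^+ 2))).
    have w0 : 0 < 1 + 2 / Num.sqrt z by rewrite ltr_pwDl// divr_ge0// ltW.
    rewrite ler_ln ?posrE ?exprn_gt0//.
    rewrite -[in leLHS]sz2 -subr_ge0 (_ : _ - _ = 4 / Num.sqrt z + 2 / Num.sqrt z ^+ 2); last first.
      by field; rewrite gt_eqF.
    by rewrite addr_ge0// divr_ge0// ?sqr_ge0// ltW.
  rewrite lnXn ?ltr_pwDl// ?divr_ge0 ?(ltW sz0)// -[_ *+ 2]mulr_natl.
  have : ln (1 + 2 / Num.sqrt z) <= 2 / Num.sqrt z.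
    by rewrite le_ln1Dx// (@lt_le_trans _ _ 0)// divr_ge0// ltW.
  have : 0 < (Num.sqrt z)^-1 by rewrite invr_gt0.
  by move=> ? ?; lra.
(* For small z the factor 1 - 1/z of [bes_ge] may be negative. There I_0 >= 1 suffices: z <= 4 /
   sqrt z and - ln q <= 1 / sqrt z add up to the constant 5. *)
have [z2|z2] := leP 2 z.
  have zi : z^-1 <= 2^-1 by rewrite lef_pV2 ?posrE.
  have zi0 : 0 < z^-1 by rewrite invr_gt0.
  have : ln (expR z / q * (1 - z^-1)) <= ln (bes (z ^+ 2 / 4)).
    by rewrite ler_ln ?posrE ?bes_ge// mulr_gt0 ?divr_gt0 ?expR_gt0//; lra.
  rewrite lnM ?posrE ?divr_gt0 ?expR_gt0//; last by lra.
  rewrite ln_div ?posrE ?expR_gt0// expRK => h.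
  have h2 : - (2 * z^-1) <= ln (1 - z^-1).
    have zz : 0 < 1 - z^-1 by lra.
    have := @ln_le_tangent R (1 - z^-1) 1 zz ltr01; rewrite ln1 div1r => h3.
    have h4 : (1 - z^-1)^-1 <= 1 + 2 * z^-1.
      rewrite -[leLHS]div1r ler_pdivrMr// -subr_ge0.
      rewrite (_ : _ - _ = z^-1 * (1 - 2 * z^-1)); last by ring.
      by rewrite mulr_ge0 ?(ltW zi0)//; lra.
    by lra.
  have h5 : z^-1 <= (Num.sqrt z)^-1.
    rewrite lef_pV2 ?posrE// -[leRHS]sz2 expr2 ler_peMl ?(ltW sz0)//.
    by rewrite -sqrtr1 ler_sqrt//; lra.
  by rewrite lq; lra.
have l0 : 0 <= ln (bes (z ^+ 2 / 4)) by rewrite ln_ge0.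
have h1 : z <= 4 / Num.sqrt z.
  rewrite ler_pdivlMr// -[X in X * _]sz2 -exprSr.
  have s3 : Num.sqrt z ^+ 3 <= z ^+ 2 \/ Num.sqrt z <= 1.
    have [s1|s1] := leP (Num.sqrt z) 1; [by right|left].
    by rewrite -[in leRHS]sz2 -exprM ler_eXn2l.
  case: s3 => s3.
    apply: (le_trans s3); rewrite (_ : 4 = 2 ^+ 2) ?lerXn2r ?nnegrE ?(ltW z2) ?(ltW z0)//.
    by rewrite -natrX.
  by rewrite (le_trans (exprn_ile1 _ _ _))// ?(ltW sz0)// ler1n.
have h2 : - ln q <= (Num.sqrt z)^-1.
  rewrite -lnV ?posrE// (le_trans (ltW (ln_sublinear _))) ?invr_gt0//.
  rewrite lef_pV2 ?posrE// /q ler_sqrt; last by rewrite !mulr_ge0// ltW.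
  rewrite ler_peMl ?(ltW z0)//.
  by have := pi_ge2 R; lra.
by rewrite lq; lra.
Qed.
End asymptotics.
End bessel.

(** * The mixed moment series *)

Section series_bk.
Context {R : realType}.
Implicit Types x : R.

(** This is (Gamma(k + 3/2) / k!)^2; the series of [bk k] times x^k is pi/4 times the hypergeometric
    function 2F1(3/2, 3/2; 1; x). *)
Definition bk k : R := (k%:R + 2^-1) ^+ 2 * (pi * wallis k ^+ 2).

Lemma bk_bounds k : k%:R + 2^-1 <= bk k <= k%:R + 1.
Proof.
have /andP[h1 h2] := @wallis_sqr_bounds R k; have k0 : 0 <= k%:R :> R by [].
have p : 0 < (k%:R + 2^-1) ^+ 2 :> R by rewrite exprn_gt0//; lra.
apply/andP; split; rewrite /bk mulrC.
  by rewrite -ler_pdivrMr// (le_trans _ h1)// expr2 invfM mulrA divff ?mul1r//; nzlra.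
by rewrite -ler_pdivlMr.
Qed.

Lemma natr2S1 k : (2 * k).+1%:R = 2 * k%:R + 1 :> R.
Proof. by rewrite -addn1 natrD natrM. Qed.

Lemma natr2S2 k : (2 * k).+2%:R = 2 * k%:R + 2 :> R.
Proof. by rewrite -addn2 natrD natrM. Qed.

Lemma bkS k : bk k.+1 = bk k * ((k%:R + 3 / 2) / (k%:R + 1)) ^+ 2.
Proof.
have k0 : 0 <= k%:R :> R by [].
rewrite /bk wallisS natr2S2 natr2S1 -(addn1 k) natrD.
by field; nzlra.
Qed.

(** The quotient of [bk] by k + 3/4 is nonincreasing, and by [bk_bounds] it eventually exceeds 1 - e
    for every e > 0; hence it is at least 1 everywhere. *)
Lemma bk_ge k : k%:R + 3 / 4 <= bk k.
Proof.
have k0 j : 0 <= j%:R :> R by [].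
pose rho j := bk j / (j%:R + 3 / 4).
have rhoS j : rho j.+1 <= rho j.
  have /andP[/(le_trans _) b0 _] := bk_bounds j.
  have {}b0 : 0 <= bk j by apply: b0; have := k0 j; lra.
  rewrite /rho bkS -mulrA ler_wpM2l// -(addn1 j) natrD.
  rewrite -subr_ge0 (_ : _ - _ = (16 * (j%:R + 3 / 4) * (j%:R + 1) ^+ 2 * (j%:R + 1 + 3 / 4))^-1).
    by rewrite invr_ge0 !mulr_ge0 ?sqr_ge0//; have := k0 j; lra.
  by field; have := k0 j => ?; nzlra.
have rho_le j : rho (k + j)%N <= rho k.
  elim: j => [|j ih]; first by rewrite addn0.
  by rewrite addnS (le_trans (rhoS _)).
have rho1 : 1 <= rho k.
  apply/ler_addgt0Pr => e e0.
  (* The lower bound k + 1/2 falls short of k + 3/4 by 1/4, a relative error below e once j >= 1 /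
     (4 e). *)
  have [j je] : exists j : nat, 1 / (4 * e) <= j%:R.
    by exists (Num.truncn (1 / (4 * e))).+1; rewrite ltW// truncnS_gt.
  apply: (@le_trans _ _ (rho (k + j)%N + e)); last by rewrite lerD2r.
  have /andP[b0 _] := bk_bounds (k + j).
  rewrite ler_pdivrMr in je; last by rewrite mulr_gt0.
  have kj := k0 (k + j)%N.
  have d0 : 0 < (k + j)%:R + 3 / 4 :> R by lra.
  rewrite -lerBlDr /rho ler_pdivlMr//.
  apply: le_trans b0; rewrite mulrBl mul1r.
  have : 4^-1 <= e * ((k + j)%:R + 3 / 4).
    rewrite natrD; have : 0 <= e * (k%:R + 3 / 4) by rewrite mulr_ge0 ?(ltW e0)//; have := k0 k; lra.
    by move=> ?; nra.
  by move=> ?; lra.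
by rewrite -[leLHS]mul1r -ler_pdivlMr//; have := k0 k; lra.
Qed.

(** The mirror argument: with the correction 1 / (4 (k+1)) in the denominator the quotient becomes
    nondecreasing, so it stays below its limiting bound 1. *)
Lemma bk_le k : bk k <= k%:R + 3 / 4 + (4 * (k%:R + 1))^-1.
Proof.
have k0 j : 0 <= j%:R :> R by [].
have i0 j : 0 < (4 * (j%:R + 1))^-1 :> R.
  by rewrite invr_gt0 mulr_gt0// ltr_wpDl.
have dn j : 0 < j%:R + 3 / 4 + (4 * (j%:R + 1))^-1 :> R.
  by have := i0 j; have := k0 j; move=> ? ?; lra.
pose rho j := bk j / (j%:R + 3 / 4 + (4 * (j%:R + 1))^-1).
have rhoS j : rho j <= rho j.+1.
  have b0 : 0 <= bk j by apply: le_trans (bk_ge j); have := k0 j; lra.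
  rewrite /rho bkS -mulrA ler_wpM2l//.
  have := dn j.+1; rewrite -(addn1 j) natrD => d1.
  rewrite -[leLHS]div1r ler_pdivrMr// mulrAC ler_pdivlMr// mul1r.
  rewrite -subr_ge0 (_ : _ - _ = (7 * j%:R ^+ 2 + 18 * j%:R + 12) / (16 * (j%:R + 1) ^+ 3 * (j%:R + 2))); last first.
    by field; have := k0 j => ?; nzlra.
  by rewrite divr_ge0 ?mulr_ge0 ?addr_ge0 ?exprn_ge0 ?addr_ge0 ?mulr_ge0 ?sqr_ge0.
have rho_le j : rho k <= rho (k + j)%N.
  elim: j => [|j ih]; first by rewrite addn0.
  by rewrite addnS (le_trans ih).
have rho1 : rho k <= 1.
  apply/ler_addgt0Pr => e e0.
  have [j je] : exists j : nat, 1 / (4 * e) <= j%:R.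
    by exists (Num.truncn (1 / (4 * e))).+1; rewrite ltW// truncnS_gt.
  apply: (le_trans (rho_le j)).
  have /andP[_ b0] := bk_bounds (k + j).
  rewrite ler_pdivrMr in je; last by rewrite mulr_gt0.
  have kj := k0 (k + j)%N.
  rewrite /rho ler_pdivrMr//; apply: (le_trans b0); rewrite mulrDl mul1r.
  have : 4^-1 <= e * ((k + j)%:R + 3 / 4 + (4 * ((k + j)%:R + 1))^-1).
    apply: (@le_trans _ _ (e * j%:R)); first by lra.
    rewrite ler_wpM2l ?(ltW e0)// natrD.
    by have := i0 (k + j)%N; rewrite natrD; have := k0 k; move=> ? ?; lra.
  by have := i0 (k + j)%N => ? ?; lra.
by rewrite -[leRHS]mul1r -ler_pdivrMr.
Qed.

Section sums.
Variables (x : R) (x0 : 0 <= x) (x1 : x < 1).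
Let y := 1 - x.
Let y0 : 0 < y. Proof. by rewrite subr_gt0. Qed.

Let geo : series (fun k => x ^+ k) @ \oo --> y^-1.
Proof.
have := @cvg_geometric_series R 1 x; rewrite ger0_norm// => /(_ x1).
rewrite div1r (_ : geometric 1 x = fun k => x ^+ k)//.
by apply/funext => k; rewrite /geometric/= mul1r.
Qed.

Let geo_le n : series (fun k => x ^+ k) n <= y^-1.
Proof.
rewrite -(cvg_lim _ geo)//; apply: nondecreasing_cvgn_le.
  by apply: nondecreasing_series => k _ _; exact: exprn_ge0.
by apply/cvg_ex; exists y^-1.
Qed.

Let T := series (fun k => k.+1%:R * x ^+ k).

(** In the limit this recurrence becomes the fixed-point equation L = 1/y + x L, which forces L = 1
    / y^2. *)
Let TS n : T n.+1 = series (fun k => x ^+ k) n.+1 + x * T n.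
Proof.
rewrite /T/series/=; elim: n => [|n ih].
  by rewrite !big_nat1 big_geq// mulr0 addr0 mul1r.
have eT := @big_nat_recr _ 0 +%R n.+1 0 (fun k => k.+1%:R * x ^+ k) isT.
have eG := @big_nat_recr _ 0 +%R n.+1 0 (fun k => x ^+ k) isT.
have eU := @big_nat_recr _ 0 +%R n 0 (fun k => k.+1%:R * x ^+ k) isT.
rewrite /= in eT eG eU; rewrite eT eG ih; move: ih; rewrite eU => ih.
have h (S G X m : R) : S + m * X = G + x * S ->
    G + x * S + (m + 1) * (x * X) = G + x * X + x * (G + x * S).
  by move=> e; rewrite -[in x * (G + _)]e; ring.
by rewrite -(natr1 n.+1) exprS; exact: h ih.
Qed.

Let T_nd : nondecreasing_seq T.
Proof. by apply: nondecreasing_series => k _ _; rewrite mulr_ge0// exprn_ge0. Qed.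

Let T_le n : T n <= y^-1 / y.
Proof.
rewrite ler_pdivlMr//; have := TS n; have := T_nd (leqnSn n); have := geo_le n.+1.
by rewrite /y => ? ? ?; nra.
Qed.

Let T_cvg : T @ \oo --> y^-1 / y.
Proof.
have ct : cvgn T.
  apply: nondecreasing_is_cvgn => //.
  by exists (y^-1 / y) => _ [n _ <-]; exact: T_le.
suff -> : y^-1 / y = limn T by [].
have l1 : T n.+1 @[n --> \oo] --> limn T by rewrite (cvg_shiftS T); exact: ct.
have l2 : T n.+1 @[n --> \oo] --> y^-1 + x * limn T.
  rewrite (_ : (fun n => T n.+1) = fun n => series (fun k => x ^+ k) n.+1 + x * T n); last first.
    by apply/funext => n; rewrite TS.
  apply: cvgD; first by rewrite (cvg_shiftS (series _)); exact: geo.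
  by apply: cvgM => //; exact: cvg_cst.
have e : limn T = y^-1 + x * limn T by exact: cvg_unique l1 l2.
have e' : y^-1 = limn T * y.
  by rewrite /y mulrBr mulr1 mulrC {1}e addrK.
by rewrite [X in X / y]e' mulfK// gt_eqF.
Qed.

Lemma cvg_natS_expr : k.+1%:R * x ^+ k @[k --> \oo] --> 0.
Proof. by apply: (@cvg_series_cvg_0 _ R^o); apply/cvg_ex; exists (y^-1 / y); exact: T_cvg. Qed.

Let inv_sqr_le n : \sum_(0 <= k < n.+1) (k.+1%:R ^- 2) <= 2 - n.+1%:R^-1 :> R.
Proof.
elim: n => [|n ih]; first by rewrite big_nat1 expr1n invr1; lra.
rewrite big_nat_recr//=; apply: (@le_trans _ _ (2 - n.+1%:R^-1 + n.+2%:R ^- 2)).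
  by rewrite lerD2r.
rewrite -(addn1 n.+1) natrD; have : 0 < n.+1%:R :> R by [].
move: n.+1%:R => a a0.
rewrite -subr_ge0 (_ : _ - _ = (a * (a + 1) ^+ 2)^-1); last by field; nzlra.
by rewrite invr_ge0 mulr_ge0 ?sqr_ge0// ltW.
Qed.

Let a k := x ^+ k * bk k.

Lemma bk_term_ge0 k : 0 <= a k.
Proof. by rewrite mulr_ge0 ?exprn_ge0// (le_trans _ (bk_ge k))// addr_ge0. Qed.

Lemma is_cvg_series_bk : cvgn (series a).
Proof.
apply: (@series_le_cvg _ a (fun k => k.+1%:R * x ^+ k)).
- exact: bk_term_ge0.
- by move=> n; rewrite mulr_ge0// exprn_ge0.
- move=> k; rewrite /a mulrC ler_wpM2r ?exprn_ge0//.
  by have /andP[_] := bk_bounds k; rewrite natr1.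
- by apply/cvg_ex; exists (y^-1 / y); exact: T_cvg.
Qed.

Lemma series_bk_ge : (1 - x) ^- 2 - (4 * (1 - x))^-1 <= limn (series a).
Proof.
have l1 : T n - 4^-1 * series (fun k => x ^+ k) n @[n --> \oo] --> y^-1 / y - 4^-1 * y^-1.
  by apply: cvgB; [exact: T_cvg|apply: cvgM; [exact: cvg_cst|exact: geo]].
rewrite -/y (_ : _ - _ = y^-1 / y - 4^-1 * y^-1); last by field; nzlra.
rewrite -(cvg_lim _ l1)//; apply: ler_lim.
- by apply/cvg_ex; eexists; exact: l1.
- exact: is_cvg_series_bk.
apply: nearW => n; rewrite /T /series/= mulr_sumr -sumrB; apply: ler_sum => k _.
rewrite /a -mulrBl mulrC ler_wpM2l ?exprn_ge0// (le_trans _ (bk_ge k))//.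
by rewrite -natr1; lra.
Qed.

(** The correction terms x^k / (4 (k+1)) sum to a logarithm of y. AM-GM with weight h = sqrt y
    splits each into h x^k / 4 and 1 / (16 h (k+1)^2), whose sums are 1 / (4 h) and at most 1 / (8
    h). *)
Lemma series_bk_le :
  limn (series a) <= (1 - x) ^- 2 - (4 * (1 - x))^-1 + (Num.sqrt (1 - x))^-1.
Proof.
rewrite -/y; set h := Num.sqrt y.
have h0 : 0 < h by rewrite sqrtr_gt0.
have h2 : h ^+ 2 = y by rewrite sqr_sqrtr// ltW.
pose b k := k.+1%:R * x ^+ k - 4^-1 * x ^+ k + 4^-1 * (h * x ^+ k) + (16 * h)^-1 * (k.+1%:R ^- 2).
have ab k : a k <= b k.
  have xk0 : 0 <= x ^+ k by rewrite exprn_ge0.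
  have xk1 : x ^+ k <= 1 by rewrite exprn_ile1// ltW.
  apply: (@le_trans _ _ (x ^+ k * (k%:R + 3 / 4 + (4 * (k%:R + 1))^-1))).
    by rewrite ler_wpM2l// bk_le.
  rewrite /b natr1; have : 0 < k.+1%:R :> R by [].
  rewrite (_ : k%:R = k.+1%:R - 1 :> R); last by rewrite -natr1 addrK.
  move: k.+1%:R (x ^+ k) xk0 xk1 => m X X0 X1 m0.
  have h3 : X / (4 * m) <= 4^-1 * (h * X) + (16 * h)^-1 * m ^- 2.
    apply: (@le_trans _ _ (4^-1 * (h * X) + (16 * h)^-1 * m ^- 2 * X)).
      rewrite -subr_ge0 (_ : _ - _ = X / (16 * h) * (2 * h - m^-1) ^+ 2); last by field; nzlra.
      by rewrite mulr_ge0 ?sqr_ge0// divr_ge0// mulr_ge0// ltW.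
    by rewrite lerD2l ler_piMr// mulr_ge0 ?invr_ge0 ?sqr_ge0// mulr_ge0// ltW.
  have e1 : X * (m - 1 + 3 / 4 + (4 * m)^-1) = m * X - 4^-1 * X + X / (4 * m).
    by field; nzlra.
  by rewrite e1; lra.
apply: limr_le; first exact: is_cvg_series_bk.
apply: nearW => n; apply: (@le_trans _ _ (series a n.+1)).
  by apply: (nondecreasing_series (fun k _ _ => bk_term_ge0 k)).
apply: (@le_trans _ _ (\sum_(0 <= k < n.+1) b k)); first by apply: ler_sum.
rewrite /b 2!big_split/= -!mulr_sumr.
have u1 : \sum_(0 <= k < n.+1) (k.+1%:R * x ^+ k - 4^-1 * x ^+ k) <= y ^- 2 - (4 * y)^-1.
  have l1 : series (fun k => k.+1%:R * x ^+ k - 4^-1 * x ^+ k) @ \oo --> y^-1 / y - 4^-1 * y^-1.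
    rewrite (_ : series _ = fun n => T n - 4^-1 * series (fun k => x ^+ k) n).
      by apply: cvgB; [exact: T_cvg|apply: cvgM; [exact: cvg_cst|exact: geo]].
    by apply/funext => j; rewrite /T/series/= mulr_sumr -sumrB.
  rewrite (_ : _ - (4 * y)^-1 = y^-1 / y - 4^-1 * y^-1); last by field; nzlra.
  rewrite -(cvg_lim _ l1)//; apply: nondecreasing_cvgn_le; last first.
    by apply/cvg_ex; eexists; exact: l1.
  apply: nondecreasing_series => k _ _; rewrite -mulrBl mulr_ge0 ?exprn_ge0// subr_ge0.
  by rewrite (@le_trans _ _ 1)// ?ler1n// invf_le1// ler1n.
have u2 := geo_le n.+1; rewrite /series/= in u2.
have u3 : \sum_(0 <= k < n.+1) (k.+1%:R ^- 2) <= 2 :> R.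
  by apply: (le_trans (inv_sqr_le n)); rewrite gerDl oppr_le0 invr_ge0.
have u4 : 4^-1 * (h * \sum_(0 <= k < n.+1) x ^+ k) <= 4^-1 * h^-1.
  rewrite ler_wpM2l// (le_trans (ler_wpM2l (ltW h0) u2))// -h2.
  by rewrite expr2 invfM mulrA divff ?mul1r// gt_eqF.
have u5 : (16 * h)^-1 * \sum_(0 <= k < n.+1) (k.+1%:R ^- 2) <= 8^-1 * h^-1.
  apply: (@le_trans _ _ ((16 * h)^-1 * 2)).
    by rewrite ler_wpM2l// invr_ge0 mulr_ge0// ltW.
  by rewrite le_eqVlt; apply/orP; left; apply/eqP; field; nzlra.
have u6 : 0 < h^-1 by rewrite invr_gt0.
by move: u1 u4 u5 u6; move: (\sum_(_ <= _ < _) _) (4^-1 * _) ((16 * h)^-1 * _) => p1 p2 p3 ? ? ? ?; lra.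
Qed.

End sums.
End series_bk.

(** * Injectivity of the Laplace transform *)

Section weighted_pushforward.
Context d d' (T : measurableType d) (T' : measurableType d') (R : realType).
Variables (mu : {measure set T -> \bar R}) (V : T -> R) (S : T -> T').
Hypotheses (V0 : forall x, 0 <= V x) (iV : mu.-integrable setT (EFin \o V)).
Hypotheses (mS : measurable_fun setT S).

Let mV : measurable_fun setT V.
Proof. by apply/measurable_EFinP; exact: measurable_int iV. Qed.

(** The image under S of the measure with density V. The weight is what later carries a Laplace
    factor or an indicator of the other coordinate. *)
Definition wmeas (A : set T') : \bar R := (\int[mu]_(x in S @^-1` A) (V x)%:E)%E.

Let wmeas0 : wmeas set0 = 0%E.
Proof. by rewrite /wmeas preimage_set0 integral_set0. Qed.

Let wmeas_ge0 A : (0 <= wmeas A)%E.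
Proof. by apply: integral_ge0 => x _; rewrite lee_fin. Qed.

Let wmeas_sigma_additive : semi_sigma_additive wmeas.
Proof.
move=> F mF tF mUF; rewrite /wmeas preimage_bigcup.
have mSF k : measurable (S @^-1` F k) by rewrite -[X in measurable X]setTI; exact: mS.
rewrite ge0_integral_bigcup//=.
- apply: is_cvg_ereal_nneg_natsum_cond => n _ _; exact: wmeas_ge0.
- by apply/measurable_EFinP; apply: measurable_funTS.
- by move=> x _; rewrite lee_fin.
- move=> i j _ _ [x [/= Fi Fj]]; apply: (tF i j) => //.
  by exists (S x).
Qed.

Lemma wmeas_measure : exists m : {measure set T' -> \bar R}, forall A, m A = wmeas A.
Proof.
exists (HB.pack_for (measure T' R) wmeas
  (isMeasure.Build _ _ _ wmeas wmeas0 wmeas_ge0 wmeas_sigma_additive)).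
by [].
Qed.

Lemma wmeas_ltoo A : measurable A -> (wmeas A < +oo)%E.
Proof.
move=> mA; apply: (@le_lt_trans _ _ (\int[mu]_x (V x)%:E)%E).
  apply: ge0_subset_integral => //; last by move=> x _; rewrite lee_fin.
  - by rewrite -[X in measurable X]setTI; exact: mS.
  - exact/measurable_EFinP.
by have /integrable_fin_num := iV => /(_ measurableT); rewrite fin_numElt => /andP[].
Qed.

End weighted_pushforward.

Section weighted_laplace.
Context d (T : measurableType d) (R : realType) (mu : {measure set T -> \bar R}).
Variables (V S : T -> R).
Hypotheses (V0 : forall x, 0 <= V x) (iV : mu.-integrable setT (EFin \o V)).
Hypotheses (mS : measurable_fun setT S) (S0 : forall x, 0 <= S x).

(** The power of 1 - e^(-c S) approximates the indicator of a ray in S when c and m grow together,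
    yet its integral is a finite combination of Laplace transform values. *)
Definition lapg (b c : R) m x :=
  V x * (expR (- (b * S x)) * (1 - expR (- (c * S x))) ^+ m).

Let mV : measurable_fun setT V.
Proof. by apply/measurable_EFinP; exact: measurable_int iV. Qed.

Let mexp (b : R) : measurable_fun setT (fun x => expR (- (b * S x))).
Proof.
apply: measurableT_comp; first exact: measurable_expR.
by apply: measurableT_comp => //; exact: measurable_funM.
Qed.

Lemma measurable_lapg b c m : measurable_fun setT (lapg b c m).
Proof.
apply: measurable_funM => //; apply: measurable_funM => //.
by apply: measurable_funX; apply: measurable_funB.
Qed.

Let exp01 (b : R) x : 0 <= b -> 0 <= expR (- (b * S x)) <= 1.
Proof. by move=> b0; rewrite expR_ge0 expR_le1 oppr_le0 mulr_ge0. Qed.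

Lemma lapg_ge0_le b c m x : 0 <= b -> 0 <= c -> 0 <= lapg b c m x <= V x.
Proof.
move=> b0 c0; have /andP[e0 e1] := exp01 x b0; have /andP[f0 f1] := exp01 x c0.
have g0 : 0 <= 1 - expR (- (c * S x)) by rewrite subr_ge0.
have g1 : 1 - expR (- (c * S x)) <= 1 by rewrite gerBl.
apply/andP; split; first by rewrite mulr_ge0// mulr_ge0// exprn_ge0.
by rewrite ler_piMr// mulr_ile1// ?exprn_ge0// exprn_ile1.
Qed.

Lemma integrable_lapg b c m : 0 <= b -> 0 <= c ->
  mu.-integrable setT (EFin \o lapg b c m).
Proof.
move=> b0 c0; apply: le_integrable iV => //.
  by apply/measurable_EFinP; exact: measurable_lapg.
move=> x _; have /andP[h0 h1] := lapg_ge0_le m x b0 c0.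
by rewrite lee_fin !ger0_norm.
Qed.

(** Expanding one factor 1 - e^(-c S) lowers m and shifts b; iterated down to m = 0, only values of
    the Laplace transform are left. *)
Lemma lapgS b c m : 0 <= b -> 0 <= c ->
  (\int[mu]_x (lapg b c m.+1 x)%:E =
   \int[mu]_x (lapg b c m x)%:E - \int[mu]_x (lapg (b + c) c m x)%:E)%E.
Proof.
move=> b0 c0; rewrite -integralB_EFin//; [|exact: integrable_lapg|]; last first.
  by apply: integrable_lapg => //; exact: addr_ge0.
apply: eq_integral => x _; rewrite -EFinB; congr (_%:E).
by rewrite /lapg mulrDl opprD expRD exprS; ring.
Qed.

Let cvg_lapg_ray (s : R) (b c : nat -> R) (m : nat -> nat) :
  (forall n, 0 <= b n) -> (forall n, 0 <= c n) ->
  (forall x, expR (- (b n * S x)) * (1 - expR (- (c n * S x))) ^+ m n @[n --> \oo] -->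
    (\1_(`]s, +oo[%classic : set R) (S x) : R)) ->
  (\int[mu]_x (lapg (b n) (c n) (m n) x)%:E)%E @[n --> \oo] -->
  (\int[mu]_(x in S @^-1` `]s, +oo[) (V x)%:E)%E.
Proof.
move=> b0 c0 lim; rewrite [X in _ --> X](_ : _ =
    \int[mu]_x (V x * \1_(`]s, +oo[%classic : set R) (S x))%:E)%E; last first.
  rewrite integral_mkcond; apply: eq_integral => x _; rewrite patchE indicE.
  rewrite (_ : (x \in _) = (S x \in (`]s, +oo[%classic : set R))); last first.
    by apply/idP/idP; rewrite !inE.
  by case: (S x \in _); rewrite ?mulr1 ?mulr0.
apply: (@dominated_cvg _ _ _ mu setT _ _ _ (EFin \o V)) => //.
- by move=> n; apply/measurable_EFinP; exact: measurable_lapg.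
- move=> x _; apply: cvg_EFin; first exact: nearW.
  by apply: cvgM; [exact: cvg_cst|exact: lim].
- move=> n x _ /=; have /andP[h0 h1] := lapg_ge0_le (m n) x (b0 n) (c0 n).
  by rewrite lee_fin ger0_norm.
Qed.

(** The scale ln 2 / s of the positive case is meaningless at s = 0; there a single factor 1 - e^(-n
    S) already tends to the indicator of S > 0. *)
Lemma cvg_lapg_ray0 : (\int[mu]_x (lapg 0 n%:R 1 x)%:E)%E @[n --> \oo] -->
  (\int[mu]_(x in S @^-1` `]0%R, +oo[) (V x)%:E)%E.
Proof.
apply: (@cvg_lapg_ray 0 (fun=> 0) (fun n => n%:R) (fun=> 1%N)) => //.
move=> x; rewrite indicE; have [sx|sx] := ltP 0 (S x); last first.
  have -> : S x = 0 by apply/eqP; rewrite eq_le sx S0.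
  rewrite memNset/=; last by rewrite in_itv/= ltxx.
  apply: cvg_near_cst; apply: nearW => n.
  by rewrite !mulr0 oppr0 expR0 subrr mulr0.
rewrite mem_set/= ?in_itv/= ?sx//.
rewrite (_ : (fun n => _) = (fun n => 1 - geometric 1 (expR (- S x)) n)); last first.
  apply/funext => n; rewrite mul0r oppr0 expR0 mul1r expr1 /geometric/= mul1r.
  by rewrite -expRM_natl mulrN.
have h : 1 - geometric 1 (expR (- S x)) n @[n --> \oo] --> (1 - 0 : R).
  apply: cvgB; first exact: cvg_cst.
  by apply: cvg_geometric; rewrite ger0_norm ?expR_ge0// expR_lt1 oppr_lt0.
by rewrite subr0 in h; exact: h.
Qed.

(** With q = 2^(-S/s) the factor is (1 - q^n)^(n 2^n), and the threshold S = s is 2q = 1. The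
    exponent carries an additional n so that at the threshold itself the limit is 0, as the open ray
    requires. *)
Lemma cvg_lapg_raygt0 (s : R) : 0 < s ->
  (\int[mu]_x (lapg 0 (ln 2 / s * n%:R) (n * 2 ^ n) x)%:E)%E @[n --> \oo] -->
  (\int[mu]_(x in S @^-1` `]s, +oo[) (V x)%:E)%E.
Proof.
move=> s0; have l2 : 0 < ln 2 :> R by rewrite ln_gt0// ltr1n.
apply: (@cvg_lapg_ray s (fun=> 0) (fun n => ln 2 / s * n%:R) (fun n => n * 2 ^ n)%N) => //.
  by move=> n; rewrite mulr_ge0// divr_ge0// ltW.
move=> x; pose q := expR (- (ln 2 / s * S x)).
have q0 : 0 < q by exact: expR_gt0.
have q1 : q <= 1 by rewrite expR_le1 oppr_le0 mulr_ge0// divr_ge0// ltW.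
rewrite (_ : (fun n => _) = fun n => (1 - q ^+ n) ^+ (n * 2 ^ n)); last first.
  apply/funext => n; rewrite mul0r oppr0 expR0 mul1r; congr ((1 - _) ^+ _); rewrite /q -expRM_natl; congr expR; ring.
have qn01 n : 0 <= q ^+ n <= 1 by rewrite exprn_ge0 ?(ltW q0)// exprn_ile1// ltW.
have half : expR (- ln 2) = 2^-1 :> R by rewrite expRN lnK// posrE.
rewrite indicE; have [sx|sx] := ltP s (S x).
  rewrite mem_set/= ?in_itv/= ?sx//.
  have q2 : 2 * q < 1.
    rewrite -ltr_pdivlMl// mulr1 -half /q ltr_expR ltrN2 mulrAC ltr_pdivlMr//.
    by rewrite ltr_pM2l.
  have q20 : 0 <= 2 * q by rewrite mulr_ge0// ltW.
  apply: (@squeeze_cvgr _ _ _ _ (fun n => 1 - n.+1%:R * (2 * q) ^+ n) (fun=> 1)).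
  - apply: nearW => n; have /andP[a0 a1] := qn01 n; apply/andP; split; last first.
      by rewrite exprn_ile1 ?subr_ge0// gerBl.
    apply: (@le_trans _ _ (1 - (n * 2 ^ n)%:R * q ^+ n)).
      rewrite lerD2l lerN2 natrM natrX -mulrA -exprMn ler_wpM2r ?exprn_ge0//.
      by rewrite ler_nat.
    (* Bernoulli's inequality, by induction on the exponent. *)
    elim: (n * 2 ^ n)%N => [|k ih]; first by rewrite mul0r subr0 expr0.
    rewrite exprS; apply: (@le_trans _ _ ((1 - q ^+ n) * (1 - k%:R * q ^+ n))); last first.
      by rewrite ler_wpM2l// subr_ge0.
    rewrite -natr1 -subr_ge0 (_ : _ - _ = k%:R * (q ^+ n) ^+ 2); last by ring.
    by rewrite mulr_ge0// sqr_ge0.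
  - have h : 1 - n.+1%:R * (2 * q) ^+ n @[n --> \oo] --> (1 - 0 : R).
      by apply: cvgB; [exact: cvg_cst|exact: cvg_natS_expr].
    by rewrite subr0 in h; exact: h.
  - exact: cvg_cst.
rewrite memNset/=; last by rewrite in_itv/= andbT; apply/negP; rewrite -leNgt.
have q2 : 1 <= 2 * q.
  rewrite -ler_pdivrMl// mulr1 -half /q ler_expR lerN2 mulrAC ler_pdivrMr//.
  by rewrite ler_pM2l.
apply: (@squeeze_cvgr _ _ _ _ (fun=> 0) (geometric 1 (expR (- 1)))).
- apply: nearW => n; have /andP[a0 a1] := qn01 n; apply/andP; split.
    by rewrite exprn_ge0// subr_ge0.
  (* From 1 - u <= e^(-u) the power is at most exp(- n (2q)^n), hence at most e^(-n) because 2q >=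
     1. *)
  apply: (@le_trans _ _ (expR (- q ^+ n) ^+ (n * 2 ^ n))).
    by rewrite lerXn2r ?nnegrE ?expR_ge0 ?subr_ge0//; exact: expR_ge1Dx.
  rewrite /geometric/= mul1r -[expR (- q ^+ n) ^+ _]expRM_natl -[expR (-1) ^+ n]expRM_natl ler_expR mulrN mulrN1 lerN2.
  rewrite (_ : _ * _ = n%:R * (2 * q) ^+ n); last by rewrite natrM natrX exprMn mulrA.
  by rewrite ler_peMr// exprn_ege1.
- exact: cvg_cst.
- by apply: cvg_geometric; rewrite ger0_norm ?expR_ge0// expR_lt1 oppr_lt0.
Qed.

End weighted_laplace.

Section laplace_unique.
Context d1 (T1 : measurableType d1) d2 (T2 : measurableType d2) (R : realType).
Variables (mu1 : {measure set T1 -> \bar R}) (mu2 : {measure set T2 -> \bar R}).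
Variables (V1 S1 : T1 -> R) (V2 S2 : T2 -> R).
Hypotheses (V10 : forall x, 0 <= V1 x) (iV1 : mu1.-integrable setT (EFin \o V1)).
Hypotheses (V20 : forall x, 0 <= V2 x) (iV2 : mu2.-integrable setT (EFin \o V2)).
Hypotheses (mS1 : measurable_fun setT S1) (S10 : forall x, 0 <= S1 x).
Hypotheses (mS2 : measurable_fun setT S2) (S20 : forall x, 0 <= S2 x).
Hypothesis lap : forall a : R, 0 <= a ->
  (\int[mu1]_x (V1 x * expR (- (a * S1 x)))%:E =
   \int[mu2]_x (V2 x * expR (- (a * S2 x)))%:E)%E.

Let eq_lapg b c m : 0 <= b -> 0 <= c ->
  (\int[mu1]_x (lapg V1 S1 b c m x)%:E = \int[mu2]_x (lapg V2 S2 b c m x)%:E)%E.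
Proof.
move=> + c0; elim: m b => [|m ih] b b0.
  by under eq_integral do rewrite /lapg expr0 mulr1; rewrite lap//;
     under [RHS]eq_integral do rewrite /lapg expr0 mulr1.
by rewrite !lapgS// ih// ih// addr_ge0.
Qed.

Let eq_ray (s : R) : (\int[mu1]_(x in S1 @^-1` `]s, +oo[) (V1 x)%:E =
  \int[mu2]_(x in S2 @^-1` `]s, +oo[) (V2 x)%:E)%E.
Proof.
have [s0|s0|<-] := ltgtP 0 s.
- have l2 : 0 < ln 2 :> R by rewrite ln_gt0// ltr1n.
  have h1 := cvg_lapg_raygt0 V10 iV1 mS1 S10 s0.
  have h2 := cvg_lapg_raygt0 V20 iV2 mS2 S20 s0.
  have e : (fun n => \int[mu1]_x (lapg V1 S1 0 (ln 2 / s * n%:R) (n * 2 ^ n) x)%:E)%E =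
      (fun n => \int[mu2]_x (lapg V2 S2 0 (ln 2 / s * n%:R) (n * 2 ^ n) x)%:E)%E.
    by apply/funext => n; rewrite eq_lapg// mulr_ge0// divr_ge0// ltW.
  by rewrite e in h1; exact: cvg_unique h1 h2.
- have -> : S1 @^-1` `]s, +oo[ = setT.
    by apply/seteqP; split => // x _ /=; rewrite in_itv/= andbT (lt_le_trans s0).
  have -> : S2 @^-1` `]s, +oo[ = setT.
    by apply/seteqP; split => // x _ /=; rewrite in_itv/= andbT (lt_le_trans s0).
  have := lap (lexx 0).
  under eq_integral do rewrite mul0r oppr0 expR0 mulr1.
  by under [in X in _ = X -> _]eq_integral do rewrite mul0r oppr0 expR0 mulr1.
- have h1 := cvg_lapg_ray0 V10 iV1 mS1 S10.
  have h2 := cvg_lapg_ray0 V20 iV2 mS2 S20.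
  have e : (fun n => \int[mu1]_x (lapg V1 S1 0 n%:R 1 x)%:E)%E =
      (fun n => \int[mu2]_x (lapg V2 S2 0 n%:R 1 x)%:E)%E.
    by apply/funext => n; rewrite eq_lapg.
  by rewrite e in h1; exact: cvg_unique h1 h2.
Qed.

(** Open upper rays are closed under intersection and generate the Borel sets; the rays from -n
    exhaust the line with finite mass. *)
Lemma laplace_unique (A : set R) : measurable A ->
  (\int[mu1]_(x in S1 @^-1` A) (V1 x)%:E = \int[mu2]_(x in S2 @^-1` A) (V2 x)%:E)%E.
Proof.
move=> mA.
have [m1 m1E] := wmeas_measure V10 iV1 mS1.
have [m2 m2E] := wmeas_measure V20 iV2 mS2.
rewrite -/(wmeas mu1 V1 S1 A) -/(wmeas mu2 V2 S2 A) -m1E -m2E.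
apply: (measure_unique (RGenOInfty.G (R := R)) (fun n : nat => `](- n%:R)%R, +oo[%classic) _ _ _ _ m1 m2) => //.
- exact: RGenOInfty.measurableE.
- move=> _ _ [a ->] [b ->]; exists (Num.max a b).
  by apply/seteqP; split => x /=; rewrite !in_itv/= !andbT gt_max => /andP.
- by move=> n; exists (- n%:R).
- apply/seteqP; split => // x _; exists (Num.truncn `|x|).+1 => //=.
  rewrite in_itv/= andbT ltrNl (le_lt_trans (ler_norm _))// normrN.
  exact: truncnS_gt.
- by move=> _ [a ->]; rewrite m1E m2E; exact: eq_ray.
- by move=> n; rewrite m1E wmeas_ltoo.
Qed.
End laplace_unique.

(** * The bivariate Rayleigh density *)

Section tonelli_products.
Context {R : realType}.
Notation mu := (@lebesgue_measure R).
Local Notation hl := (`](0%R : R), +oo[%classic).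

(** A real factor in place of a domain of integration, so that integrals over the open quadrant
    become integrals over the whole plane. *)
Definition hind (x : R) : R := ((0 < x)%R)%:R.

Lemma hindE : hind = \1_hl.
Proof.
apply/funext => x; rewrite indicE /hind; congr ((_ : bool)%:R).
by apply/idP/idP; rewrite inE/= in_itv/= andbT.
Qed.

Lemma hind_ge0 (x : R) : 0 <= hind x. Proof. by []. Qed.

Lemma measurable_hind : measurable_fun setT hind.
Proof. by rewrite hindE; exact: measurable_indic. Qed.

Lemma integral_hindM (g : R -> R) :
  (\int[mu]_x (hind x * g x)%:E = \int[mu]_(x in hl) (g x)%:E)%E.
Proof.
rewrite hindE [RHS]integral_mkcond; apply: eq_integral => x _.
by rewrite patchE indicE; case: (x \in _); rewrite ?mul1r ?mul0r.
Qed.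

Lemma measurable_fun1 (h : R -> R) : measurable_fun setT h ->
  measurable_fun setT (fun z : R * R => h z.1).
Proof. by move=> mh; apply: (measurableT_comp mh). Qed.

Lemma measurable_fun2 (h : R -> R) : measurable_fun setT h ->
  measurable_fun setT (fun z : R * R => h z.2).
Proof. by move=> mh; apply: (measurableT_comp mh). Qed.

Lemma integral_prodM (h1 h2 : R -> R) :
  (forall x, 0 <= h1 x) -> (forall x, 0 <= h2 x) ->
  measurable_fun setT h1 -> measurable_fun setT h2 ->
  (\int[(mu \x mu)%E]_z (h1 z.1 * h2 z.2)%:E =
   \int[mu]_x (h1 x)%:E * \int[mu]_y (h2 y)%:E)%E.
Proof.
move=> h10 h20 m1 m2.
rewrite fubini_tonelli1//=; last 2 first.
- apply/measurable_EFinP; apply: measurable_funM; first exact: measurable_fun1.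
  exact: measurable_fun2.
- by move=> z; rewrite lee_fin mulr_ge0.
rewrite /fubini_F/= -ge0_integralZr//; last 3 first.
- exact/measurable_EFinP.
- by move=> x _; rewrite lee_fin.
- by apply: integral_ge0 => y _; rewrite lee_fin.
apply: eq_integral => x _; rewrite -ge0_integralZl//; last 3 first.
- exact/measurable_EFinP.
- by move=> y _; rewrite lee_fin.
- by rewrite lee_fin.
Qed.

Definition pw (lam : R) n (x : R) := hind x * (x ^+ n * gw lam x).

Lemma pw_ge0 lam n x : 0 <= pw lam n x.
Proof.
rewrite /pw /hind; have [x0|x0] := ltP 0 x; last by rewrite mul0r.
by rewrite mul1r mulr_ge0 ?gw_ge0// exprn_ge0// ltW.
Qed.

Lemma measurable_pw lam n : measurable_fun setT (pw lam n).
Proof.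
apply: measurable_funM; first exact: measurable_hind.
by apply: measurable_funM; [exact: measurable_funX|exact: measurable_gw].
Qed.

Lemma integral_pw lam n : 0 < lam -> (\int[mu]_x (pw lam n x)%:E = (hmom lam n)%:E)%E.
Proof. by move=> l0; rewrite integral_hindM hmomE. Qed.

Lemma pwM lam n m x : pw lam n x * x ^+ m = pw lam (n + m) x.
Proof. by rewrite /pw exprD; ring. Qed.

Lemma pw_gw lam n a x : pw lam n x * expR (- (a * x ^+ 2)) = pw (lam + a) n x.
Proof.
rewrite /pw /gw -!mulrA -expRD; congr (_ * (_ * expR _)); ring.
Qed.

Lemma bes_coeffM (t u v : R) k :
  bes_coeff (t * (u ^+ 2 * v ^+ 2)) k = t ^+ k / k`!%:R ^+ 2 * (u ^+ (2 * k) * v ^+ (2 * k)).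
Proof. by rewrite /bes_coeff exprMn (exprMn k (u ^+ 2)) -!exprM; ring. Qed.

Lemma EFin_geometric (q : R) : 0 <= q -> q < 1 ->
  (\sum_(0 <= k <oo) (q ^+ k)%:E = ((1 - q)^-1)%:E)%E.
Proof.
move=> q0 q1; have := @cvg_geometric_series R 1 q; rewrite ger0_norm// => /(_ q1).
rewrite div1r (_ : geometric 1 q = fun k => q ^+ k); last first.
  by apply/funext => k; rewrite /geometric/= mul1r.
move=> h; rewrite -EFin_nneseries ?(cvg_lim _ h)//.
by move=> k; exact: exprn_ge0.
Qed.

End tonelli_products.

Section density.
Context {R : realType}.
Notation mu := (@lebesgue_measure R).
Local Notation hl := (`](0%R : R), +oo[%classic).

Definition detD (SA SE c : R) : R := SA * SE - c.
Definition th2 (SA SE c : R) : R := c / detD SA SE c ^+ 2.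

(** The exponential is split between the two [pw] factors, so that each term of the Bessel series is
    a function of x times a function of y. With [th2] equal to c / D^2, the Bessel factor is I_0(2
    sqrt c x y / D). *)
Definition ray2 (SA SE c x y : R) : R :=
  4 / detD SA SE c * pw (SE / detD SA SE c) 1 x * pw (SA / detD SA SE c) 1 y *
  bes (th2 SA SE c * (x ^+ 2 * y ^+ 2)).

Lemma ray2_sym SA SE c x y : ray2 SA SE c x y = ray2 SE SA c y x.
Proof.
have e : detD SE SA c = detD SA SE c by rewrite /detD mulrC.
by rewrite /ray2 /th2 e (mulrC (y ^+ 2)); ring.
Qed.

Variables (SA SE c : R).
Hypotheses (SA0 : 0 < SA) (SE0 : 0 < SE) (c0 : 0 <= c) (cD : c < SA * SE).
Local Notation D := (detD SA SE c).
Local Notation al := (SE / D).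
Local Notation be := (SA / D).
Local Notation t2 := (th2 SA SE c).
Local Notation f0 := (ray2 SA SE c).

Let D0 : 0 < D. Proof. by rewrite subr_gt0. Qed.
Let al0 : 0 < al. Proof. exact: divr_gt0. Qed.
Let be0 : 0 < be. Proof. exact: divr_gt0. Qed.
Let th20 : 0 <= t2. Proof. by rewrite divr_ge0// sqr_ge0. Qed.

Let det_albe : al * be - t2 = D^-1.
Proof.
have e : c = SA * SE - D by rewrite /detD; lra.
transitivity (D / D ^+ 2); last by field; nzlra.
rewrite [X in _ = X / _]/detD /th2; move: D D0 => d d0; field; nzlra.
Qed.

Let arg_ge0 (x y : R) : 0 <= t2 * (x ^+ 2 * y ^+ 2).
Proof. by rewrite mulr_ge0// mulr_ge0// sqr_ge0. Qed.

Definition ray2_term k (x y : R) : R := 4 / D * (t2 ^+ k / k`!%:R ^+ 2) *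
  pw al (2 * k).+1 x * pw be (2 * k).+1 y.

Let cst_ge0 k : 0 <= 4 / D * (t2 ^+ k / k`!%:R ^+ 2).
Proof. by rewrite mulr_ge0 ?divr_ge0 ?exprn_ge0// ltW. Qed.

Lemma ray2_term_ge0 k x y : 0 <= ray2_term k x y.
Proof. by rewrite /ray2_term mulr_ge0 ?pw_ge0// mulr_ge0 ?pw_ge0. Qed.

Lemma ray2_ge0 x y : 0 <= f0 x y.
Proof.
rewrite /ray2 mulr_ge0 ?(le_trans ler01 (bes_ge1 (arg_ge0 _ _)))//.
by rewrite mulr_ge0 ?pw_ge0// mulr_ge0 ?pw_ge0// divr_ge0// ltW.
Qed.

Lemma ray2_series x y : (f0 x y)%:E = (\sum_(0 <= k <oo) (ray2_term k x y)%:E)%E.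
Proof.
rewrite /ray2 EFinM EFin_bes// -nneseriesZl//; last first.
  by move=> k _; rewrite lee_fin bes_coeff_ge0.
apply: eq_eseriesr => k _; rewrite -EFinM; congr (_%:E).
rewrite /ray2_term bes_coeffM -!(add1n (2 * k)) -!pwM; ring.
Qed.

Lemma measurable_ray2_term k : measurable_fun setT (fun z : R * R => ray2_term k z.1 z.2).
Proof.
rewrite /ray2_term; apply: measurable_funM; last first.
  by apply: (@measurable_fun2 _ (pw be (2 * k).+1)); exact: measurable_pw.
apply: measurable_funM; first exact: measurable_cst.
by apply: (@measurable_fun1 _ (pw al (2 * k).+1)); exact: measurable_pw.
Qed.

Lemma measurable_ray2 : measurable_fun setT (fun z : R * R => f0 z.1 z.2).
Proof.
apply/measurable_EFinP; rewrite (_ : _ \o _ = fun z : R * R =>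
  (\sum_(0 <= k <oo) (ray2_term k z.1 z.2)%:E)%E); last first.
  by apply/funext => z /=; rewrite ray2_series.
apply: ge0_emeasurable_sum => [k z _ _|k _].
  by rewrite lee_fin ray2_term_ge0.
by apply/measurable_EFinP; exact: measurable_ray2_term.
Qed.

(** Tonelli applied to each term of the Bessel series. Signs are required only on the positive
    half-line so that the identity function qualifies, as E[X Y] needs. *)
Lemma integral_ray2M (g1 g2 : R -> R) :
  (forall x, 0 <= hind x * g1 x) -> (forall x, 0 <= hind x * g2 x) ->
  measurable_fun setT g1 -> measurable_fun setT g2 ->
  (\int[(mu \x mu)%E]_z (f0 z.1 z.2 * (g1 z.1 * g2 z.2))%:E =
   \sum_(0 <= k <oo) ((4 / D * (t2 ^+ k / k`!%:R ^+ 2))%:E *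
     (\int[mu]_x (pw al (2 * k).+1 x * g1 x)%:E *
      \int[mu]_y (pw be (2 * k).+1 y * g2 y)%:E)))%E.
Proof.
move=> g10 g20 mg1 mg2.
have pg lam n (g : R -> R) x : (forall x, 0 <= hind x * g x) -> 0 <= pw lam n x * g x.
  move=> /(_ x); rewrite /pw /hind; have [x0|x0] := ltP 0 x; last by rewrite !mul0r.
  by rewrite !mul1r => g0; rewrite !mulr_ge0 ?gw_ge0// exprn_ge0// ltW.
have gg x y : 0 <= pw al 1 x * pw be 1 y * (g1 x * g2 y).
  rewrite (_ : _ * _ = (pw al 1 x * g1 x) * (pw be 1 y * g2 y)); last by ring.
  by rewrite mulr_ge0// pg.
pose t k (z : R * R) := (4 / D * (t2 ^+ k / k`!%:R ^+ 2)) *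
   ((pw al (2 * k).+1 z.1 * g1 z.1) * (pw be (2 * k).+1 z.2 * g2 z.2)).
have t0 k z : 0 <= t k z by rewrite mulr_ge0// mulr_ge0// pg.
have mt k : measurable_fun setT (fun z => (pw al (2 * k).+1 z.1 * g1 z.1) * (pw be (2 * k).+1 z.2 * g2 z.2)).
  apply: measurable_funM.
    apply: (@measurable_fun1 _ (fun x => pw al (2 * k).+1 x * g1 x)).
    by apply: measurable_funM => //; exact: measurable_pw.
  apply: (@measurable_fun2 _ (fun x => pw be (2 * k).+1 x * g2 x)).
  by apply: measurable_funM => //; exact: measurable_pw.
transitivity (\int[(mu \x mu)%E]_z (\sum_(0 <= k <oo) (t k z)%:E))%E.
  apply: eq_integral => z _; rewrite /ray2.
  rewrite [X in X%:E](_ : _ = 4 / D * (pw al 1 z.1 * pw be 1 z.2 * (g1 z.1 * g2 z.2)) * bes (t2 * (z.1 ^+ 2 * z.2 ^+ 2))); last by ring.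
  rewrite EFinM EFin_bes// -nneseriesZl//; last first.
    by move=> k _; rewrite lee_fin bes_coeff_ge0.
  apply: eq_eseriesr => k _; rewrite -EFinM; congr (_%:E).
  by rewrite /t bes_coeffM -!(add1n (2 * k)) -!pwM; ring.
rewrite integral_nneseries//; last 2 first.
- move=> k; apply/measurable_EFinP; apply: measurable_funM => //.
  exact: mt.
- by move=> k z _; rewrite lee_fin.
apply: eq_eseriesr => k _.
under eq_integral do rewrite EFinM.
rewrite ge0_integralZl//; last 3 first.
- by apply/measurable_EFinP; exact: mt.
- by move=> z _; rewrite lee_fin mulr_ge0// pg.
- by rewrite lee_fin.
congr (_ * _)%E; rewrite (@integral_prodM _ (fun x => pw al (2 * k).+1 x * g1 x) (fun y => pw be (2 * k).+1 y * g2 y))//.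
- by move=> x; exact: pg.
- by move=> x; exact: pg.
- by apply: measurable_funM => //; exact: measurable_pw.
- by apply: measurable_funM => //; exact: measurable_pw.
Qed.

Lemma laplace_ray2 (a b : R) : 0 <= a -> 0 <= b ->
  (\int[(mu \x mu)%E]_z (f0 z.1 z.2 *
     (expR (- (a * z.1 ^+ 2)) * expR (- (b * z.2 ^+ 2))))%:E =
   (((1 + a * SA) * (1 + b * SE) - a * b * c)^-1)%:E)%E.
Proof.
move=> a0 b0.
have mexp (u : R) : measurable_fun setT (fun x : R => expR (- (u * x ^+ 2))).
  apply: measurableT_comp; first exact: measurable_expR.
  by apply: measurableT_comp => //; apply: measurable_funM => //; exact: measurable_funX.
rewrite (@integral_ray2M (fun x => expR (- (a * x ^+ 2))) (fun x => expR (- (b * x ^+ 2))))//; last 2 first.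
- by move=> x; rewrite mulr_ge0 ?hind_ge0 ?expR_ge0.
- by move=> x; rewrite mulr_ge0 ?hind_ge0 ?expR_ge0.
have A0 : 0 < al + a by rewrite ltr_pwDl.
have B0 : 0 < be + b by rewrite ltr_pwDl.
(* Odd moments cancel both factorials in the Bessel coefficients, leaving a geometric series of
   ratio q; q < 1 because al be - t2 = 1/D > 0. *)
pose q := t2 / ((al + a) * (be + b)).
have AB : 0 < (al + a) * (be + b) by rewrite mulr_gt0.
have q0 : 0 <= q by rewrite divr_ge0// ltW.
have tAB : t2 < (al + a) * (be + b).
  have : 0 < D^-1 by rewrite invr_gt0.
  have : al * be <= (al + a) * (be + b) by rewrite ler_pM ?(ltW al0) ?(ltW be0)// lerDl.
  by move: det_albe => e ? ?; lra.
have q1 : q < 1 by rewrite ltr_pdivrMr// mul1r.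
rewrite (eq_eseriesr (g := fun k => ((D * ((al + a) * (be + b)))^-1)%:E * (q ^+ k)%:E)%E); last first.
  move=> k _; under eq_integral do rewrite pw_gw.
  under [X in (_ * (_ * X))%E]eq_integral do rewrite pw_gw.
  rewrite !integral_pw// !hmom_odd// -!EFinM; congr (_%:E).
  have -> : q ^+ k = t2 ^+ k / ((al + a) ^+ k * (be + b) ^+ k).
    by rewrite /q expr_div_n (exprMn k (al + a)).
  rewrite (exprS (al + a)) (exprS (be + b)).
  have G0 : k`!%:R != 0 :> R by rewrite pnatr_eq0 -lt0n fact_gt0.
  have F0 : (al + a) ^+ k != 0 by rewrite expf_neq0// gt_eqF.
  have E0 : (be + b) ^+ k != 0 by rewrite expf_neq0// gt_eqF.
  move: (k`!%:R) G0 ((al + a) ^+ k) F0 ((be + b) ^+ k) E0 => g g0 u u0 v v0.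
  move: (al + a) A0 (be + b) B0 (t2 ^+ k) => A A0 B B0 w; move: D D0 => d d0.
  by field; rewrite g0 u0 v0 !gt_eqF.
rewrite nneseriesZl; last by move=> k _; rewrite lee_fin exprn_ge0.
rewrite EFin_geometric// -EFinM; congr (_%:E).
rewrite -invfM; congr (_^-1).
rewrite /q mulrBr mulr1 [X in _ - X](_ : _ = D * t2); last first.
  by move: ((al + a) * (be + b)) AB => w w0; field; rewrite gt_eqF.
have e1 : D * (al * be - t2) = 1 by rewrite det_albe divff// gt_eqF.
have e2 : D * al = SE by rewrite mulrC divfK// gt_eqF.
have e3 : D * be = SA by rewrite mulrC divfK// gt_eqF.
transitivity (D * (al * be - t2) + a * (D * be) + b * (D * al) + a * b * D); first by ring.
by rewrite e1 e2 e3 /detD; ring.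
Qed.

(** The additional factors x and y turn the odd moments into even ones, so Wallis factors appear
    squared and the series of [bk] results. *)
Lemma integral_ray2_XY : (\int[(mu \x mu)%E]_z (f0 z.1 z.2 * (z.1 * z.2))%:E =
  ((D * (al * be) * (Num.sqrt al * Num.sqrt be))^-1 *
   limn (series (fun k => (c / (SA * SE)) ^+ k * bk k)))%:E)%E.
Proof.
rewrite (@integral_ray2M id id)//; last 2 first.
- by move=> x; rewrite /hind; have [x0|x0] := ltP 0 x; rewrite ?mul1r ?mul0r// ltW.
- by move=> x; rewrite /hind; have [x0|x0] := ltP 0 x; rewrite ?mul1r ?mul0r// ltW.
set q := c / (SA * SE).
have SS : 0 < SA * SE by rewrite mulr_gt0.
have q0 : 0 <= q by rewrite divr_ge0// ltW.
have q1 : q < 1 by rewrite ltr_pdivrMr// mul1r.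
have qE : q = t2 / (al * be).
  by rewrite /q /th2; move: D D0 => d d0; field; rewrite !gt_eqF.
rewrite EFinM EFin_nneseries; last 2 first.
- by move=> k; exact: bk_term_ge0.
- exact: is_cvg_series_bk.
rewrite -nneseriesZl; last by move=> k _; rewrite lee_fin bk_term_ge0.
apply: eq_eseriesr => k _.
have e lam : (\int[mu]_x (pw lam (2 * k).+1 x * x)%:E = \int[mu]_x (pw lam (2 * k.+1) x)%:E)%E.
  apply: eq_integral => x _; rewrite -[X in _ * X]expr1 pwM.
  by rewrite addn1 mulnS.
rewrite !e !integral_pw// !hmom_even// -!EFinM; congr (_%:E).
rewrite wallisS natr2S1 natr2S2 factS natrM -[k.+1%:R]natr1 /bk qE.
have -> : (t2 / (al * be)) ^+ k = t2 ^+ k / (al ^+ k * be ^+ k).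
  by rewrite expr_div_n (exprMn k al).
have spi : Num.sqrt pi ^+ 2 = pi :> R by rewrite sqr_sqrtr// pi_ge0.
rewrite -[pi in RHS]spi (exprS al) (exprS be).
have G0 : k`!%:R != 0 :> R by rewrite pnatr_eq0 -lt0n fact_gt0.
have F0 : al ^+ k != 0 by rewrite expf_neq0// gt_eqF.
have E0 : be ^+ k != 0 by rewrite expf_neq0// gt_eqF.
have sa0 : 0 < Num.sqrt al by rewrite sqrtr_gt0.
have sb0 : 0 < Num.sqrt be by rewrite sqrtr_gt0.
have k0 : 0 <= k%:R :> R by [].
move: (k`!%:R) G0 (k%:R) k0 (wallis k) => g g0 m m0 w.
move: (al ^+ k) F0 (be ^+ k) E0 (t2 ^+ k) (Num.sqrt al) sa0 (Num.sqrt be) sb0 => u u0 v v0 t sa sa0 sb sb0.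
move: al al0 be be0 => a a0 b b0; move: D D0 => d d0.
have m1 : m + 1 != 0 by nzlra.
by field; rewrite g0 u0 v0 !gt_eqF//; lra.
Qed.

(** Integrating y out cancels one factorial in the Bessel coefficients, so an exponential in x^2
    remains; it corrects the rate from SE/D to SE/D - t2/be = 1/SA. *)
Lemma marginal_ray2 x : (\int[mu]_y (f0 x y)%:E = (2 / SA * pw SA^-1 1 x)%:E)%E.
Proof.
under eq_integral do rewrite ray2_series.
rewrite integral_nneseries//; last 2 first.
- move=> k; apply/measurable_EFinP; apply: measurable_funM; first exact: measurable_cst.
  exact: measurable_pw.
- by move=> k y _; rewrite lee_fin ray2_term_ge0.
pose K := 2 / (D * be) * pw al 1 x.
have K0 : 0 <= K.
  by rewrite mulr_ge0 ?pw_ge0// divr_ge0// mulr_ge0// ltW.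
pose u := t2 / be * x ^+ 2.
have u0 : 0 <= u by rewrite mulr_ge0 ?sqr_ge0// divr_ge0// ltW.
rewrite (eq_eseriesr (g := fun k => K%:E * (exp_coeff u k)%:E)%E); last first.
  move=> k _; under eq_integral do rewrite /ray2_term EFinM.
  rewrite ge0_integralZl//; last 3 first.
  - by apply/measurable_EFinP; exact: measurable_pw.
  - by move=> y _; rewrite lee_fin pw_ge0.
  - by rewrite lee_fin mulr_ge0 ?pw_ge0.
  rewrite integral_pw// hmom_odd// -!EFinM; congr (_%:E).
  rewrite /K exp_coeffE/= -(add1n (2 * k)) -pwM.
  have -> : u ^+ k = t2 ^+ k / be ^+ k * x ^+ (2 * k).
    by rewrite /u (exprMn k (t2 / be)) expr_div_n -exprM.
  rewrite (exprS be).
  have G0 : k`!%:R != 0 :> R by rewrite pnatr_eq0 -lt0n fact_gt0.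
  have E0 : be ^+ k != 0 by rewrite expf_neq0// gt_eqF.
  move: (k`!%:R) G0 (be ^+ k) E0 (t2 ^+ k) (x ^+ (2 * k)) (pw al 1 x) => g g0 v v0 t X p.
  move: be be0 => b b0; move: D D0 => d d0.
  by field; rewrite g0 v0 !gt_eqF.
rewrite nneseriesZl; last by move=> k _; rewrite lee_fin exp_coeff_ge0.
rewrite -EFin_nneseries; last 2 first.
- by move=> k; exact: exp_coeff_ge0.
- exact: is_cvg_series_exp_coeff.
rewrite -EFinM; congr (_%:E); rewrite /K -[limn _]/(expR u).
have -> : D * be = SA by rewrite mulrC divfK// gt_eqF.
rewrite -(mulrA (2 / SA)); congr (_ * _).
have -> : expR u = expR (- ((- (t2 / be)) * x ^+ 2)) by rewrite mulNr opprK.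
rewrite pw_gw; congr (pw _ _ _).
have e1 : D * (al * be - t2) = 1 by rewrite det_albe divff// gt_eqF.
have -> : al - t2 / be = D * (al * be - t2) / (D * be) by field; rewrite !gt_eqF.
by rewrite e1 (mulrC D) divfK ?gt_eqF// div1r.
Qed.

End density.

(** * Integrals with a known value, and reduction to marginals *)

Section has_int.
Context d (T : measurableType d) (R : realType) (mu : {measure set T -> \bar R}).
Implicit Types f g : T -> R.

(** Integrability travels with the value, so a long linear combination is integrated by nesting
    [has_intD] and [has_intZ]. *)
Definition has_int f (v : R) :=
  mu.-integrable setT (EFin \o f) /\ (\int[mu]_x (f x)%:E = v%:E)%E.

Lemma has_int_ext f g v : f =1 g -> has_int f v -> has_int g v.
Proof. by move=> /funext ->. Qed.

Lemma has_intD f g v w : has_int f v -> has_int g w -> has_int (fun x => f x + g x) (v + w).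
Proof.
move=> [fi fv] [gi gw]; split; first exact: integrable_EFinD.
have := @integralD_EFin _ _ _ mu setT measurableT f g fi gi => /= ->.
by rewrite fv gw.
Qed.

Lemma has_intZ k f v : has_int f v -> has_int (fun x => k * f x) (k * v).
Proof.
move=> [fi fv]; split; first exact: integrable_EFinZ.
by under eq_integral do rewrite EFinM; rewrite integralZl// fv.
Qed.

Lemma has_int_ge0 f v : (forall x, 0 <= f x) -> measurable_fun setT f ->
  (\int[mu]_x (f x)%:E = v%:E)%E -> has_int f v.
Proof.
move=> f0 mf fv; split => //; apply/integrableP; split; first exact/measurable_EFinP.
by under eq_integral do rewrite /= ger0_norm//; rewrite fv ltry.
Qed.

Lemma has_int_dom f g v : measurable_fun setT g -> (forall x, `|g x| <= f x) ->
  has_int f v -> exists w, has_int g w /\ `|w| <= v.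
Proof.
move=> mg gf [fi fv].
have gi : mu.-integrable setT (EFin \o g).
  apply: le_integrable fi => //; first exact/measurable_EFinP.
  by move=> x _ /=; rewrite lee_fin (le_trans (gf x))// ler_norm.
have gfin : (\int[mu]_x (g x)%:E)%E \is a fin_num by exact: integrable_fin_num.
exists (fine (\int[mu]_x (g x)%:E)%E); split; first by split => //; rewrite fineK.
rewrite -lee_fin -fv EFin_normr_Rintegral//.
apply: le_trans (le_abse_integral _ _ _) _ => //.
  by apply/measurable_EFinP.
apply: ge0_le_integral => //=.
- by apply/measurable_EFinP; apply: measurableT_comp.
- exact: measurable_int fi.
- by move=> x _; rewrite lee_fin.
Qed.

End has_int.

Section product_density.
Context {R : realType}.
Notation mu := (@lebesgue_measure R).
Variables (f : R -> R -> R) (m h : R -> R) (v : R).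
Hypotheses (f0 : forall x y, 0 <= f x y).
Hypothesis mf : measurable_fun setT (fun z : R * R => f z.1 z.2).
Hypothesis mh : measurable_fun setT h.
Hypothesis hv : has_int mu (fun x => m x * h x) v.

Let mfh1 : measurable_fun setT (fun z : R * R => f z.1 z.2 * h z.1).
Proof. by apply: measurable_funM => //; exact: measurable_fun1. Qed.

Let mfh2 : measurable_fun setT (fun z : R * R => f z.1 z.2 * h z.2).
Proof. by apply: measurable_funM => //; exact: measurable_fun2. Qed.

Let mfx x : measurable_fun setT (f x).
Proof. exact: (measurableT_comp mf (measurable_pair1 x)). Qed.

Let mfy y : measurable_fun setT (f ^~ y).
Proof. exact: (measurableT_comp mf (measurable_pair2 y)). Qed.

Lemma has_int_fst : (forall x, (\int[mu]_y (f x y)%:E = (m x)%:E)%E) ->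
  has_int (mu \x mu)%E (fun z => f z.1 z.2 * h z.1) v.
Proof.
move=> fm.
have fi x : has_int mu (f x) (m x) by apply: has_int_ge0 => //; exact: mfx.
have int : (mu \x mu)%E.-integrable setT (EFin \o (fun z : R * R => f z.1 z.2 * h z.1)).
  apply/integrable12ltyP; first exact/measurable_EFinP.
  have [/integrableP[_ +] _] := hv; apply: le_lt_trans.
  rewrite le_eqVlt; apply/orP; left; apply/eqP; apply: eq_integral => x _ /=.
  under eq_integral do rewrite normrM (ger0_norm (f0 _ _)) mulrC.
  have [_ ->] := has_intZ `|h x| (fi x); rewrite normrM mulrC; congr (_ * _)%:E.
  by rewrite ger0_norm// -lee_fin -fm integral_ge0// => y _; rewrite lee_fin.
split => //; rewrite -integral12_prod_meas1//; have [_ <-] := hv.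
apply: eq_integral => x _; rewrite /fubini_F/=.
under eq_integral do rewrite mulrC.
by have [_ ->] := has_intZ (h x) (fi x); rewrite mulrC.
Qed.

Lemma has_int_snd : (forall y, (\int[mu]_x (f x y)%:E = (m y)%:E)%E) ->
  has_int (mu \x mu)%E (fun z => f z.1 z.2 * h z.2) v.
Proof.
move=> fm.
have fi y : has_int mu (f ^~ y) (m y) by apply: has_int_ge0 => //; exact: mfy.
have int : (mu \x mu)%E.-integrable setT (EFin \o (fun z : R * R => f z.1 z.2 * h z.2)).
  apply/integrable21ltyP; first exact/measurable_EFinP.
  have [/integrableP[_ +] _] := hv; apply: le_lt_trans.
  rewrite le_eqVlt; apply/orP; left; apply/eqP; apply: eq_integral => y _ /=.
  under eq_integral do rewrite normrM (ger0_norm (f0 _ _)) mulrC.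
  have [_ ->] := has_intZ `|h y| (fi y); rewrite normrM mulrC; congr (_ * _)%:E.
  by rewrite ger0_norm// -lee_fin -fm integral_ge0// => x _; rewrite lee_fin.
split => //; rewrite -integral21_prod_meas1//; have [_ <-] := hv.
apply: eq_integral => y _; rewrite /fubini_G/=.
under eq_integral do rewrite mulrC.
by have [_ ->] := has_intZ (h y) (fi y); rewrite mulrC.
Qed.

End product_density.

Lemma measurable_bes_comp d (T : measurableType d) (R : realType) (g : T -> R) :
  (forall x, 0 <= g x) -> measurable_fun setT g -> measurable_fun setT (fun x => bes (g x)).
Proof.
move=> g0 mg; apply/measurable_EFinP; rewrite (_ : _ \o _ = fun x =>
  (\sum_(0 <= k <oo) (bes_coeff (g x) k)%:E)%E); last first.
  by apply/funext => z /=; rewrite EFin_bes.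
apply: ge0_emeasurable_sum => [k z _ _|k _].
  by rewrite lee_fin bes_coeff_ge0.
apply/measurable_EFinP; apply: measurable_funM => //; exact: measurable_funX.
Qed.

(** * Moments of the Rayleigh density *)

Section rayleigh.
Context {R : realType}.
Notation mu := (@lebesgue_measure R).
Variables (S : R) (S0 : 0 < S).

Definition rayl (x : R) : R := 2 / S * pw S^-1 1 x.

Let Si0 : 0 < S^-1. Proof. by rewrite invr_gt0. Qed.

Let has_int_pw n : has_int mu (pw S^-1 n) (hmom S^-1 n).
Proof.
by apply: has_int_ge0; [exact: pw_ge0|exact: measurable_pw|exact: integral_pw].
Qed.

Lemma has_int_rayl1 : has_int mu (fun x => rayl x * 1) 1.
Proof.
have := has_intZ (2 / S) (has_int_pw 1); rewrite hmom1// (_ : 2 / S * (2 / S)^-1 = 1).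
  by apply: has_int_ext => x; rewrite mulr1.
by field; rewrite gt_eqF.
Qed.

Lemma has_int_rayl_sqr : has_int mu (fun x => rayl x * x ^+ 2) S.
Proof.
have := has_intZ (2 / S) (has_int_pw 3).
rewrite (hmom_odd 1)// (_ : _ * (_ / _) = S).
  by apply: has_int_ext => x; rewrite /rayl -(mulrA (2 / S)) pwM.
by rewrite factS fact0 muln1 exprVn; field; rewrite gt_eqF.
Qed.

(** On the positive half-line [expR (- ln x)] is 1/x; this form is measurable by composition. The
    factor x of the Rayleigh density removes the singularity. *)
Lemma has_int_rayl_inv : has_int mu (fun x => rayl x * expR (- ln x)) (Num.sqrt pi / Num.sqrt S).
Proof.
have s0 : 0 < Num.sqrt S by rewrite sqrtr_gt0.
have := has_intZ (2 / S) (has_int_pw 0).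
rewrite hmom0// sqrtrV ?(ltW S0)// (_ : _ * (_ / _) = Num.sqrt pi / Num.sqrt S).
  apply: has_int_ext => x; rewrite /rayl -(mulrA (2 / S)); congr (_ * _).
  rewrite /pw /hind; have [x0|x0] := ltP 0 x; last by rewrite !mul0r.
  by rewrite expRN lnK ?posrE// expr0 expr1; field; rewrite gt_eqF.
rewrite -{1}[S](sqr_sqrtr (ltW S0)); field; rewrite gt_eqF//.
Qed.

(** X^2 / S is a standard exponential variable, and its logarithm has mean minus Euler's
    constant. *)
Lemma has_int_rayl_ln : has_int mu (fun x => rayl x * ln (S^-1 * x ^+ 2)) (- euler_gamma).
Proof.
have i := integrable_lnmom 0 Si0.
have h : has_int mu (fun x => hind x * (x ^+ 1 * ln (S^-1 * x ^+ 2) * gw S^-1 x)) (lnmom S^-1 1).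
  split; last by rewrite integral_hindM fineK//; exact: integrable_fin_num.
  have [h1 _] := @integrable_mkcond _ _ _ mu `]0, +oo[%classic
    (EFin \o (fun x => x ^+ 1 * ln (S^-1 * x ^+ 2) * gw S^-1 x)) (measurable_itv _).
  apply: eq_integrable (h1 i) => // x _.
  by rewrite patchE /= hindE indicE; case: (x \in _); rewrite ?mul1r ?mul0r.
have := has_intZ (2 / S) h; rewrite lnmom1// (_ : _ * (_ / _) = - euler_gamma).
  apply: has_int_ext => x; rewrite /rayl /pw; ring.
by field; rewrite gt_eqF.
Qed.

End rayleigh.

Definition psi {R : realType} (z : R) : R :=
  ln (bes (z ^+ 2 / 4)) - z + ln (2 * pi * z) / 2.

(** AM-GM on 1 / sqrt (x y) separates the coordinates, so the mean of the error is controlled by the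
    marginals whatever the correlation. The scales a and b are free to balance the two terms. *)
Lemma psi_bound (R : realType) (k a b x y : R) :
  0 < k -> 0 < a -> 0 < b -> 0 < x -> 0 < y ->
  `|psi (k * (x * y))| <= 5 / 2 / Num.sqrt (k * (a * b)) * (a * x^-1 + b * y^-1).
Proof.
move=> k0 a0 b0 x0 y0; have kxy : 0 < k * (x * y) by rewrite !mulr_gt0.
apply: (le_trans (ln_bes_asymp kxy)).
set u := Num.sqrt (a * x^-1); set v := Num.sqrt (b * y^-1).
have u2 : u ^+ 2 = a * x^-1 by rewrite sqr_sqrtr// mulr_ge0 ?invr_ge0 ?ltW.
have v2 : v ^+ 2 = b * y^-1 by rewrite sqr_sqrtr// mulr_ge0 ?invr_ge0 ?ltW.
have kab : 0 < k * (a * b) by rewrite !mulr_gt0.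
have e : (Num.sqrt (k * (x * y)))^-1 = (Num.sqrt (k * (a * b)))^-1 * (u * v).
  rewrite /u /v -sqrtrM; last by rewrite mulr_ge0 ?invr_ge0 ?ltW.
  rewrite -!sqrtrV ?(ltW kxy) ?(ltW kab)//.
  rewrite -sqrtrM; last by rewrite invr_ge0 ltW.
  by congr Num.sqrt; field; rewrite !gt_eqF.
have i0 : 0 < (Num.sqrt (k * (a * b)))^-1 by rewrite invr_gt0 sqrtr_gt0.
rewrite e -u2 -v2 -subr_ge0.
rewrite (_ : _ - _ = 5 / 2 * (Num.sqrt (k * (a * b)))^-1 * (u - v) ^+ 2).
  by rewrite mulr_ge0 ?sqr_ge0// mulr_ge0 ?(ltW i0).
by move: (Num.sqrt _)^-1 => i; field.
Qed.

Lemma ln_mul_expR_mul (R : realType) (a w b : R) : 0 < a -> 0 < b ->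
  ln (a * (expR w * b)) = ln a + (w + ln b).
Proof.
by move=> a0 b0; rewrite !lnM ?posrE ?mulr_gt0 ?expR_gt0// expRK.
Qed.

(** * Mutual information of the bivariate Rayleigh density *)

Section mutual_information.
Context {R : realType}.
Notation mu := (@lebesgue_measure R).
Variables (SA SE c : R).
Hypotheses (SA0 : 0 < SA) (SE0 : 0 < SE) (c0 : 0 < c) (cD : c < SA * SE).
Local Notation D := (detD SA SE c).
Local Notation f0 := (ray2 SA SE c).
Local Notation t2 := (th2 SA SE c).

Let D0 : 0 < D. Proof. by rewrite subr_gt0. Qed.

Lemma marg1_ray2 x : marg1 f0 x = rayl SA x.
Proof. by rewrite /marg1 marginal_ray2// ltW. Qed.

Lemma marg2_ray2 y : marg2 f0 y = rayl SE y.
Proof.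
rewrite /marg2; under eq_integral do rewrite ray2_sym.
by rewrite marginal_ray2// ?(ltW c0)// mulrC.
Qed.

Let f0_ge0 x y : 0 <= f0 x y. Proof. by apply: ray2_ge0 => //; exact: ltW. Qed.

Let mf0 : measurable_fun setT (fun z : R * R => f0 z.1 z.2).
Proof. by apply: measurable_ray2 => //; exact: ltW. Qed.

Let int1 (h : R -> R) v : measurable_fun setT h -> has_int mu (fun x => rayl SA x * h x) v ->
  has_int (mu \x mu)%E (fun z => f0 z.1 z.2 * h z.1) v.
Proof.
move=> mh hv; apply: (has_int_fst f0_ge0 mf0 mh hv) => x.
by rewrite marginal_ray2// ltW.
Qed.

Let int2 (h : R -> R) v : measurable_fun setT h -> has_int mu (fun x => rayl SE x * h x) v ->
  has_int (mu \x mu)%E (fun z => f0 z.1 z.2 * h z.2) v.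
Proof.
move=> mh hv; apply: (has_int_snd f0_ge0 mf0 mh hv) => y.
under eq_integral do rewrite ray2_sym.
by rewrite marginal_ray2// ?(ltW c0)// mulrC.
Qed.

Definition kap : R := 2 * Num.sqrt c / D.
Let kap0 : 0 < kap. Proof. by rewrite divr_gt0// mulr_gt0// sqrtr_gt0. Qed.
Let ss : R := Num.sqrt SA * Num.sqrt SE.
Let ss0 : 0 < ss. Proof. by rewrite mulr_gt0// sqrtr_gt0. Qed.

Let kap_sqr x y : (kap * (x * y)) ^+ 2 / 4 = t2 * (x ^+ 2 * y ^+ 2).
Proof.
rewrite /kap /th2 (_ : c / D ^+ 2 = (Num.sqrt c) ^+ 2 / D ^+ 2); last by rewrite sqr_sqrtr// ltW.
by move: (Num.sqrt c) D D0 => s d d0; field; rewrite gt_eqF.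
Qed.

Let measurable_psi : measurable_fun setT (fun z : R * R => psi (kap * (z.1 * z.2))).
Proof.
have m12 : measurable_fun setT (fun z : R * R => kap * (z.1 * z.2)).
  apply: measurable_funM; first exact: measurable_cst.
  by apply: measurable_funM; [exact: (@measurable_fun1 _ id)|exact: (@measurable_fun2 _ id)].
apply: measurable_funD; [apply: measurable_funB => //|apply: measurable_funM => //].
  apply: measurableT_comp; first exact: measurable_ln.
  apply: measurable_bes_comp => [z|]; first by rewrite divr_ge0// sqr_ge0.
  by apply: measurable_funM => //; exact: measurable_funX.
apply: measurableT_comp; first exact: measurable_ln.
by apply: measurable_funM.
Qed.

Let f0_supp x y : f0 x y = 0 \/ (0 < x /\ 0 < y).
Proof.
rewrite /ray2 /pw /hind; have [x0|x0] := ltP 0 x; last by left; rewrite mul0r !(mulr0, mul0r).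
have [y0|y0] := ltP 0 y; [by right|by left; rewrite mul0r !(mulr0, mul0r)].
Qed.

Let measurable_inv : measurable_fun setT (fun x : R => expR (- ln x)).
Proof.
apply: measurableT_comp; first exact: measurable_expR.
by apply: measurableT_comp => //; exact: measurable_ln.
Qed.

(** The scales sqrt SA and sqrt SE make both weighted inverse moments equal to sqrt pi. *)
Let has_int_psi : exists w,
  has_int (mu \x mu)%E (fun z => f0 z.1 z.2 * psi (kap * (z.1 * z.2))) w /\
  `|w| <= 5 * Num.sqrt pi / Num.sqrt (kap * ss).
Proof.
have SA0' : 0 < Num.sqrt SA by rewrite sqrtr_gt0.
have SE0' : 0 < Num.sqrt SE by rewrite sqrtr_gt0.
have i0 : 0 < Num.sqrt (kap * ss) by rewrite sqrtr_gt0 mulr_gt0.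
have h1 := int1 measurable_inv (has_int_rayl_inv SA0).
have h2 := int2 measurable_inv (has_int_rayl_inv SE0).
have h := has_intZ (5 / 2 / Num.sqrt (kap * ss))
  (has_intD (has_intZ (Num.sqrt SA) h1) (has_intZ (Num.sqrt SE) h2)).
have -> : 5 * Num.sqrt pi / Num.sqrt (kap * ss) = 5 / 2 / Num.sqrt (kap * ss) *
  (Num.sqrt SA * (Num.sqrt pi / Num.sqrt SA) + Num.sqrt SE * (Num.sqrt pi / Num.sqrt SE)).
  by field; rewrite !gt_eqF.
apply: has_int_dom h; first exact: measurable_funM.
move=> [x y] /=; rewrite normrM (ger0_norm (f0_ge0 _ _)).
have [->|[x0 y0]] := f0_supp x y; first by rewrite !(mul0r, mulr0) addr0 mulr0.
have := ler_wpM2l (f0_ge0 x y) (psi_bound kap0 SA0' SE0' x0 y0).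
by rewrite !expRN !lnK ?posrE//; congr (_ <= _); rewrite /ss; ring.
Qed.

Let lnA (x : R) : R := ln (SA^-1 * x ^+ 2).
Let lnE (x : R) : R := ln (SE^-1 * x ^+ 2).

(** The exponents combine through SE/D - 1/SA = c / (D SA) and its mirror image. The term ln z / 2
    of the Bessel expansion splits into one logarithm per coordinate, each of coefficient -1/4 once
    written with squares. Every summand except [psi] then has a known mean. *)
Let ln_ratio (x y : R) : 0 < x -> 0 < y ->
  ln (f0 x y / (rayl SA x * rayl SE y)) =
  ln (SA * SE / D) - ln (2 * pi * (kap * ss)) / 2 +
  (- (c / (D * SA)) * x ^+ 2 + (- (c / (D * SE)) * y ^+ 2 +
  (kap * (x * y) + (- 4^-1 * lnA x + (- 4^-1 * lnE y + psi (kap * (x * y))))))).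
Proof.
move=> x0 y0; have p0 := pi_gt0 R.
have b1 : 0 < bes (t2 * (x ^+ 2 * y ^+ 2)).
  apply: lt_le_trans ltr01 (bes_ge1 _).
  by rewrite mulr_ge0 ?divr_ge0 ?sqr_ge0 ?(ltW c0)// mulr_ge0 ?sqr_ge0.
pose w := - (c / (D * SA)) * x ^+ 2 - (c / (D * SE)) * y ^+ 2.
have -> : f0 x y / (rayl SA x * rayl SE y) = SA * SE / D * (expR w * bes (t2 * (x ^+ 2 * y ^+ 2))).
  have e : expR w = gw (SE / D) x * gw (SA / D) y / (gw SA^-1 x * gw SE^-1 y).
    rewrite /gw -!expRD -expRN -expRD; congr expR; rewrite /w.
    have : D = SA * SE - c by [].
    move: D D0 => d d0 dE; have -> : c = SA * SE - d by rewrite dE; ring.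
    by field; rewrite !gt_eqF.
  rewrite e /ray2 /rayl /pw /hind x0 y0 !mul1r !expr1.
  have g1 : 0 < gw SA^-1 x by exact: expR_gt0.
  have g2 : 0 < gw SE^-1 y by exact: expR_gt0.
  move: (gw SA^-1 x) g1 (gw SE^-1 y) g2 => a a0 b b0.
  move: (gw _ x) (gw _ y) (bes _) => u v B; move: D D0 => d d0.
  by field; rewrite !gt_eqF.
have SD : 0 < SA * SE / D by rewrite divr_gt0// mulr_gt0.
have k0 : 0 < kap * (x * y) by apply: mulr_gt0 => //; exact: mulr_gt0.
rewrite ln_mul_expR_mul//.
rewrite /psi kap_sqr.
have -> : ln (2 * pi * (kap * (x * y))) =
    ln (2 * pi * (kap * ss)) + 2^-1 * lnA x + 2^-1 * lnE y.
  have a1 : 0 < SA^-1 * x ^+ 2 by rewrite mulr_gt0 ?invr_gt0 ?exprn_gt0.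
  have a2 : 0 < SE^-1 * y ^+ 2 by rewrite mulr_gt0 ?invr_gt0 ?exprn_gt0.
  have SA0' : 0 < Num.sqrt SA by rewrite sqrtr_gt0.
  have SE0' : 0 < Num.sqrt SE by rewrite sqrtr_gt0.
  have l1 : 2^-1 * lnA x = ln (x / Num.sqrt SA).
    have -> : lnA x = ln ((x / Num.sqrt SA) ^+ 2).
      by rewrite /lnA expr_div_n sqr_sqrtr ?(ltW SA0)// mulrC.
    by rewrite lnXn ?divr_gt0// -[ln _ *+ 2]mulr_natr mulrC mulfK.
  have l2 : 2^-1 * lnE y = ln (y / Num.sqrt SE).
    have -> : lnE y = ln ((y / Num.sqrt SE) ^+ 2).
      by rewrite /lnE expr_div_n sqr_sqrtr ?(ltW SE0)// mulrC.
    by rewrite lnXn ?divr_gt0// -[ln _ *+ 2]mulr_natr mulrC mulfK.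
  rewrite l1 l2; move: kap kap0 => k k00.
  rewrite -!lnM ?posrE ?mulr_gt0 ?invr_gt0//; congr ln.
  by rewrite /ss; field; rewrite !gt_eqF.
by rewrite /w; move: (lnA x) (lnE y) => a b; field; rewrite !gt_eqF.
Qed.

Let measurable_ln_sqr (S : R) : measurable_fun setT (fun x : R => ln (S^-1 * x ^+ 2)).
Proof.
apply: measurableT_comp; first exact: measurable_ln.
by apply: measurable_funM => //; exact: measurable_funX.
Qed.

Lemma mutual_info_ray2 : exists e, `|e| <= 5 * Num.sqrt pi / Num.sqrt (kap * ss) /\
  mutual_info f0 = ((ln (SA * SE / D) - ln (2 * pi * (kap * ss)) / 2 - 2 * c / D +
    kap * ((D * (SE / D * (SA / D)) * (Num.sqrt (SE / D) * Num.sqrt (SA / D)))^-1 *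
     limn (series (fun k => (c / (SA * SE)) ^+ k * bk k))) + euler_gamma / 2 + e) / ln 2)%:E.
Proof.
have [w [hw wle]] := has_int_psi; exists w; split => //.
have m1 : measurable_fun setT (fun _ : R => 1 : R) by exact: measurable_cst.
have mx : measurable_fun setT (fun x : R => x ^+ 2) by exact: measurable_funX.
have h0 := int1 m1 (has_int_rayl1 SA0).
have h1 := int1 mx (has_int_rayl_sqr SA0).
have h2 := int2 mx (has_int_rayl_sqr SE0).
have h3 := int1 (measurable_ln_sqr SA) (has_int_rayl_ln SA0).
have h4 := int2 (measurable_ln_sqr SE) (has_int_rayl_ln SE0).
set B := limn _; set Q := (X in kap * (X * B)).
have h5 : has_int (mu \x mu)%E (fun z => f0 z.1 z.2 * (z.1 * z.2)) (Q * B).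
  apply: has_int_ge0.
  - move=> [x y] /=; have [->|[x0 y0]] := f0_supp x y; first by rewrite mul0r.
    by rewrite mulr_ge0// mulr_ge0 ?ltW.
  - apply: measurable_funM => //.
    by apply: measurable_funM; [exact: (@measurable_fun1 _ id)|exact: (@measurable_fun2 _ id)].
  - by rewrite integral_ray2_XY// ltW.
set K := ln (SA * SE / D) - ln (2 * pi * (kap * ss)) / 2.
have h := has_intZ (ln 2)^-1 (has_intD (has_intZ K h0) (has_intD (has_intZ (- (c / (D * SA))) h1)
  (has_intD (has_intZ (- (c / (D * SE))) h2) (has_intD (has_intZ kap h5)
  (has_intD (has_intZ (- 4^-1) h3) (has_intD (has_intZ (- 4^-1) h4) hw)))))).
have [_] := h; rewrite /mutual_info => hh.
transitivity ((ln 2)^-1 * (K * 1 + (- (c / (D * SA)) * SA + (- (c / (D * SE)) * SE + (kap * (Q * B) +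
  (- 4^-1 * - euler_gamma + (- 4^-1 * - euler_gamma + w)))))))%:E; last first.
  congr (_%:E); rewrite mulrC; congr (_ / _).
  have ar (X k g : R) : k * 1 + (- (c / (D * SA)) * SA + (- (c / (D * SE)) * SE + (X +
      (- 4^-1 * - g + (- 4^-1 * - g + w))))) = k - 2 * c / D + X + g / 2 + w.
    by move: D D0 => d d0; field; rewrite !gt_eqF.
  exact: ar.
have pt (x y : R) : f0 x y * log2 (f0 x y / (marg1 f0 x * marg2 f0 y)) = (ln 2)^-1 *
  (K * (f0 x y * 1) + (- (c / (D * SA)) * (f0 x y * x ^+ 2) +
    (- (c / (D * SE)) * (f0 x y * y ^+ 2) + (kap * (f0 x y * (x * y)) +
      (- 4^-1 * (f0 x y * ln (SA^-1 * x ^+ 2)) +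
       (- 4^-1 * (f0 x y * ln (SE^-1 * y ^+ 2)) +
        f0 x y * psi (kap * (x * y)))))))).
  rewrite marg1_ray2 marg2_ray2 /log2.
  (* Off the open quadrant the density vanishes and multiplies every term, so the values taken there
     by the logarithms do not matter. *)
  have [->|[x0 y0]] := f0_supp x y; first by rewrite !(mul0r, mulr0, addr0).
  by rewrite ln_ratio// -/K /lnA /lnE; ring.
by rewrite -hh; apply: eq_integral => -[x y] _ /=; rewrite pt.
Qed.

End mutual_information.

(** * Strong-correlation asymptotics with explicit error *)

Section asymptotics.
Context {R : realType}.

Lemma pi_le_sqr2 : pi <= 2 ^+ 2 :> R.
Proof.
have /andP[_] := @wallis_sqr_bounds R 0; rewrite wallis0 expr1n mulr1 add0r add0r => h.
by apply: le_trans h _; rewrite div1r exprVn invrK.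
Qed.

(** Mutual information is invariant under rescaling each envelope, so only x = c / (SA SE) can
    survive: [detD] is y SA SE and the Bessel scale is 2 r / y. *)
Lemma mutual_info_ray2_corr (SA SE c : R) :
  0 < SA -> 0 < SE -> 0 < c -> c < SA * SE ->
  let x := c / (SA * SE) in let y := 1 - x in let r := Num.sqrt x in
  exists e, `|e| <= 5 * Num.sqrt pi / Num.sqrt (2 * r / y) /\
  mutual_info (ray2 SA SE c) = ((- ln y - ln (2 * pi * (2 * r / y)) / 2 - 2 * x / y +
    2 * r * y * limn (series (fun k => x ^+ k * bk k)) + euler_gamma / 2 + e) / ln 2)%:E.
Proof.
move=> SA0 SE0 c0 cD x y r.
have [e [ele ->]] := mutual_info_ray2 SA0 SE0 c0 cD.
have SS : 0 < SA * SE by rewrite mulr_gt0.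
have D0 : 0 < detD SA SE c by rewrite subr_gt0.
have yE : y = detD SA SE c / (SA * SE).
  by rewrite /y /x /detD mulrBl divff// gt_eqF.
have y0 : 0 < y by rewrite yE divr_gt0.
set a := Num.sqrt SA in ele *; set b := Num.sqrt SE in ele *.
have a0 : 0 < a by rewrite sqrtr_gt0.
have b0 : 0 < b by rewrite sqrtr_gt0.
have a2 : a ^+ 2 = SA by rewrite sqr_sqrtr// ltW.
have b2 : b ^+ 2 = SE by rewrite sqr_sqrtr// ltW.
have rE : r = Num.sqrt c / (a * b).
  by rewrite /r /x sqrtrM ?(ltW c0)// sqrtrV ?(ltW SS)// sqrtrM ?(ltW SA0).
have DE : detD SA SE c = y * (a ^+ 2 * b ^+ 2) by rewrite yE a2 b2 divfK// gt_eqF.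
have kE : kap SA SE c * (a * b) = 2 * r / y.
  have gen (s z u w : R) : 0 < z -> 0 < u -> 0 < w ->
      2 * s / (z * (u ^+ 2 * w ^+ 2)) * (u * w) = 2 * (s / (u * w)) / z.
    by move=> ? ? ?; field; rewrite !gt_eqF.
  by rewrite /kap DE rE gen.
rewrite kE in ele *; exists e; split => //.
congr (_%:E); congr (_ / _).
have e1 : SA * SE / detD SA SE c = y^-1 by rewrite yE invf_div.
have e2 : 2 * c / detD SA SE c = 2 * x / y.
  rewrite yE /x; move: (detD _ _ _) D0 => d d0.
  by field; rewrite !gt_eqF.
have e3 : kap SA SE c * (detD SA SE c * (SE / detD SA SE c * (SA / detD SA SE c)) *
     (Num.sqrt (SE / detD SA SE c) * Num.sqrt (SA / detD SA SE c)))^-1 = 2 * r * y.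
  have d0 : 0 < Num.sqrt (detD SA SE c) by rewrite sqrtr_gt0.
  have d2 : Num.sqrt (detD SA SE c) ^+ 2 = detD SA SE c by rewrite sqr_sqrtr// ltW.
  rewrite !sqrtrM ?(ltW SE0) ?(ltW SA0)// sqrtrV ?(ltW D0)// -/a -/b /kap rE.
  have gen (d w u v : R) : 0 < d -> 0 < u -> 0 < v ->
      2 * w / d ^+ 2 * (d ^+ 2 * (v ^+ 2 / d ^+ 2 * (u ^+ 2 / d ^+ 2)) * (v / d * (u / d)))^-1 =
      2 * (w / (u * v)) * (d ^+ 2 / (u ^+ 2 * v ^+ 2)).
    by move=> ? ? ?; field; rewrite !gt_eqF.
  by have := gen _ (Num.sqrt c) _ _ d0 a0 b0; rewrite d2 a2 b2 yE.
by rewrite e1 e2 (mulrA (kap SA SE c)) e3 lnV ?posrE.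
Qed.

(** The error budget is 10 sqrt y from the Bessel remainder, 2 sqrt y from the E[X Y] series, and
    terms of order y from ln r and from the cancellation, within 13 sqrt y altogether. *)
Lemma mutual_info_ray2_asymp (SA SE c : R) :
  0 < SA -> 0 < SE -> 0 < c -> c < SA * SE ->
  let y := 1 - c / (SA * SE) in y <= 2^-1 ->
  exists v, mutual_info (ray2 SA SE c) = (v / ln 2)%:E /\
  `|v - (- ln y / 2 - ln (4 * pi) / 2 + 2^-1 + euler_gamma / 2)| <= 13 * Num.sqrt y.
Proof.
move=> SA0 SE0 c0 cD /=; have := mutual_info_ray2_corr SA0 SE0 c0 cD.
rewrite /=; set x := c / (SA * SE); set y := 1 - x; set r := Num.sqrt x.
move=> [e [ele ->]] yh.
have SS : 0 < SA * SE by rewrite mulr_gt0.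
have x0 : 0 < x by rewrite divr_gt0.
have x1 : x < 1 by rewrite ltr_pdivrMr// mul1r.
have y0 : 0 < y by rewrite subr_gt0.
have xh : 2^-1 <= x by rewrite /y in yh; lra.
have r0 : 0 < r by rewrite sqrtr_gt0.
have r2 : r ^+ 2 = x by rewrite sqr_sqrtr// ltW.
have r1 : r < 1 by rewrite -sqrtr1 ltr_sqrt.
have xr : x <= r by rewrite -r2 expr2 ler_piMr// ltW.
have h0 : 0 < Num.sqrt y by rewrite sqrtr_gt0.
have h2 : Num.sqrt y ^+ 2 = y by rewrite sqr_sqrtr// ltW.
have h1 : Num.sqrt y <= 1 by rewrite -sqrtr1 ler_sqrt//; lra.
have yh1 : y <= Num.sqrt y by rewrite -{1}h2 expr2 ler_piMr// ltW.
have p0 := pi_gt0 R.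
eexists; split; first by [].
have E1 : 0 <= - ln r <= y.
  apply/andP; split; first by rewrite oppr_ge0 ln_le0// ltW.
  have lx : ln x = 2 * ln r by rewrite -r2 lnXn// -[ln _ *+ 2]mulr_natl.
  have := @ln_le_tangent R x 1 x0 ltr01; rewrite ln1 div1r lx => h.
  have : x^-1 <= 1 + 2 * y.
    rewrite -[leLHS]div1r ler_pdivrMr// -subr_ge0 (_ : _ - _ = y * (2 * x - 1)); last first.
      by rewrite /y; ring.
    by rewrite mulr_ge0 ?(ltW y0)//; lra.
  by move=> ?; lra.
have E2 : ln (2 * pi * (2 * r / y)) = ln (4 * pi) + ln r - ln y.
  rewrite (_ : 2 * pi * _ = 4 * pi * r / y); last by field; rewrite gt_eqF.
  by rewrite ln_div ?posrE ?mulr_gt0// lnM ?posrE ?mulr_gt0.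
set B := limn _.
have xx0 := ltW x0.
have B1 : y ^- 2 - (4 * y)^-1 <= B by exact: (series_bk_ge xx0 x1).
have B2 : B <= y ^- 2 - (4 * y)^-1 + (Num.sqrt y)^-1 by exact: (series_bk_le xx0 x1).
have yr : y = (1 - r) * (1 + r) by rewrite /y -r2; ring.
have ry0 : 0 <= 2 * r * y by rewrite !mulr_ge0 ?ltW.
(* The cancellation of the 1/y terms: since y = (1 - r)(1 + r), the difference is 2 r / (1 + r) -
   r/2, which tends to 1/2 as r tends to 1. *)
have E3 : 2 * r * y * (y ^- 2 - (4 * y)^-1) - 2 * x / y = 2^-1 - (1 - r) ^+ 2 / (2 * (1 + r)).
  by rewrite -r2 yr; field; nzlra.
have E4 : 0 <= (1 - r) ^+ 2 / (2 * (1 + r)) <= y.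
  apply/andP; split; first by rewrite divr_ge0 ?sqr_ge0//; lra.
  rewrite ler_pdivrMr; last by lra.
  rewrite yr -subr_ge0 (_ : _ - _ = (1 - r) * (1 + 5 * r + 2 * r ^+ 2)); last by ring.
  by rewrite mulr_ge0//; [lra|]; rewrite !addr_ge0// ?mulr_ge0 ?sqr_ge0// ltW.
have E5 : 2 * r * y * (Num.sqrt y)^-1 <= 2 * Num.sqrt y.
  rewrite -{1}h2 (_ : _ * _ = 2 * r * Num.sqrt y); last by field; rewrite gt_eqF.
  by rewrite ler_wpM2r ?(ltW h0)//; lra.
(* Here sqrt pi <= 2 and 2 r >= 1, the latter from x >= 1/2. *)
have E6 : `|e| <= 10 * Num.sqrt y.
  apply: (le_trans ele); rewrite ler_pdivrMr; last by rewrite sqrtr_gt0 divr_gt0// mulr_gt0.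
  rewrite -(mulrA 10) -sqrtrM ?(ltW y0)// (_ : y * _ = 2 * r); last by field; rewrite gt_eqF.
  have s1 : 1 <= Num.sqrt (2 * r) by rewrite -[leLHS]sqrtr1 ler_sqrt; lra.
  have s2 : Num.sqrt pi <= 2 :> R.
    by rewrite -[leRHS]ger0_norm// -sqrtr_sqr ler_sqrt ?sqr_ge0//; exact: pi_le_sqr2.
  by lra.
have C1 := ler_wpM2l ry0 B1.
have C2 : 2 * r * y * B <= 2 * r * y * (y ^- 2 - (4 * y)^-1) + 2 * r * y * (Num.sqrt y)^-1.
  have gen (k u v w : R) : 0 <= k -> w <= u + v -> k * w <= k * u + k * v.
    by move=> k0 h; rewrite -mulrDr ler_wpM2l.
  exact: gen ry0 B2.
move: E6; rewrite ler_norml => /andP[E6 E7]; rewrite E2.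
case/andP : E1 => E1 E1'; case/andP : E4 => E4 E4'.
rewrite ler_norml; apply/andP; split.
  by move: (ln (4 * pi)) (ln r) (ln y) E1 E1' (2 * r * y * _) C1 C2 E3 => l4 lr ly E1 E1' Z C1 C2 E3; lra.
by move: (ln (4 * pi)) (ln r) (ln y) E1 E1' (2 * r * y * B) C1 C2 E3 => l4 lr ly E1 E1' Z C1 C2 E3; lra.
Qed.

Lemma mi_approx_limit (p b eps : R) : 0 < p -> 0 < b -> 0 < eps ->
  exists delta : R, 0 < delta /\
  forall q s : R, 1 - delta < q -> q < 1 -> 0 <= q -> 0 < s -> s < delta ->
  [/\ 0 < q, (p * q) ^+ 2 < (p + s) * (p + b * s) &
  forall v, v%:E = mutual_info (ray2 (p + s) (p + b * s) ((p * q) ^+ 2)) ->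
  `|v - (log2 (p / (p * (1 - q ^+ 2) + s + b * s)) / 2 - chi)| < eps].
Proof.
move=> p0 b0 e0.
have l2 : 0 < ln 2 :> R by rewrite ln_gt0// ltr1n.
(* K is chosen so that y <= K delta: 1 - q^2 contributes at most 2 delta and the noise (s + 2 b s) /
   p. The second b s comes from b s^2 <= p b s, which is why delta is also at most p. *)
pose K := 2 + (1 + 2 * b) / p.
have bp0 : 0 < (1 + 2 * b) / p by rewrite divr_gt0//; lra.
have K0 : 0 < K by rewrite /K; lra.
(* The 15 leaves room for the 13 sqrt y of the expansion and for one further share from ln z / 2.
   The square turns a bound on y into one on sqrt y, and 1/2 is the range in which the expansion
   holds. *)
pose m := Num.min 2^-1 ((eps * ln 2 / 15) ^+ 2).
have m0 : 0 < m by rewrite lt_min invr_gt0 ltr0n exprn_gt0// divr_gt0// mulr_gt0.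
exists (Num.min 2^-1 (Num.min p (m / K))); split.
  by rewrite !lt_min invr_gt0 ltr0n p0 divr_gt0.
move=> q s; set delta := Num.min _ _ => dq q1 q0 s0 sd.
have [d1 d2 d3] : [/\ delta <= 2^-1, delta <= p & delta <= m / K].
  by rewrite /delta !ge_min !lexx !orbT.
have q0' : 0 < q by lra.
have sp : s <= p by lra.
have Kd : K * delta <= m by rewrite mulrC -ler_pdivlMr.
set SA := p + s; set SE := p + b * s; set c := (p * q) ^+ 2; set N := p * (1 - q ^+ 2) + s + b * s.
have bs0 : 0 < b * s by rewrite mulr_gt0.
have SA0 : 0 < SA by rewrite addr_gt0.
have SE0 : 0 < SE by rewrite addr_gt0.
have SS : 0 < SA * SE by rewrite mulr_gt0.
have q2 : 0 < 1 - q ^+ 2.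
  by rewrite (_ : 1 - q ^+ 2 = (1 - q) * (1 + q)); [rewrite mulr_gt0; lra|ring].
have q3 : 1 - q ^+ 2 <= 2 * delta.
  rewrite (_ : 1 - q ^+ 2 = (1 - q) * (1 + q)); last by ring.
  rewrite mulrC ler_pM//; lra.
have N0 : 0 < N by rewrite !addr_gt0// mulr_gt0.
have c0 : 0 < c by rewrite exprn_gt0// mulr_gt0.
have DE : SA * SE - c = p * N + b * s ^+ 2 by rewrite /SA /SE /c /N; ring.
have bs2 : 0 < b * s ^+ 2 by rewrite mulr_gt0// exprn_gt0.
have cD : c < SA * SE by rewrite -subr_gt0 DE addr_gt0// mulr_gt0.
split => // v vE.
set y := 1 - c / (SA * SE).
have yE : y = (p * N + b * s ^+ 2) / (SA * SE).
  by rewrite /y -DE mulrBl divff// gt_eqF.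
have y0 : 0 < y by rewrite yE divr_gt0// addr_gt0// mulr_gt0.
have pSS : p ^+ 2 <= SA * SE by rewrite expr2 ler_pM ?(ltW p0)// lerDl ltW.
have p20 : 0 < p ^+ 2 by rewrite exprn_gt0.
have bsp : b * s ^+ 2 <= p * (b * s).
  by rewrite expr2 mulrA mulrC ler_wpM2r// ltW.
have sK : (s + 2 * (b * s)) / p = s * ((1 + 2 * b) / p) by field; rewrite gt_eqF.
have sK' : s * ((1 + 2 * b) / p) <= delta * ((1 + 2 * b) / p).
  by rewrite ler_wpM2r ?(ltW bp0)// ltW.
have yK : y <= K * delta.
  apply: (@le_trans _ _ ((p * N + b * s ^+ 2) / p ^+ 2)).
    by rewrite yE ler_wpM2l ?lef_pV2 ?posrE// ltW// addr_gt0// mulr_gt0.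
  apply: (@le_trans _ _ ((p * N + p * (b * s)) / p ^+ 2)).
    by rewrite ler_wpM2r ?invr_ge0 ?(ltW p20)// lerD2l.
  rewrite (_ : _ / _ = 1 - q ^+ 2 + (s + 2 * (b * s)) / p); last by rewrite /N; field; rewrite gt_eqF.
  by rewrite sK /K mulrDl; lra.
have ym : y <= m by exact: le_trans Kd.
have yh : y <= 2^-1 by apply: le_trans ym _; rewrite ge_min lexx.
have [v' []] := mutual_info_ray2_asymp SA0 SE0 c0 cD yh.
rewrite -vE => -[vv] h; rewrite -/y in h.
have sy : Num.sqrt y <= eps * ln 2 / 15.
  rewrite -[leRHS]ger0_norm; last by rewrite divr_ge0// mulr_ge0// ltW.
  rewrite -sqrtr_sqr ler_sqrt ?sqr_ge0//; apply: le_trans ym _.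
  by rewrite ge_min lexx orbT.
(* z is the ratio of the exact 1 - r^2 to the expression N / p used in the approximation; the two
   formulas differ by ln z / 2 apart from the expansion error. *)
pose z := y * (p / N).
have z0 : 0 < z by rewrite mulr_gt0// divr_gt0.
have zE : z - 1 = (p * (b * s ^+ 2 / N) - (p * s + p * (b * s) + b * s ^+ 2)) / (SA * SE).
  have -> : p * s + p * (b * s) + b * s ^+ 2 = SA * SE - p ^+ 2 by rewrite /SA /SE; ring.
  have gen (n S : R) : 0 < n -> 0 < S -> (p * n + b * s ^+ 2) / S * (p / n) - 1 =
      (p * (b * s ^+ 2 / n) - (S - p ^+ 2)) / S.
    by move=> ? ?; field; rewrite !gt_eqF.
  by rewrite /z yE gen.
have bN : 0 <= b * s ^+ 2 / N <= b * s.
  rewrite divr_ge0 ?(ltW N0) ?(ltW bs2)//= ler_pdivrMr// expr2 mulrA ler_wpM2l ?(ltW bs0)//.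
  by rewrite /N -addrA addrCA lerDl addr_ge0 ?(ltW bs0)// mulr_ge0 ?(ltW p0) ?(ltW q2).
have zabs : `|z - 1| <= y \/ `|z - 1| <= K * delta.
  right; rewrite zE normrM (ger0_norm (_ : 0 <= (SA * SE)^-1)) ?invr_ge0 ?(ltW SS)//.
  case/andP: bN => bN0 bN1.
  have n1 : `|p * (b * s ^+ 2 / N) - (p * s + p * (b * s) + b * s ^+ 2)| <= p * (s + 2 * (b * s)).
    have k1 : p * (b * s ^+ 2 / N) <= p * (b * s) by rewrite ler_wpM2l// ltW.
    have k2 : 0 <= p * (b * s ^+ 2 / N) by rewrite mulr_ge0// ltW.
    have k3 : 0 < p * s by rewrite mulr_gt0.
    have k4 : 0 < p * (b * s) by rewrite mulr_gt0.
    move: (b * s ^+ 2 / N) bN0 bN1 k1 k2 => w ? ? k1 k2.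
    rewrite mulrDr (mulrCA p 2) ler_norml; apply/andP; split; lra.
  apply: (@le_trans _ _ (p * (s + 2 * (b * s)) / p ^+ 2)).
    by apply: ler_pM => //; rewrite ?invr_ge0 ?(ltW SS)// lef_pV2 ?posrE.
  rewrite (_ : _ / _ = (s + 2 * (b * s)) / p); last by field; rewrite gt_eqF.
  rewrite sK /K mulrDl; have : 0 < 2 * delta by lra.
  by move=> ?; lra.
have {zabs} zabs : `|z - 1| <= m by case: zabs => h'; apply: (le_trans h').
have mh : m <= 2^-1 by rewrite ge_min lexx.
have mm : m <= eps * ln 2 / 15.
  have sm : Num.sqrt m <= eps * ln 2 / 15.
    rewrite -[leRHS]ger0_norm; last by rewrite divr_ge0// mulr_ge0// ltW.
    by rewrite -sqrtr_sqr ler_sqrt ?sqr_ge0// ge_min lexx orbT.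
  apply: le_trans sm; rewrite -{1}(sqr_sqrtr (ltW m0)) expr2 ler_piMl ?sqrtr_ge0//.
  by rewrite -sqrtr1 ler_sqrt//; lra.
have zl : `|ln z| <= 2 * m.
  move: zabs; rewrite !ler_norml => /andP[z1 z2].
  have u1 := @ln_le_tangent R 1 z ltr01 z0; rewrite ln1 divr1 in u1.
  have u2 := @ln_le_tangent R z 1 z0 ltr01; rewrite ln1 div1r in u2.
  have u3 : z^-1 <= 1 + 2 * m.
    rewrite -[leLHS]div1r ler_pdivrMr//.
    have : 0 <= m * (1 - 2 * m) by rewrite mulr_ge0 ?(ltW m0)//; lra.
    have : (1 + 2 * m) * (1 - m) <= (1 + 2 * m) * z by rewrite ler_wpM2l; lra.
    by move=> ? ?; lra.
  by apply/andP; split; lra.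
have chiE : log2 (p / N) / 2 - chi = (ln (p / N) / 2 - ln (4 * pi) / 2 + 2^-1 + euler_gamma / 2) / ln 2.
  have -> : chi = (ln (4 * pi) - (1 + euler_gamma)) / ln 2 / 2 :> R.
    by rewrite /chi /log2 ln_div ?posrE ?mulr_gt0 ?pi_gt0 ?expR_gt0// expRK.
  rewrite /log2.
  by field; rewrite gt_eqF.
have pN : 0 < p / N by exact: divr_gt0.
have lz : ln z = ln y + ln (p / N) by apply: lnM; rewrite posrE.
rewrite vv chiE -mulrBl normrM [X in _ * X]gtr0_norm ?invr_gt0// ltr_pdivrMr//.
have el : 0 < eps * ln 2 by rewrite mulr_gt0.
move: h zl; rewrite !ler_norml ltr_norml => /andP[g1 g2] /andP[g3 g4].
move: (ln (4 * pi)) (ln y) (ln (p / N)) (ln z) (Num.sqrt y) euler_gamma lz g1 g2 g3 g4 sy => l4 ly lp lzz sq eg lz g1 g2 g3 g4 sy.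
by move: (eps * ln 2) el sy mm => X ? ? ?; apply/andP; split; lra.
Qed.

End asymptotics.

(** * Gaussian Fourier integrals *)

Section gauss_fourier.
Context {R : realType}.
Notation mu := (@lebesgue_measure R).
Notation hl := (`]0%R, +oo[%classic : set R).

Lemma continuous_cosM (t : R) : continuous (fun x : R => cos (t * x)).
Proof.
move=> x; apply: (@continuous_comp _ _ _ (fun x : R => t * x) (@cos R)).
  by apply: cvgM; [exact: cvg_cst|exact: cvg_id].
exact: continuous_cos.
Qed.

Lemma continuous_sinM (t : R) : continuous (fun x : R => sin (t * x)).
Proof.
move=> x; apply: (@continuous_comp _ _ _ (fun x : R => t * x) (@sin R)).
  by apply: cvgM; [exact: cvg_cst|exact: cvg_id].
exact: continuous_sin.
Qed.

Lemma measurable_cosM (t : R) : measurable_fun setT (fun x : R => cos (t * x)).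
Proof. by apply: continuous_measurable_fun; exact: continuous_cosM. Qed.

Lemma measurable_sinM (t : R) : measurable_fun setT (fun x : R => sin (t * x)).
Proof. by apply: continuous_measurable_fun; exact: continuous_sinM. Qed.

Lemma is_derive_cosMl (x t : R) : is_derive t 1 (fun t => cos (t * x)) (- (x * sin (t * x))).
Proof.
apply: (@is_derive_eq R R^o R^o _ _ _ _ (- sin (t * x) * x)); last by ring.
apply: (@is_derive1_comp _ (@cos R) (fun y : R => y * x)).
by apply: is_derive_eq; rewrite /GRing.scale/=; ring.
Qed.

Lemma is_derive_sinMr (t x : R) : is_derive x 1 (fun x => sin (t * x)) (t * cos (t * x)).
Proof.
apply: (@is_derive_eq R R^o R^o _ _ _ _ (cos (t * x) * t)); last by ring.
apply: (@is_derive1_comp _ (@sin R) (fun y : R => t * y)).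
by apply: is_derive_eq; rewrite /GRing.scale/=; ring.
Qed.

Let pb_cos (t : R) : polybound (fun x => cos (t * x)) 1 0.
Proof. by move=> x _; rewrite mul1r muln0 expr0 (le_trans (cos_max _))// lerDr. Qed.

Let pb_sin (t : R) : polybound (fun x => sin (t * x)) 1 0.
Proof. by move=> x _; rewrite mul1r muln0 expr0 (le_trans (sin_max _))// lerDr. Qed.

Lemma integrable_cos_gw (t : R) : mu.-integrable hl (EFin \o (fun x => cos (t * x) * gw 1 x)).
Proof.
apply: (integrable_polybound ltr01 _ (@pb_cos t)).
by apply: measurable_funTS; exact: measurable_cosM.
Qed.

Lemma integrable_xsin_gw (t : R) : mu.-integrable hl (EFin \o (fun x => x * sin (t * x) * gw 1 x)).
Proof.
have h : polybound (fun x => x * sin (t * x)) 1 1.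
  move=> x x0; have := @polybound_exprn R 1 x x0; rewrite expr1; apply: le_trans.
  by rewrite normrM ler_piMr// sin_max.
apply: (integrable_polybound ltr01 _ h).
by apply: measurable_funTS; apply: measurable_funM => //; exact: measurable_sinM.
Qed.

Let Fc (t : R) := \int[mu]_(x in hl) (cos (t * x) * gw 1 x).

(** Integration by parts with primitive sin(t x) e^(-x^2), which vanishes at both ends. *)
Let xsin_gw (t : R) : \int[mu]_(x in hl) (x * sin (t * x) * gw 1 x) = t / 2 * Fc t.
Proof.
have h : (\int[mu]_(x in hl) (t * (cos (t * x) * gw 1 x) - 2 * (x * sin (t * x) * gw 1 x)) = 0)%R.
  rewrite /Rintegral (@integral_FTC_0y _ (fun x => sin (t * x) * gw 1 x) _ 0 0) ?subr0//.
  - move=> x x0; apply: is_deriveP.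
    apply: (is_derive_eq (is_derive_mul (is_derive_sinMr t x) (is_derive_gw 1 x))).
    by ring.
  - move=> x _; apply: cvgB; apply: cvgM; try exact: cvg_cst.
      by apply: cvgM; [exact: continuous_cosM|exact: continuous_gw].
    apply: cvgM; last exact: continuous_gw.
    by apply: cvgM; [exact: cvg_id|exact: continuous_sinM].
  - apply: integrable_EFinB => //; apply: integrable_EFinZ => //.
      exact: integrable_cos_gw.
    exact: integrable_xsin_gw.
  - rewrite -[X in _ --> X](_ : sin (t * 0) * gw 1 0 = 0); last by rewrite mulr0 sin0 mul0r.
    apply: cvg_at_right_filter.
    by apply: cvgM; [exact: continuous_sinM|exact: continuous_gw].
  - exact: (cvgy_polybound ltr01 (@pb_sin t)).
move: h; rewrite RintegralB//; last 2 first.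
  by apply: integrable_EFinZ => //; exact: integrable_cos_gw.
  by apply: integrable_EFinZ => //; exact: integrable_xsin_gw.
rewrite !RintegralZl//; [|exact: integrable_xsin_gw|exact: integrable_cos_gw].
by rewrite -/(Fc t) => h; lra.
Qed.

(** Differentiation under the integral, dominated by x e^(-x^2), combined with [xsin_gw], gives the
    equation F' = -(t/2) F. *)
Let is_derive_Fc (t : R) : is_derive t 1 Fc (- (t / 2) * Fc t).
Proof.
pose f (t x : R) := cos (t * x) * gw 1 x.
have df (s x : R) : is_derive s 1 (f ^~ x) (- (x * sin (s * x)) * gw 1 x).
  apply: (is_derive_eq (is_derive_mul (is_derive_cosMl x s) (is_derive_cst (gw 1 x) s 1))).
  by rewrite mulr0 addr0.
pose G (x : R) := `|x * gw 1 x|.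
have iG : mu.-integrable hl (EFin \o G).
  have := integrable_abse (integrable_hmom 1 (ltr01 : 0 < 1 :> R)).
  by apply: eq_integrable => // x _; rewrite /= expr1.
have tI : `]t - 1, t + 1[%classic t by rewrite /= in_itv/=; apply/andP; split; lra.
have intf s : `]t - 1, t + 1[%classic s -> mu.-integrable hl (EFin \o f s).
  by move=> _; exact: integrable_cos_gw.
have derf1 s x : `]t - 1, t + 1[%classic s -> hl x -> derivable (f ^~ x) s 1.
  by move=> _ _; have [] := df s x.
have Gub s x : `]t - 1, t + 1[%classic s -> hl x -> `|partial1of2 f s x| <= G x.
  move=> _ _; rewrite partial1of2E; have [_ ->] := df s x.
  by rewrite /G mulNr normrN -mulrA mulrCA normrM ler_piMl// sin_max.
have mhl : measurable (hl : set (measurableTypeR R)) by exact: measurable_itv.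
have G0 x : 0 <= G x by exact: normr_ge0.
split.
  exact: (@derivable_under_integral R _ _ mu f hl mhl t _ _ tI intf derf1 G G0 iG Gub).
rewrite -derive1E (@differentiation_under_integral R _ _ mu f hl mhl t _ _ tI intf derf1 G G0 iG Gub).
transitivity (\int[mu]_(x in hl) (-1 * (x * sin (t * x) * gw 1 x))).
  apply: eq_Rintegral => x _; rewrite partial1of2E; have [_ ->] := df t x.
  by ring.
by rewrite RintegralZl ?xsin_gw//; [ring|exact: integrable_xsin_gw].
Qed.

(** The equation makes F(t) e^(t^2/4) constant; [gw (- 4^-1)] is this growing exponential, and the
    constant is read off at t = 0. *)
Lemma Rintegral_cos_gw (t : R) :
  \int[mu]_(x in hl) (cos (t * x) * gw 1 x) = Num.sqrt pi / 2 * gw 4^-1 t.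
Proof.
have dK (s : R) : is_derive s 1 (fun s => Fc s * gw (- 4^-1) s) 0.
  apply: (is_derive_eq (is_derive_mul (is_derive_Fc s) (is_derive_gw (- 4^-1) s))).
  by field.
have := is_derive_0_is_cst t 0 dK.
have -> : Fc 0 = Num.sqrt pi / 2.
  rewrite /Fc; under eq_Rintegral do rewrite mul0r cos0 mul1r.
  by rewrite /Rintegral integral_gw//= divr1.
rewrite {2}/gw expr0n mulr0 expR0 mulr1 => <-.
by rewrite -mulrA /gw -expRD (_ : _ + _ = 0) ?expR0 ?mulr1//; ring.
Qed.

Lemma le_integrable_gw (f : R -> R) : measurable_fun setT f -> (forall x, `|f x| <= 1) ->
  mu.-integrable setT (EFin \o (fun x => f x * gw 1 x)).
Proof.
move=> mf f1; apply: (le_integrable _ _ _ (integrable_gwT (ltr01 : 0 < 1 :> R))) => //.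
  by apply/measurable_EFinP; apply: measurable_funM => //; exact: measurable_gw.
by move=> x _ /=; rewrite lee_fin normrM ler_piMl.
Qed.

(** The reflection formula is for nonnegative integrands, so the Gaussian is added to reach (1 +
    cos) times a Gaussian and subtracted at the end. *)
Lemma integral_cos_gwT (t : R) :
  (\int[mu]_x (cos (t * x) * gw 1 x)%:E = (Num.sqrt pi * gw 4^-1 t)%:E)%E.
Proof.
have i1 := le_integrable_gw (measurable_cosM t) (fun x => cos_max (t * x)).
have i0 := integrable_gwT (ltr01 : 0 < 1 :> R).
have : (\int[mu]_x (cos (t * x) * gw 1 x + gw 1 x)%:E = (Num.sqrt pi * gw 4^-1 t + Num.sqrt pi)%:E)%E.
  rewrite (@ge0_symfun_integralT _ (fun x => cos (t * x) * gw 1 x + gw 1 x)); last 3 first.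
  - move=> x; rewrite -{2}[gw 1 x]mul1r -mulrDl mulr_ge0 ?gw_ge0//.
  - move=> x; apply: cvgD; last exact: continuous_gw.
    by apply: cvgM; [exact: continuous_cosM|exact: continuous_gw].
  - by move=> x; rewrite /gw/= mulrN cosN sqrrN.
  rewrite -set_itvcy -integral_itv_obnd_cbnd; last first.
    apply/measurable_EFinP; apply: measurable_funTS; apply: measurable_funD; last exact: measurable_gw.
    by apply: measurable_funM; [exact: measurable_cosM|exact: measurable_gw].
  under eq_integral do rewrite EFinD.
  rewrite integralD//; last 2 first.
    exact: integrable_cos_gw.
    by apply: integrableS (i0).
  have c1 : (\int[mu]_(x in hl) (cos (t * x) * gw 1 x)%:E = (Num.sqrt pi / 2 * gw 4^-1 t)%:E)%E.
    by rewrite -Rintegral_cos_gw fineK//; apply: integrable_fin_num => //; exact: integrable_cos_gw.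
  rewrite c1 integral_gw//.
  by rewrite divr1 -EFinD -EFinM; congr EFin; field.
under eq_integral do rewrite EFinD.
rewrite integralD// integral_gwT// divr1 => /(congr1 (fun z => z - (Num.sqrt pi)%:E)%E).
rewrite EFinD addeK// addeK//.
Qed.

(** Lebesgue measure is invariant under negation and the integrand is odd, so this finite integral
    equals its own opposite. *)
Lemma integral_sin_gwT (t : R) : (\int[mu]_x (sin (t * x) * gw 1 x)%:E = 0)%E.
Proof.
have i1 := le_integrable_gw (measurable_sinM t) (fun x => sin_max (t * x)).
have mN : measurable_fun setT (-%R : R -> measurableTypeR R) by exact: oppr_measurable.
have : (\int[mu]_x (sin (t * x) * gw 1 x)%:E = - \int[mu]_x (sin (t * x) * gw 1 x)%:E)%E.
  transitivity (\int[mu]_x (- (sin (t * x) * gw 1 x)%:E))%E; last by rewrite integralN//; exact: integrable_add_def.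
  transitivity (\int[pushforward mu (-%R : R -> measurableTypeR R)]_x (sin (t * x) * gw 1 x)%:E)%E.
    by apply: eq_measure_integral => A mA _; exact/esym/lebesgue_measureN.
  rewrite integral_pushforward//=.
  - by apply: eq_integral => x _ /=; rewrite /gw mulrN sinN sqrrN mulNr.
  - exact: measurable_int i1.
  have := le_integrable_gw (measurable_sinM (- t)) (fun x => sin_max (- t * x)).
  by apply: eq_integrable => // x _; rewrite /= /gw mulrN mulNr sqrrN.
have : (\int[mu]_x (sin (t * x) * gw 1 x)%:E)%E \is a fin_num by exact: integrable_fin_num.
case: (\int[mu]_x _)%E => [r| |]// _ [] h; congr EFin; lra.
Qed.

(** This trades a squared variable in an exponent for a linear one in a cosine, while a phase th
    carries the variables not yet treated. *)
Lemma integral_cosD_gwT (s th : R) :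
  (\int[mu]_x (cos (x * s + th) * gw 1 x)%:E = (Num.sqrt pi * (gw 4^-1 s * cos th))%:E)%E.
Proof.
have i1 := le_integrable_gw (measurable_sinM s) (fun x => sin_max (s * x)).
have i2 := le_integrable_gw (measurable_cosM s) (fun x => cos_max (s * x)).
transitivity (\int[mu]_x ((cos th * (cos (s * x) * gw 1 x)) - sin th * (sin (s * x) * gw 1 x))%:E)%E.
  by apply: eq_integral => x _; congr EFin; rewrite cosD (mulrC x); ring.
under eq_integral do rewrite EFinB.
rewrite integralB//; try by apply: integrable_EFinZ.
under eq_integral do rewrite EFinM.
under [X in (_ - X)%E]eq_integral do rewrite EFinM.
rewrite !integralZl// integral_sin_gwT integral_cos_gwT mule0 sube0 -EFinM.
by congr EFin; ring.
Qed.

(** Completing the square gives a multiple of the normal density of mean l / (2 lam). *)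
Lemma integral_gw_expR (lam l : R) : 0 < lam ->
  (\int[mu]_x (gw lam x * expR (l * x))%:E =
    (Num.sqrt (pi / lam) * expR (l ^+ 2 / (4 * lam)))%:E)%E.
Proof.
move=> l0; pose s : R := (Num.sqrt (2 * lam))^-1.
have s0 : s != 0 by rewrite invr_eq0 gt_eqF// sqrtr_gt0 mulr_gt0.
have s2 : s ^+ 2 = (2 * lam)^-1.
  by rewrite exprVn sqr_sqrtr// mulr_ge0// ltW.
have pk : normal_peak s = (Num.sqrt (pi / lam))^-1.
  rewrite /normal_peak s2; congr (Num.sqrt _)^-1.
  by rewrite -mulr_natr; field; rewrite gt_eqF.
have pl : Num.sqrt (pi / lam) != 0 by rewrite gt_eqF// sqrtr_gt0 divr_gt0// pi_gt0.
transitivity (\int[mu]_x ((Num.sqrt (pi / lam) * expR (l ^+ 2 / (4 * lam)))%:E *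
    (normal_pdf (l / (2 * lam)) s x)%:E))%E; last first.
  rewrite ge0_integralZl//.
  - by rewrite integral_normal_pdf mule1.
  - by apply/measurable_EFinP; exact: measurable_normal_pdf.
  - by move=> x _; rewrite lee_fin normal_pdf_ge0.
apply: eq_integral => x _; rewrite -EFinM normal_pdfE// pk; congr EFin.
rewrite /gw /normal_fun s2 mulrACA divff// mul1r -!expRD; congr expR.
by rewrite -mulr_natr; field; rewrite gt_eqF.
Qed.

End gauss_fourier.

(** * Uniqueness of the joint density *)

Section rectangle_uniqueness.
Context d1 d2 (T1 : measurableType d1) (T2 : measurableType d2) (R : realType).
Variables m1 m2 : {measure set (T1 * T2) -> \bar R}.

Lemma measure_unique_rect : (m1 setT < +oo)%E ->
  (forall A B, measurable A -> measurable B -> m1 (A `*` B) = m2 (A `*` B)) ->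
  forall C, measurable C -> m1 C = m2 C.
Proof.
move=> m1T m12 C mC.
apply: (measure_unique [set A `*` B | A in measurable & B in measurable] (fun=> setT)) => //.
- by rewrite measurable_prod_measurableType.
- move=> _ _ [A1 mA1 [B1 mB1 <-]] [A2 mA2 [B2 mB2 <-]].
  rewrite -setXI; exists (A1 `&` A2); first exact: measurableI.
  by exists (B1 `&` B2) => //; exact: measurableI.
- by move=> _; exists setT => //; exists setT => //; rewrite setXTT.
- by apply/seteqP; split => // x _; exists 0%N.
- by move=> _ [A mA [B mB <-]]; exact: m12.
Qed.

End rectangle_uniqueness.

Lemma measurable_invr_ge0 d (T : measurableType d) (R : realType) (g : T -> R) :
  (forall x, 0 <= g x) -> measurable_fun setT g -> measurable_fun setT (fun x => (g x)^-1).
Proof.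
move=> g0 mg; rewrite (_ : (fun x => _) = (fun x => if 0 < g x then expR (- ln (g x)) else 0)); last first.
  apply/funext => x; case: ltP => gx; first by rewrite expRN lnK.
  by rewrite (_ : g x = 0) ?invr0//; apply/eqP; rewrite eq_le gx g0.
apply: measurable_fun_ifT => //; first exact: measurable_fun_ltr.
apply: measurableT_comp; first exact: measurable_expR.
by apply: measurableT_comp => //; apply: measurableT_comp => //; exact: measurable_ln.
Qed.

Section density_uniqueness.
Context {R : realType}.
Notation mu := (@lebesgue_measure R).
Variables f g : R -> R -> R.
Hypotheses (f0 : forall x y, 0 <= f x y) (g0 : forall x y, 0 <= g x y).
Hypothesis mf : measurable_fun setT (fun z : R * R => f z.1 z.2).
Hypothesis mg : measurable_fun setT (fun z : R * R => g z.1 z.2).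
Hypothesis fi : (\int[(mu \x mu)%E]_z (f z.1 z.2)%:E < +oo)%E.
Hypothesis fg : forall A B : set R, measurable A -> measurable B ->
  (\int[(mu \x mu)%E]_(z in A `*` B) (f z.1 z.2)%:E =
   \int[(mu \x mu)%E]_(z in A `*` B) (g z.1 z.2)%:E)%E.

Let int_f : (mu \x mu)%E.-integrable setT (EFin \o (fun z : R * R => f z.1 z.2)).
Proof.
apply/integrableP; split; first exact/measurable_EFinP.
by under eq_integral do rewrite /= ger0_norm//.
Qed.

Let int_g : (mu \x mu)%E.-integrable setT (EFin \o (fun z : R * R => g z.1 z.2)).
Proof.
apply/integrableP; split; first exact/measurable_EFinP.
under eq_integral do rewrite /= ger0_norm//.
by have := fg measurableT measurableT; rewrite setXTT => <-.
Qed.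

(** Agreement on rectangles extends to the whole product sigma-algebra because both weighted
    measures are finite; integrable functions with equal integrals over all measurable sets agree
    almost everywhere. *)
Lemma density_ae_eq : ae_eq (mu \x mu)%E setT (fun z : R * R => (f z.1 z.2)%:E)
  (fun z : R * R => (g z.1 z.2)%:E).
Proof.
apply: integral_ae_eq => //; first exact/measurable_EFinP.
move=> E _ mE.
have [m1 m1E] := @wmeas_measure _ _ (measurableTypeR R * measurableTypeR R)%type
  (measurableTypeR R * measurableTypeR R)%type R (mu \x mu)%E _ id
  (fun z => f0 z.1 z.2) int_f (@measurable_id _ _ setT).
have [m2 m2E] := @wmeas_measure _ _ (measurableTypeR R * measurableTypeR R)%type
  (measurableTypeR R * measurableTypeR R)%type R (mu \x mu)%E _ id
  (fun z => g0 z.1 z.2) int_g (@measurable_id _ _ setT).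
have : m1 E = m2 E.
  apply: measure_unique_rect mE; first by rewrite m1E.
  by move=> A B mA mB; rewrite m1E m2E; exact: fg.
by rewrite m1E m2E.
Qed.

Let mF (k : R -> R -> R) : (forall x y, 0 <= k x y) ->
  measurable_fun setT (fun z : R * R => k z.1 z.2) ->
  measurable_fun setT (fubini_F mu (fun z : R * R => (k z.1 z.2)%:E)).
Proof.
move=> k0 mk; apply: measurable_fun_fubini_tonelli_F; first exact/measurable_EFinP.
by move=> z; rewrite lee_fin.
Qed.

Let mG (k : R -> R -> R) : (forall x y, 0 <= k x y) ->
  measurable_fun setT (fun z : R * R => k z.1 z.2) ->
  measurable_fun setT (fubini_G mu (fun z : R * R => (k z.1 z.2)%:E)).
Proof.
move=> k0 mk; apply: measurable_fun_fubini_tonelli_G; first exact/measurable_EFinP.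
by move=> z; rewrite lee_fin.
Qed.

Let int_fst (k : R -> R -> R) (A : set R) : (forall x y, 0 <= k x y) ->
  measurable_fun setT (fun z : R * R => k z.1 z.2) -> measurable A ->
  (\int[mu]_(x in A) fubini_F mu (fun z : R * R => (k z.1 z.2)%:E) x =
   \int[(mu \x mu)%E]_(z in A `*` setT) (k z.1 z.2)%:E)%E.
Proof.
move=> k0 mk mA.
rewrite integral_mkcond [in RHS]integral_mkcond fubini_tonelli1.
- apply: eq_integral => x _; rewrite /fubini_F /patch; case: ifPn => xA.
    by apply: eq_integral => y _; rewrite mem_set//=; split => //; exact: set_mem.
  rewrite integral0_eq// => y _; rewrite memNset//= => -[xA' _].
  by move: xA; rewrite mem_set.
- apply/measurable_restrict => //; first exact: measurableX.
  by apply: measurable_funTS; exact/measurable_EFinP.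
- by move=> z; rewrite /patch; case: ifP => // _; rewrite lee_fin.
Qed.

Let int_snd (k : R -> R -> R) (A : set R) : (forall x y, 0 <= k x y) ->
  measurable_fun setT (fun z : R * R => k z.1 z.2) -> measurable A ->
  (\int[mu]_(y in A) fubini_G mu (fun z : R * R => (k z.1 z.2)%:E) y =
   \int[(mu \x mu)%E]_(z in setT `*` A) (k z.1 z.2)%:E)%E.
Proof.
move=> k0 mk mA.
rewrite integral_mkcond [in RHS]integral_mkcond fubini_tonelli2.
- apply: eq_integral => y _; rewrite /fubini_G /patch; case: ifPn => yA.
    by apply: eq_integral => x _; rewrite mem_set//=; split => //; exact: set_mem.
  rewrite integral0_eq// => x _; rewrite memNset//= => -[_ yA'].
  by move: yA; rewrite mem_set.
- apply/measurable_restrict => //; first exact: measurableX.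
  by apply: measurable_funTS; exact/measurable_EFinP.
- by move=> z; rewrite /patch; case: ifP => // _; rewrite lee_fin.
Qed.

(** Integrating the marginal over A is integrating the density over the strip A times the line,
    where f and g agree by hypothesis. *)
Lemma marg1_ae_eq : {ae mu, forall x, marg1 f x = marg1 g x}.
Proof.
have h : ae_eq mu setT (fubini_F mu (fun z : R * R => (f z.1 z.2)%:E))
    (fubini_F mu (fun z : R * R => (g z.1 z.2)%:E)).
  apply: integral_ae_eq => //; [|exact: mF|].
    apply/integrableP; split; first exact: mF.
    have F0 x : (0 <= fubini_F mu (fun z : R * R => (f z.1 z.2)%:E) x)%E.
      by apply: integral_ge0 => y _; rewrite lee_fin.
    under eq_integral do rewrite gee0_abs//.
    by rewrite int_fst// setXTT.
  by move=> E _ mE; rewrite !int_fst//; exact: fg.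
by apply: filterS h => x /(_ I); rewrite /fubini_F /marg1 => ->.
Qed.

Lemma marg2_ae_eq : {ae mu, forall y, marg2 f y = marg2 g y}.
Proof.
have h : ae_eq mu setT (fubini_G mu (fun z : R * R => (f z.1 z.2)%:E))
    (fubini_G mu (fun z : R * R => (g z.1 z.2)%:E)).
  apply: integral_ae_eq => //; [|exact: mG|].
    apply/integrableP; split; first exact: mG.
    have F0 x : (0 <= fubini_G mu (fun z : R * R => (f z.1 z.2)%:E) x)%E.
      by apply: integral_ge0 => y _; rewrite lee_fin.
    under eq_integral do rewrite gee0_abs//.
    by rewrite int_snd// setXTT.
  by move=> E _ mE; rewrite !int_snd//; exact: fg.
by apply: filterS h => x /(_ I); rewrite /fubini_G /marg2 => ->.
Qed.

Let ae_fst (Q : R -> Prop) : {ae mu, forall x, Q x} -> {ae (mu \x mu)%E, forall z : R * R, Q z.1}.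
Proof.
move=> [N [mN N0 QN]]; exists (N `*` setT); split.
- exact: measurableX.
- by rewrite [LHS]product_measure1E// [X in (X * _)%E]N0 mul0e.
- by move=> z /= Qz; split => //; apply: QN.
Qed.

Let ae_snd (Q : R -> Prop) : {ae mu, forall x, Q x} -> {ae (mu \x mu)%E, forall z : R * R, Q z.2}.
Proof.
move=> [N [mN N0 QN]]; exists (setT `*` N); split.
- exact: measurableX.
- by rewrite [LHS]product_measure1E// [X in (_ * X)%E]N0 mule0.
- by move=> z /= Qz; split => //; apply: QN.
Qed.

Let measurable_mi (k : R -> R -> R) : (forall x y, 0 <= k x y) ->
  measurable_fun setT (fun z : R * R => k z.1 z.2) ->
  measurable_fun setT (fun z : R * R => k z.1 z.2 * log2 (k z.1 z.2 / (marg1 k z.1 * marg2 k z.2))).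
Proof.
move=> k0 mk; apply: measurable_funM => //; apply: measurable_funM => //.
apply: measurableT_comp; first exact: measurable_ln.
apply: measurable_funM => //; apply: measurable_invr_ge0.
  by move=> z; rewrite mulr_ge0// fine_ge0// integral_ge0// => y _; rewrite lee_fin.
apply: measurable_funM.
  by apply: (@measurable_fun1 _ (marg1 k)); apply: measurableT_comp => //; exact: mF.
by apply: (@measurable_fun2 _ (marg2 k)); apply: measurableT_comp => //; exact: mG.
Qed.

(** The integrand involves the density and both marginals, so three almost-everywhere equalities are
    needed; null sets of the line lift to null strips in the plane. *)
Lemma mutual_info_unique : mutual_info f = mutual_info g.
Proof.
apply: ae_eq_integral => //; try (apply/measurable_EFinP; exact: measurable_mi).
near=> z => _ /=.
have -> : f z.1 z.2 = g z.1 z.2.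
  apply: EFin_inj; have := density_ae_eq; near: z.
  by apply: filterS density_ae_eq => z /(_ I).
have -> : marg1 f z.1 = marg1 g z.1 by near: z; exact: ae_fst marg1_ae_eq.
have -> // : marg2 f z.2 = marg2 g z.2 by near: z; exact: ae_snd marg2_ae_eq.
Unshelve. all: by end_near. Qed.

End density_uniqueness.

Lemma integrable_le1 d (T : measurableType d) (R : realType) (P : probability T R) (f : T -> R) :
  measurable_fun setT f -> (forall x, `|f x| <= 1) -> P.-integrable setT (EFin \o f).
Proof.
move=> mf f1; apply: (@le_integrable _ _ _ P _ _ _ (EFin \o cst 1)) => //.
- exact/measurable_EFinP.
- by move=> x _; rewrite /= normr1 lee_fin.
- exact: finite_measure_integrable_cst.
Qed.

(** * Characteristic function and joint density of the envelopes *)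

Section independence.
Context d (T : measurableType d) (R : realType) (P : probability T R).

Let measurable_preim d' (T' : measurableType d') (X : T -> T') A :
  measurable_fun setT X -> measurable A -> measurable (X @^-1` A).
Proof. by move=> mX mA; rewrite -[X in measurable X]setTI; exact: mX. Qed.

(** Both sides are finite measures in C, the image of P restricted to K and G and P(G) times the
    image of P restricted to K, and they agree on rectangles. *)
Lemma indep_pair d1 d2 (T1 : measurableType d1) (T2 : measurableType d2)
    (X : T -> T1) (Y : T -> T2) (K G : set T) :
  measurable_fun setT X -> measurable_fun setT Y -> measurable K -> measurable G ->
  (forall A B, measurable A -> measurable B ->
    P (K `&` X @^-1` A `&` Y @^-1` B `&` G) = (P (K `&` X @^-1` A `&` Y @^-1` B) * P G)%E) ->
  forall C, measurable C ->
    P (K `&` (fun w => (X w, Y w)) @^-1` C `&` G) =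
    (P (K `&` (fun w => (X w, Y w)) @^-1` C) * P G)%E.
Proof.
move=> mX mY mK mG h C mC; pose phi w := (X w, Y w).
have mphi : measurable_fun setT phi by exact: measurable_fun_pair.
pose g := fine (P G).
have gE : P G = g%:E by rewrite fineK// fin_num_measure.
have g0 : 0 <= g by exact: fine_ge0.
have i1 : P.-integrable setT (EFin \o (\1_(K `&` G) : T -> R)).
  by apply: integrable_indic => //; exact: measurableI.
have i2 : P.-integrable setT (EFin \o (fun w => g * \1_K w)).
  by apply: integrable_EFinZ => //; exact: integrable_indic.
have v1 w : 0 <= (\1_(K `&` G) : T -> R) w by [].
have v2 w : 0 <= g * (\1_K : T -> R) w by rewrite mulr_ge0.
have [m1 m1E] := wmeas_measure v1 i1 mphi.
have [m2 m2E] := wmeas_measure v2 i2 mphi.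
have E1 D : measurable D -> m1 D = P (K `&` phi @^-1` D `&` G).
  move=> mD; rewrite m1E /wmeas integral_indic//; last 2 first.
    exact: measurable_preim.
    exact: measurableI.
  by congr (P _); rewrite setIAC.
have E2 D : measurable D -> m2 D = (P (K `&` phi @^-1` D) * P G)%E.
  move=> mD; rewrite m2E /wmeas; under eq_integral do rewrite EFinM.
  rewrite ge0_integralZl//=; last 2 first.
    exact: measurable_preim.
    by apply/measurable_EFinP; apply: measurable_funTS; exact: measurable_indic.
  by rewrite integral_indic// ?gE 1?muleC//; exact: measurable_preim.
rewrite -E1// -E2//; apply: measure_unique_rect mC.
  by rewrite E1// (le_lt_trans (probability_le1 _ _)) ?ltry//; do 2?apply: measurableI => //; exact: measurable_preim.
move=> A B mA mB; rewrite E1 ?E2//; try exact: measurableX.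
by have := h A B mA mB; rewrite -!setIA.
Qed.

(** The event G is independent of every rectangle event in the variables of [Xs], intersected with
    K. The recursion lets the head of the list be rewritten while the tail is untouched. *)
Fixpoint indepl (G K : set T) (Xs : seq (T -> R)) : Prop :=
  if Xs is X :: Xs' then forall A, measurable A -> indepl G (K `&` X @^-1` A) Xs'
  else P (K `&` G) = (P K * P G)%E.

Fixpoint measl (Xs : seq (T -> R)) : Prop :=
  if Xs is X :: Xs' then measurable_fun setT X /\ measl Xs' else True.

(** Merging the two leading variables; repeated, it reduces independence from rectangles to
    independence from one linear form. The conditions on the other variables are moved into K, which
    leaves a statement about the pair (X, Y) and a measurable set of the plane. *)
Lemma indepl_lin (G K : set T) (X Y : T -> R) (a b : R) (Xs : seq (T -> R)) :
  measurable_fun setT X -> measurable_fun setT Y -> measl Xs ->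
  measurable K -> measurable G ->
  indepl G K (X :: Y :: Xs) -> indepl G K ((fun w => a * X w + b * Y w) :: Xs).
Proof.
move=> mX mY; elim: Xs K => [|Z Xs ih] K mXs mK mG h.
  move=> C mC /=; pose l (z : R * R) := a * z.1 + b * z.2.
  have ml : measurable_fun setT l by apply: measurable_funD; apply: measurable_funM.
  have /(_ (l @^-1` C)) := indep_pair mX mY mK mG (fun A B mA mB => h A mA B mB); apply.
  by rewrite -[X in measurable X]setTI; exact: ml.
move=> C mC D mD; rewrite setIAC; case: mXs => mZ mXs.
apply: ih => //; first by apply: measurableI => //; exact: measurable_preim.
move=> A mA B mB; have := h A mA B mB D mD.
by rewrite [K `&` Z @^-1` D `&` _]setIAC [K `&` _ `&` Z @^-1` D `&` _]setIAC.
Qed.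

(** In the addition formula the sine part drops out because Y has vanishing sine mean, so only the
    cosine half of the characteristic function has to be propagated. *)
Lemma indep_cosD (X Y : T -> R) (cX cY : R) :
  measurable_fun setT X -> measurable_fun setT Y ->
  (forall A B, measurable A -> measurable B ->
    P (X @^-1` A `&` Y @^-1` B) = (P (X @^-1` A) * P (Y @^-1` B))%E) ->
  (\int[P]_w (cos (X w))%:E = cX%:E)%E -> (\int[P]_w (cos (Y w))%:E = cY%:E)%E ->
  (\int[P]_w (sin (Y w))%:E = 0)%E ->
  (\int[P]_w (cos (X w + Y w))%:E = (cX * cY)%:E)%E.
Proof.
move=> mX mY ind hX hY hS.
pose X' : {mfun T >-> R} := HB.pack X (isMeasurableFun.Build _ _ _ _ X mX).
pose Y' : {mfun T >-> R} := HB.pack Y (isMeasurableFun.Build _ _ _ _ Y mY).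
pose phi w := (X w, Y w).
have mphi : measurable_fun setT phi by exact: measurable_fun_pair.
pose phi' : {mfun T >-> (R * R)%type} := HB.pack phi (isMeasurableFun.Build _ _ _ _ phi mphi).
pose m1 := distribution P X'; pose m2 := distribution P Y'; pose m := distribution P phi'.
have mcos : measurable_fun setT (@cos R) by apply: continuous_measurable_fun; exact: continuous_cos.
have msin : measurable_fun setT (@sin R) by apply: continuous_measurable_fun; exact: continuous_sin.
have mm C : measurable C -> (m1 \x m2)%E C = m C.
  by move=> mC; apply: product_measure_unique => // A B mA mB; exact: ind.
have mc2 : measurable_fun setT (fun z : R * R => cos (z.1 + z.2)).
  by apply: (measurableT_comp mcos); exact: measurable_funD.
have ic2 : (m1 \x m2)%E.-integrable setT (EFin \o (fun z : R * R => cos (z.1 + z.2))).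
  apply/integrableP; split; first exact/measurable_EFinP.
  rewrite (eq_measure_integral m) => [|A mA _]; last exact: mm.
  by have /integrableP[] := @integrable_le1 _ _ _ m _ mc2 (fun z => cos_max (z.1 + z.2)).
have int1 (f : R -> R) (Z' : {mfun T >-> R}) : measurable_fun setT f -> (forall x, `|f x| <= 1) ->
    (\int[distribution P Z']_x (f x)%:E = \int[P]_w (f (Z' w))%:E)%E.
  move=> mf f1; rewrite /distribution integral_pushforward//; first exact/measurable_EFinP.
  by apply: integrable_le1 => //; exact: measurableT_comp.
transitivity (\int[m]_z (cos (z.1 + z.2))%:E)%E.
  rewrite /m /distribution integral_pushforward//; first exact/measurable_EFinP.
  apply: (@integrable_le1 _ _ _ P (fun w => cos (X w + Y w))); last by move=> w; exact: cos_max.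
  by apply: (measurableT_comp mcos); exact: measurable_funD.
rewrite (eq_measure_integral (m1 \x m2)%E) => [|A mA _]; last exact/esym/mm.
rewrite -integral12_prod_meas1//.
transitivity (\int[m1]_x (cY%:E * (cos x)%:E))%E.
  apply: eq_integral => x _; rewrite /fubini_F/=.
  transitivity (\int[m2]_y ((cos x)%:E * (cos y)%:E - (sin x)%:E * (sin y)%:E))%E.
    by apply: eq_integral => y _; rewrite cosD EFinB !EFinM.
  have ic : m2.-integrable setT (EFin \o @cos R) by apply: integrable_le1 => //; exact: cos_max.
  have isn : m2.-integrable setT (EFin \o @sin R) by apply: integrable_le1 => //; exact: sin_max.
  rewrite integralB//; try exact: integrableZl.
  rewrite !integralZl// int1//; last exact: cos_max.
  rewrite int1//; last exact: sin_max.
  by rewrite hY hS mule0 sube0 muleC.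
have ic : m1.-integrable setT (EFin \o @cos R) by apply: integrable_le1 => //; exact: cos_max.
by rewrite integralZl// int1//; [rewrite hX -EFinM mulrC|exact: cos_max].
Qed.

(** Fubini between P and Gaussian averaging in n: the average of cos(n S + Th) is exp(-S^2/4) cos
    Th. V collects the Gaussian factors already produced, Th the coordinates still to be treated. *)
Lemma integral_gauss_linear (V S Th : T -> R) (c : R -> R) (v : R) :
  measurable_fun setT V -> measurable_fun setT S -> measurable_fun setT Th ->
  (forall w, `|V w| <= 1) ->
  (forall n, (\int[P]_w (V w * cos (n * S w + Th w))%:E = (c n)%:E)%E) ->
  (\int[@lebesgue_measure R]_n (c n * gw 1 n)%:E = (Num.sqrt pi * v)%:E)%E ->
  (\int[P]_w (V w * gw 4^-1 (S w) * cos (Th w))%:E = v%:E)%E.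
Proof.
pose mu := [the {sigma_finite_measure set (measurableTypeR R) -> \bar R} of @lebesgue_measure R].
move=> mV mS mT V1 hc hv.
have mcos : measurable_fun setT (@cos R) by apply: continuous_measurable_fun; exact: continuous_cos.
pose f (z : T * R) := V z.1 * (cos (z.2 * S z.1 + Th z.1) * gw 1 z.2).
have mf : measurable_fun setT f.
  apply: measurable_funM; first exact: (measurableT_comp mV).
  apply: measurable_funM; last exact: (measurableT_comp (measurable_gw 1)).
  apply: (measurableT_comp mcos); apply: measurable_funD; last exact: (measurableT_comp mT).
  by apply: measurable_funM => //; exact: (measurableT_comp mS).
have gT : (\int[mu]_n (gw 1 n)%:E = (Num.sqrt pi)%:E)%E by rewrite integral_gwT// divr1.
have c1 w n : `|V w * cos (n * S w + Th w)| <= 1.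
  by rewrite normrM -[leRHS]mul1r ler_pM// cos_max.
have mnw n : measurable_fun setT (fun w => n * S w + Th w).
  by apply: measurable_funD => //; exact: measurable_funM.
have fi : (P \x mu)%E.-integrable setT (EFin \o f).
  apply/integrable12ltyP; first exact/measurable_EFinP.
  apply: (@le_lt_trans _ _ (\int[P]_w (Num.sqrt pi)%:E)%E); last first.
    by rewrite integral_cst//= probability_setT mule1 ltry.
  apply: ge0_le_integral => //.
  - by move=> w _; exact: integral_ge0.
  - apply: (@measurable_fun_fubini_tonelli_F _ _ T (measurableTypeR R) R mu (abse \o (EFin \o f))) => //.
    + by apply: measurableT_comp => //; exact/measurable_EFinP.
    + by move=> z; exact: abse_ge0.
  - move=> w _; rewrite -gT; apply: ge0_le_integral => //.
    + apply: measurableT_comp => //; apply/measurable_EFinP.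
      exact: (measurableT_comp mf (measurable_pair1 w)).
    + by apply/measurable_EFinP; exact: measurable_gw.
    + move=> n _ /=; rewrite lee_fin /f/= mulrA normrM (ger0_norm (gw_ge0 _ _)).
      by rewrite ler_piMl ?gw_ge0// c1.
have sp : 0 < Num.sqrt pi :> R by rewrite sqrtr_gt0 pi_gt0.
have F := Fubini fi.
have L : (\int[P]_w \int[mu]_n (f (w, n))%:E =
    (Num.sqrt pi)%:E * \int[P]_w (V w * gw 4^-1 (S w) * cos (Th w))%:E)%E.
  rewrite -integralZl//; last first.
    apply: integrable_le1.
      apply: measurable_funM; last exact: (measurableT_comp mcos).
      by apply: measurable_funM => //; exact: (measurableT_comp (measurable_gw _)).
    move=> w; rewrite normrM -[leRHS]mul1r ler_pM// ?cos_max// normrM -[leRHS]mul1r ler_pM//.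
    by rewrite ger0_norm ?gw_ge0// gw_le1.
  apply: eq_integral => w _; rewrite /f/=; under eq_integral do rewrite EFinM.
  rewrite integralZl//; last first.
    apply: le_integrable_gw => [|n]; last exact: cos_max.
    by apply: (measurableT_comp mcos); apply: measurable_funD => //; exact: measurable_funM.
  by rewrite integral_cosD_gwT -!EFinM; congr EFin; ring.
have K : (\int[mu]_n \int[P]_w (f (w, n))%:E = (Num.sqrt pi * v)%:E)%E.
  rewrite -hv; apply: eq_integral => n _; rewrite mulrC EFinM -hc -integralZl//; last first.
    apply: integrable_le1 => //.
    by apply: measurable_funM => //; exact: (measurableT_comp mcos).
  by apply: eq_integral => w _; rewrite -EFinM /f/=; congr EFin; ring.
move: F; rewrite /= L K EFinM => /(congr1 (fun z => (Num.sqrt pi)^-1%:E * z)%E).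
by rewrite !muleA -EFinM mulVf ?mul1e// gt_eqF.
Qed.

End independence.

(** A Gaussian characteristic function has this form once one coordinate n is singled out, with l
    and k depending on the others. *)
Lemma integral_expR_quadratic_gw (R : realType) (C lam l k : R) : 0 < 1 + lam ->
  (\int[@lebesgue_measure R]_n (C * expR (- (lam * n ^+ 2) + l * n + k) * gw 1 n)%:E =
   (Num.sqrt pi * (C / Num.sqrt (1 + lam) * expR (k + l ^+ 2 / (4 * (1 + lam)))))%:E)%E.
Proof.
move=> l0.
transitivity (\int[@lebesgue_measure R]_n ((C * expR k)%:E * (gw (1 + lam) n * expR (l * n))%:E))%E.
  apply: eq_integral => n _; rewrite -EFinM; congr EFin.
  rewrite -!mulrA; congr (_ * _); rewrite /gw -!expRD; congr expR; ring.
rewrite integralZl//; last first.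
  apply/integrableP; split.
    apply/measurable_EFinP; apply: measurable_funM; first exact: measurable_gw.
    by apply: measurableT_comp => //; exact: measurable_funM.
  rewrite [ltLHS](_ : _ = \int[@lebesgue_measure R]_x (gw (1 + lam) x * expR (l * x))%:E)%E; last first.
    by apply: eq_integral => x _; rewrite gee0_abs// lee_fin mulr_ge0// ?gw_ge0// expR_ge0.
  by rewrite integral_gw_expR// ltry.
rewrite integral_gw_expR// -EFinM; congr EFin.
rewrite sqrtrM ?pi_ge0// sqrtrV ?(ltW l0)// expRD; ring.
Qed.

(** * From the characteristic function to the Laplace transform *)

Section laplace_of_charfun.
Context d (T : measurableType d) (R : realType) (P : probability T R).
Variables (U1 U2 V1 V2 : T -> R) (SA SE p r s : R).
Hypotheses (mU1 : measurable_fun setT U1) (mU2 : measurable_fun setT U2).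
Hypotheses (mV1 : measurable_fun setT V1) (mV2 : measurable_fun setT V2).
Hypotheses (SA0 : 0 < SA) (SE0 : 0 < SE) (cS : p ^+ 2 * (r ^+ 2 + s ^+ 2) < SA * SE).
Hypothesis cf : forall a1 a2 b1 b2,
  (\int[P]_w (cos (a1 * U1 w + a2 * U2 w + b1 * V1 w + b2 * V2 w))%:E =
   (expR (- (SA * (a1 ^+ 2 + a2 ^+ 2) + SE * (b1 ^+ 2 + b2 ^+ 2) +
      2 * p * (a1 * (r * b1 - s * b2) + a2 * (r * b2 + s * b1))) / 4))%:E)%E.

Lemma laplace_of_charfun (a b : R) : 0 <= a -> 0 <= b ->
  (\int[P]_w (expR (- (a * (U1 w ^+ 2 + U2 w ^+ 2))) * expR (- (b * (V1 w ^+ 2 + V2 w ^+ 2))))%:E =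
   ((1 + a * SA) * (1 + b * SE) - a * b * (p ^+ 2 * (r ^+ 2 + s ^+ 2)))^-1%:E)%E.
Proof.
move=> a0 b0.
(* The factor 2 matches [gw 4^-1]: at A U the latter is exp(-a U^2). *)
pose A := 2 * Num.sqrt a; pose B := 2 * Num.sqrt b; pose k := Num.sqrt a * Num.sqrt b * p.
have A2 : A ^+ 2 = 4 * a by rewrite exprMn sqr_sqrtr//; ring.
have B2 : B ^+ 2 = 4 * b by rewrite exprMn sqr_sqrtr//; ring.
have eA (x : R) : (x * A) ^+ 2 = 4 * a * x ^+ 2 by rewrite -A2; ring.
have eB (x : R) : (x * B) ^+ 2 = 4 * b * x ^+ 2 by rewrite -B2; ring.
have ABk : A * B * p = 4 * k by rewrite /A /B /k; ring.
have k2 : k ^+ 2 = a * b * p ^+ 2 by rewrite 2!exprMn !sqr_sqrtr.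
pose m := 1 + a * SA.
have m0 : 0 < m by rewrite /m; have := mulr_ge0 a0 (ltW SA0); lra.
(* 1 + M is the Schur complement left after the first two coordinates: the squares (r n3 - s n4)^2
   and (r n4 + s n3)^2 add up to (r^2 + s^2)(n3^2 + n4^2), so the remaining form is diagonal and m
   (1 + M) is the target determinant. *)
pose M := b * SE - k ^+ 2 * (r ^+ 2 + s ^+ 2) / m.
have mM : m * (1 + M) = (1 + a * SA) * (1 + b * SE) - a * b * (p ^+ 2 * (r ^+ 2 + s ^+ 2)).
  rewrite (mulrA (a * b)) -k2 /M -/m; field; by rewrite gt_eqF.
have M0 : 0 < 1 + M.
  rewrite -(pmulr_rgt0 _ m0) mM.
  have := mulr_ge0 (mulr_ge0 a0 b0) (ltW (_ : 0 < SA * SE - p ^+ 2 * (r ^+ 2 + s ^+ 2))).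
  rewrite subr_gt0 cS => /(_ isT).
  have := mulr_ge0 a0 (ltW SA0); have := mulr_ge0 b0 (ltW SE0).
  by move: (p ^+ 2 * _) => c; nra.
have sm : Num.sqrt m != 0 by rewrite gt_eqF// sqrtr_gt0.
have sM : Num.sqrt (1 + M) != 0 by rewrite gt_eqF// sqrtr_gt0.
have sm2 : Num.sqrt m ^+ 2 = m by rewrite sqr_sqrtr// ltW.
have sM2 : Num.sqrt (1 + M) ^+ 2 = 1 + M by rewrite sqr_sqrtr// ltW.
have mA1 : measurable_fun setT (fun w => A * U1 w) by exact: measurable_funM.
have mA2 : measurable_fun setT (fun w => A * U2 w) by exact: measurable_funM.
have mB1 : measurable_fun setT (fun w => B * V1 w) by exact: measurable_funM.
have mB2 : measurable_fun setT (fun w => B * V2 w) by exact: measurable_funM.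
have mg (S : T -> R) : measurable_fun setT S -> measurable_fun setT (fun w => gw 4^-1 (S w)).
  by move=> mS; exact: (measurableT_comp (measurable_gw _)).
have g1 (V S : T -> R) : (forall w, `|V w| <= 1) -> forall w, `|V w * gw 4^-1 (S w)| <= 1.
  move=> hV w; rewrite normrM -[leRHS]mul1r ler_pM// ger0_norm ?gw_ge0//.
  by rewrite gw_le1// invr_ge0.
pose G1 (w : T) := 1 * gw 4^-1 (A * U1 w).
pose G2 w := G1 w * gw 4^-1 (A * U2 w).
pose G3 w := G2 w * gw 4^-1 (B * V1 w).
have b1 w : `|G1 w| <= 1 by apply: (g1 (fun=> 1) (fun w => A * U1 w)) => ?; rewrite normr1.
have b2 w : `|G2 w| <= 1 by exact: (g1 _ (fun w => A * U2 w) b1).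
have b3 w : `|G3 w| <= 1 by exact: (g1 _ (fun w => B * V1 w) b2).
have m1 : measurable_fun setT G1 by apply: measurable_funM => //; exact: mg.
have m2 : measurable_fun setT G2 by apply: measurable_funM => //; exact: mg.
have m3 : measurable_fun setT G3 by apply: measurable_funM => //; exact: mg.
have h0 n1 n2 n3 n4 : (\int[P]_w (1 * cos (n1 * (A * U1 w) +
    (n2 * (A * U2 w) + (n3 * (B * V1 w) + n4 * (B * V2 w)))))%:E =
    (1 * expR (- (a * SA * n1 ^+ 2) + - (2 * k * (r * n3 - s * n4)) * n1 +
      (- (a * SA * n2 ^+ 2) - 2 * k * (r * n4 + s * n3) * n2 - b * SE * (n3 ^+ 2 + n4 ^+ 2))))%:E)%E.
  transitivity (\int[P]_w (cos ((n1 * A) * U1 w + (n2 * A) * U2 w + (n3 * B) * V1 w + (n4 * B) * V2 w))%:E)%E.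
    by apply: eq_integral => w _; rewrite mul1r; congr (cos _)%:E; ring.
  rewrite cf mul1r; congr (expR _)%:E.
  rewrite !eA !eB.
  have -> : 2 * p * (n1 * A * (r * (n3 * B) - s * (n4 * B)) + n2 * A * (r * (n4 * B) + s * (n3 * B))) =
     2 * (A * B * p) * (n1 * (r * n3 - s * n4) + n2 * (r * n4 + s * n3)) by ring.
  by rewrite ABk; field.
have h1 n2 n3 n4 : (\int[P]_w (G1 w * cos (n2 * (A * U2 w) + (n3 * (B * V1 w) + n4 * (B * V2 w))))%:E =
    ((Num.sqrt m)^-1 * expR (- (a * SA * n2 ^+ 2) + - (2 * k * (r * n4 + s * n3)) * n2 +
      (k ^+ 2 * (r * n3 - s * n4) ^+ 2 / m - b * SE * (n3 ^+ 2 + n4 ^+ 2))))%:E)%E.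
  apply: (integral_gauss_linear _ mA1 _ _ (fun n1 => h0 n1 n2 n3 n4)) => //.
  - by apply: measurable_funD; [exact: measurable_funM|apply: measurable_funD; exact: measurable_funM].
  - by move=> w; rewrite normr1.
  rewrite integral_expR_quadratic_gw// -/m; congr (_ * (_ * expR _))%:E; first by rewrite div1r.
  by field; rewrite gt_eqF.
have h2 n3 n4 : (\int[P]_w (G2 w * cos (n3 * (B * V1 w) + n4 * (B * V2 w)))%:E =
    (m^-1 * expR (- (M * n3 ^+ 2) + 0 * n3 + - (M * n4 ^+ 2)))%:E)%E.
  apply: (integral_gauss_linear _ mA2 _ _ (fun n2 => h1 n2 n3 n4)) => //.
  - by apply: measurable_funD; exact: measurable_funM.
  rewrite integral_expR_quadratic_gw// -/m; congr (_ * (_ * expR _))%:E.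
    by rewrite -invfM -expr2 sm2.
  by rewrite /M; field; rewrite gt_eqF.
(* The zeros provide the phase and the lower-order coefficients expected by the last application. *)
have h3 n4 : (\int[P]_w (G3 w * cos (n4 * (B * V2 w) + 0))%:E =
    (m^-1 / Num.sqrt (1 + M) * expR (- (M * n4 ^+ 2) + 0 * n4 + 0))%:E)%E.
  transitivity (\int[P]_w (G3 w * cos (n4 * (B * V2 w)))%:E)%E.
    by apply: eq_integral => w _; rewrite addr0.
  apply: (integral_gauss_linear _ mB1 _ _ (fun n3 => h2 n3 n4)) => //.
  - exact: measurable_funM.
  rewrite integral_expR_quadratic_gw//; congr (_ * (_ * expR _))%:E.
  by rewrite expr0n mul0r mul0r !addr0.
have h4 : (\int[P]_w (G3 w * gw 4^-1 (B * V2 w) * cos 0)%:E = (m^-1 / (1 + M))%:E)%E.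
  apply: (@integral_gauss_linear _ _ _ P G3 (fun w => B * V2 w) (fun=> 0) _ _ m3 mB2 (measurable_cst _) b3 h3).
  rewrite integral_expR_quadratic_gw//; congr (_ * _)%:E.
  by rewrite expr0n mul0r addr0 expR0 mulr1 -mulrA -invfM -expr2 sM2.
rewrite -mM invfM -h4; apply: eq_integral => w _; congr EFin.
rewrite cos0 mulr1 /G3 /G2 /G1 mul1r /gw !(mulrC A) !(mulrC B) !eA !eB -!expRD; congr expR.
by field.
Qed.

End laplace_of_charfun.

Section charfun_of_sum.
Context d (T : measurableType d) (R : realType) (P : probability T R).
Variables (X1 X2 X3 X4 Y1 Y2 Z1 Z2 : T -> R) (p r s sX sE : R).
Hypotheses (mX1 : measurable_fun setT X1) (mX2 : measurable_fun setT X2).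
Hypotheses (mX3 : measurable_fun setT X3) (mX4 : measurable_fun setT X4).
Hypotheses (mY1 : measurable_fun setT Y1) (mY2 : measurable_fun setT Y2).
Hypotheses (mZ1 : measurable_fun setT Z1) (mZ2 : measurable_fun setT Z2).
Let rX (A1 A2 A3 A4 : set R) := X1 @^-1` A1 `&` X2 @^-1` A2 `&` X3 @^-1` A3 `&` X4 @^-1` A4.
Let rY (A1 A2 : set R) := Y1 @^-1` A1 `&` Y2 @^-1` A2.
Let rZ (A1 A2 : set R) := Z1 @^-1` A1 `&` Z2 @^-1` A2.
Hypothesis iXYZ : forall A1 A2 A3 A4 A5 A6 A7 A8 : set R,
  measurable A1 -> measurable A2 -> measurable A3 -> measurable A4 ->
  measurable A5 -> measurable A6 -> measurable A7 -> measurable A8 ->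
  P (rX A1 A2 A3 A4 `&` rY A5 A6 `&` rZ A7 A8) =
  (P (rX A1 A2 A3 A4) * P (rY A5 A6) * P (rZ A7 A8))%E.
Hypothesis cX : forall x1 x2 x3 x4,
  (\int[P]_w (cos (x1 * X1 w + x2 * X2 w + x3 * X3 w + x4 * X4 w))%:E =
   (expR (- (p * (x1 ^+ 2 + x2 ^+ 2 + x3 ^+ 2 + x4 ^+ 2) +
      2 * p * (x1 * (r * x3 - s * x4) + x2 * (r * x4 + s * x3))) / 4))%:E)%E.
Hypothesis cY : forall y1 y2, (\int[P]_w (cos (y1 * Y1 w + y2 * Y2 w))%:E =
  (expR (- (sX * (y1 ^+ 2 + y2 ^+ 2)) / 4))%:E)%E.
Hypothesis sY : forall y1 y2, (\int[P]_w (sin (y1 * Y1 w + y2 * Y2 w))%:E = 0)%E.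
Hypothesis cZ : forall z1 z2, (\int[P]_w (cos (z1 * Z1 w + z2 * Z2 w))%:E =
  (expR (- (sE * (z1 ^+ 2 + z2 ^+ 2)) / 4))%:E)%E.
Hypothesis sZ : forall z1 z2, (\int[P]_w (sin (z1 * Z1 w + z2 * Z2 w))%:E = 0)%E.

Let mpre (X : T -> R) A : measurable_fun setT X -> measurable A -> measurable (X @^-1` A).
Proof. by move=> mX mA; rewrite -[X in measurable X]setTI; exact: mX. Qed.

Let mlin (X Y : T -> R) (a b : R) : measurable_fun setT X -> measurable_fun setT Y ->
  measurable_fun setT (fun w => a * X w + b * Y w).
Proof. by move=> mX mY; apply: measurable_funD; exact: measurable_funM. Qed.

Let iXY (A1 A2 A3 A4 A5 A6 : set R) :
  measurable A1 -> measurable A2 -> measurable A3 -> measurable A4 ->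
  measurable A5 -> measurable A6 ->
  P (rX A1 A2 A3 A4 `&` rY A5 A6) = (P (rX A1 A2 A3 A4) * P (rY A5 A6))%E.
Proof.
move=> ? ? ? ? ? ?; have := @iXYZ A1 A2 A3 A4 A5 A6 setT setT.
have -> : rZ setT setT = setT by rewrite /rZ !preimage_setT setTI.
by rewrite !setIT probability_setT mule1; apply.
Qed.

(** The argument is a sum of linear forms in the channel, in the first noise and in the second
    noise; each noise is split off in turn, so the exponents add. *)
Lemma charfun_of_sum (a1 a2 b1 b2 : R) :
  (\int[P]_w (cos (a1 * (X1 w + Y1 w) + a2 * (X2 w + Y2 w) +
      b1 * (X3 w + Z1 w) + b2 * (X4 w + Z2 w)))%:E =
   (expR (- ((p + sX) * (a1 ^+ 2 + a2 ^+ 2) + (p + sE) * (b1 ^+ 2 + b2 ^+ 2) +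
      2 * p * (a1 * (r * b1 - s * b2) + a2 * (r * b2 + s * b1))) / 4))%:E)%E.
Proof.
pose M w := a1 * Y1 w + a2 * Y2 w; pose N w := b1 * Z1 w + b2 * Z2 w.
(* The coefficients 1 keep each partial sum in the two-term shape that [indepl_lin] produces. *)
pose L2 w := a1 * X1 w + a2 * X2 w; pose L3 w := 1 * L2 w + b1 * X3 w.
pose L w := 1 * L3 w + b2 * X4 w.
pose Q1 w := 1 * L w + a1 * Y1 w; pose Q w := 1 * Q1 w + a2 * Y2 w.
have mM : measurable_fun setT M by exact: mlin.
have mN : measurable_fun setT N by exact: mlin.
have mL2 : measurable_fun setT L2 by exact: mlin.
have mL3 : measurable_fun setT L3 by exact: mlin.
have mL : measurable_fun setT L by exact: mlin.
have mQ1 : measurable_fun setT Q1 by exact: mlin.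
have mQ : measurable_fun setT Q by exact: mlin.
have indLM A B : measurable A -> measurable B ->
    P (L @^-1` A `&` M @^-1` B) = (P (L @^-1` A) * P (M @^-1` B))%E.
  move=> mA mB.
  (* Independence is upgraded one side at a time: first the noise pair becomes a linear form against
     channel rectangles, then the channel becomes one against events of that form. *)
  have h1 A1 A2 A3 A4 : measurable A1 -> measurable A2 -> measurable A3 -> measurable A4 ->
      P (M @^-1` B `&` rX A1 A2 A3 A4) = (P (M @^-1` B) * P (rX A1 A2 A3 A4))%E.
    move=> m1 m2 m3 m4.
    have : indepl P (rX A1 A2 A3 A4) setT [:: M].
      apply: indepl_lin => //; first by do 3?apply: measurableI; exact: mpre.
      by move=> C mC D mD /=; rewrite setTI setIC iXY// muleC.
    by move=> /(_ B mB)/=; rewrite setTI.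
  have : indepl P (M @^-1` B) setT [:: L].
    do 3!(apply: indepl_lin => //; try by [exact: mpre]).
    move=> A1 mA1 A2 mA2 A3 mA3 A4 mA4 /=; rewrite setTI setIC h1// muleC//.
  by move=> /(_ A mA)/=; rewrite setTI.
have indQN A B : measurable A -> measurable B ->
    P (Q @^-1` A `&` N @^-1` B) = (P (Q @^-1` A) * P (N @^-1` B))%E.
  move=> mA mB.
  have h1 A1 A2 A3 A4 A5 A6 : measurable A1 -> measurable A2 -> measurable A3 -> measurable A4 ->
      measurable A5 -> measurable A6 ->
      P (N @^-1` B `&` (rX A1 A2 A3 A4 `&` rY A5 A6)) =
      (P (N @^-1` B) * P (rX A1 A2 A3 A4 `&` rY A5 A6))%E.
    move=> m1 m2 m3 m4 m5 m6.
    have : indepl P (rX A1 A2 A3 A4 `&` rY A5 A6) setT [:: N].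
      apply: indepl_lin => //; first by do 4?apply: measurableI; try exact: mpre; apply: measurableI; exact: mpre.
      by move=> C mC D mD /=; rewrite setTI setIC iXYZ// iXY// muleC.
    by move=> /(_ B mB)/=; rewrite setTI.
  have : indepl P (N @^-1` B) setT [:: Q].
    do 5!(apply: indepl_lin => //; try by [exact: mpre]).
    move=> A1 mA1 A2 mA2 A3 mA3 A4 mA4 A5 mA5 A6 mA6 /=; rewrite setTI.
    by rewrite -(setIA _ (Y1 @^-1` A5)) setIC h1// muleC.
  by move=> /(_ A mA)/=; rewrite setTI.
have cL : (\int[P]_w (cos (L w))%:E = (expR (- (p * (a1 ^+ 2 + a2 ^+ 2 + b1 ^+ 2 + b2 ^+ 2) +
      2 * p * (a1 * (r * b1 - s * b2) + a2 * (r * b2 + s * b1))) / 4))%:E)%E.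
  by rewrite -cX; apply: eq_integral => w _; rewrite /L /L3 /L2 !mul1r.
have cQ : (\int[P]_w (cos (Q w))%:E = (expR (- (p * (a1 ^+ 2 + a2 ^+ 2 + b1 ^+ 2 + b2 ^+ 2) +
      2 * p * (a1 * (r * b1 - s * b2) + a2 * (r * b2 + s * b1))) / 4) *
      expR (- (sX * (a1 ^+ 2 + a2 ^+ 2)) / 4))%:E)%E.
  rewrite -(indep_cosD mL mM indLM cL (cY a1 a2) (sY a1 a2)).
  by apply: eq_integral => w _; rewrite /Q /Q1 /M !mul1r addrA.
transitivity (\int[P]_w (cos (Q w + N w))%:E)%E.
  by apply: eq_integral => w _; congr (cos _)%:E; rewrite /Q /Q1 /L /L3 /L2 /N; ring.
rewrite (indep_cosD mQ mN indQN cQ (cZ b1 b2) (sZ b1 b2)) -!expRD; congr (expR _)%:E.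
by field.
Qed.

End charfun_of_sum.

Lemma integral_indicM d (T : measurableType d) (R : realType)
    (mu : {measure set T -> \bar R}) (D : set T) (g : T -> R) :
  (\int[mu]_(x in D) (g x)%:E = \int[mu]_x (g x * \1_D x)%:E)%E.
Proof.
rewrite integral_mkcond; apply: eq_integral => x _; rewrite /patch indicE.
by case: ifP => _; rewrite ?mulr1 ?mulr0.
Qed.

(** * The joint density determined by its Laplace transform *)

Section density_of_laplace.
Context d (T : measurableType d) (R : realType) (P : probability T R).
Notation mu := (@lebesgue_measure R).
Variables (RA RE : T -> R) (SA SE c : R).
Hypotheses (mRA : measurable_fun setT RA) (mRE : measurable_fun setT RE).
Hypotheses (RA0 : forall w, 0 <= RA w) (RE0 : forall w, 0 <= RE w).
Hypotheses (SA0 : 0 < SA) (SE0 : 0 < SE) (c0 : 0 <= c) (cD : c < SA * SE).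
Hypothesis lap : forall a b : R, 0 <= a -> 0 <= b ->
  (\int[P]_w (expR (- (a * RA w ^+ 2)) * expR (- (b * RE w ^+ 2)))%:E =
   ((1 + a * SA) * (1 + b * SE) - a * b * c)^-1%:E)%E.
Local Notation f0 := (ray2 SA SE c).

Let mf0 : measurable_fun setT (fun z : R * R => f0 z.1 z.2).
Proof. exact: measurable_ray2. Qed.

Let f00 x y : 0 <= f0 x y. Proof. exact: ray2_ge0. Qed.

Let if0 : (mu \x mu)%E.-integrable setT (EFin \o (fun z : R * R => f0 z.1 z.2)).
Proof.
apply/integrableP; split; first exact/measurable_EFinP.
have := laplace_ray2 SA0 SE0 c0 cD (lexx 0) (lexx 0).
under eq_integral do rewrite !mul0r oppr0 expR0 !mulr1.
move=> h; under eq_integral do rewrite /= ger0_norm//.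
by rewrite h ltry.
Qed.

Let if0M (g : R * R -> R) : measurable_fun setT g -> (forall z, `|g z| <= 1) ->
  (mu \x mu)%E.-integrable setT (EFin \o (fun z : R * R => f0 z.1 z.2 * g z)).
Proof.
move=> mg g1; apply: (le_integrable _ _ _ if0) => //.
  by apply/measurable_EFinP; exact: measurable_funM.
by move=> z _ /=; rewrite lee_fin normrM ler_piMr.
Qed.

Let mexp d' (T' : measurableType d') (b : R) (g : T' -> R) : measurable_fun setT g ->
  measurable_fun setT (fun w => expR (- (b * g w ^+ 2))).
Proof.
move=> mg; apply: measurableT_comp; first exact: measurable_expR.
by apply: measurableT_comp => //; apply: measurable_funM => //; exact: measurable_funX.
Qed.

Let exp1 (b x : R) : 0 <= b -> `|expR (- (b * x ^+ 2))| <= 1.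
Proof. by move=> b0; rewrite ger0_norm ?expR_ge0// expR_le1 oppr_le0 mulr_ge0// sqr_ge0. Qed.

Let msqrt (A : set R) : measurable A -> measurable (Num.sqrt @^-1` A : set R).
Proof.
move=> mA; rewrite -[X in measurable X]setTI.
by apply: (continuous_measurable_fun (@sqrt_continuous R)).
Qed.

(** Events are expressed through the squares, the variables of the Laplace transform. For
    nonnegative envelopes, the square root of the square restores the original event. *)
Let EA (A : set R) : set T := (fun w => RA w ^+ 2) @^-1` (Num.sqrt @^-1` A).
Let EB (B : set R) : set T := (fun w => RE w ^+ 2) @^-1` (Num.sqrt @^-1` B).
Let DA (A : set R) : set (R * R) := (fun z => z.1 ^+ 2) @^-1` (Num.sqrt @^-1` A).
Let DB (B : set R) : set (R * R) := (fun z => z.2 ^+ 2) @^-1` (Num.sqrt @^-1` B).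

Let mRA2 : measurable_fun setT (fun w => RA w ^+ 2). Proof. exact: measurable_funX. Qed.
Let mRE2 : measurable_fun setT (fun w => RE w ^+ 2). Proof. exact: measurable_funX. Qed.
Let mz1 : measurable_fun setT (fun z : R * R => z.1 ^+ 2). Proof. exact: measurable_funX. Qed.
Let mz2 : measurable_fun setT (fun z : R * R => z.2 ^+ 2). Proof. exact: measurable_funX. Qed.

Let mEA A : measurable A -> measurable (EA A).
Proof. by move=> mA; have := mRA2 measurableT (msqrt mA); rewrite setTI. Qed.
Let mEB A : measurable A -> measurable (EB A).
Proof. by move=> mA; have := mRE2 measurableT (msqrt mA); rewrite setTI. Qed.
Let mDA A : measurable A -> measurable (DA A).
Proof. by move=> mA; have := mz1 measurableT (msqrt mA); rewrite setTI. Qed.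
Let ind1 d' (T' : measurableType d') (D : set T') x : `|\1_D x : R| <= 1.
Proof. by rewrite indicE ger0_norm// lern1 leq_b1. Qed.

(** With b frozen, the factor in RE is a weight and uniqueness applies in the square of RA. *)
Let step1 (b : R) A : 0 <= b -> measurable A ->
  (\int[P]_(w in EA A) (expR (- (b * RE w ^+ 2)))%:E =
   \int[(mu \x mu)%E]_(z in DA A) (f0 z.1 z.2 * expR (- (b * z.2 ^+ 2)))%:E)%E.
Proof.
move=> b0 mA.
have v1 w : 0 <= expR (- (b * RE w ^+ 2)) by exact: expR_ge0.
have v2 (z : R * R) : 0 <= f0 z.1 z.2 * expR (- (b * z.2 ^+ 2)) by rewrite mulr_ge0// expR_ge0.
have i1 : P.-integrable setT (EFin \o (fun w => expR (- (b * RE w ^+ 2)))).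
  by apply: integrable_le1 => [|w]; [exact: mexp|exact: exp1].
have i2 := if0M (@mexp _ _ b (fun z : R * R => z.2) measurable_snd) (fun z => exp1 z.2 b0).
have s1 w : 0 <= RA w ^+ 2 by exact: sqr_ge0.
have s2 (z : R * R) : 0 <= z.1 ^+ 2 by exact: sqr_ge0.
apply: (@laplace_unique _ T _ (measurableTypeR R * measurableTypeR R)%type R P (mu \x mu)%E _ _ _ _ v1 i1 v2 i2 mRA2 s1 mz1 s2 _ _ (msqrt mA)).
move=> a a0; transitivity (((1 + a * SA) * (1 + b * SE) - a * b * c)^-1%:E)%E.
  by rewrite -lap//; apply: eq_integral => w _; rewrite mulrC.
rewrite -laplace_ray2//; apply: eq_integral => z _.
by rewrite -mulrA [X in _ = (_ * X)%:E]mulrC.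
Qed.

(** Read for varying b, [step1] says that the measures weighted by the indicator of the first event
    have equal Laplace transforms in the second square; uniqueness applies again. *)
Let step2 A B : measurable A -> measurable B ->
  (\int[P]_(w in EB B) (\1_(EA A) w)%:E =
   \int[(mu \x mu)%E]_(z in DB B) (f0 z.1 z.2 * \1_(DA A) z)%:E)%E.
Proof.
move=> mA mB.
have v1 w : 0 <= \1_(EA A) w :> R by [].
have v2 (z : R * R) : 0 <= f0 z.1 z.2 * \1_(DA A) z by rewrite mulr_ge0.
have i1 : P.-integrable setT (EFin \o (\1_(EA A) : T -> R)).
  by apply: integrable_indic => //; exact: mEA.
have i2 := if0M (measurable_indic (mDA mA)) (ind1 (DA A)).
have s1 w : 0 <= RE w ^+ 2 by exact: sqr_ge0.
have s2 (z : R * R) : 0 <= z.2 ^+ 2 by exact: sqr_ge0.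
apply: (@laplace_unique _ T _ (measurableTypeR R * measurableTypeR R)%type R P (mu \x mu)%E _ _ _ _ v1 i1 v2 i2 mRE2 s1 mz2 s2 _ _ (msqrt mB)).
move=> b b0; have := step1 b0 mA; rewrite integral_indicM [in RHS]integral_indicM => h.
transitivity (\int[P]_w (expR (- (b * RE w ^+ 2)) * \1_(EA A) w)%:E)%E.
  by apply: eq_integral => w _; rewrite mulrC.
by rewrite h; apply: eq_integral => z _; rewrite mulrAC.
Qed.

Let f0_eq0 x y : ~~ ((0 < x) && (0 < y)) -> f0 x y = 0.
Proof.
rewrite negb_and /ray2 /pw /hind => /orP[/negbTE ->|/negbTE ->].
  by rewrite !mul0r mulr0 !mul0r.
by rewrite !mul0r mulr0 !mul0r.
Qed.

Lemma joint_density_ray2 : joint_density P RA RE f0.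
Proof.
split => //; split => // A B mA mB.
have -> : RA @^-1` A `&` RE @^-1` B = EA A `&` EB B.
  by apply/seteqP; split => w; rewrite /EA /EB /= !sqrtr_sqr !ger0_norm.
have := step2 mA mB; rewrite integral_indic//; [|exact: mEB|exact: mEA].
move=> ->; rewrite integral_indicM [in RHS]integral_indicM; apply: eq_integral => z _; congr EFin.
(* [DA] and [DB] test the absolute values of the coordinates, so they differ from A and B off the
   positive quadrant, where the density is zero. *)
have [/andP[z1 z2]|zn] := boolP ((0 < z.1) && (0 < z.2)); last by rewrite f0_eq0// !mul0r.
have e1 : (z \in DA A) = (z.1 \in A).
  by apply/idP/idP; rewrite !inE /DA /= sqrtr_sqr ger0_norm// ltW.
have e2 : (z \in DB B) = (z.2 \in B).
  by apply/idP/idP; rewrite !inE /DB /= sqrtr_sqr ger0_norm// ltW.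
rewrite -mulrA; congr (_ * _); rewrite !indicE e1 e2 in_setX -natrM mulnb.
by [].
Qed.

End density_of_laplace.

(** * The channel model and its envelopes *)

Section channel.
Context d (T : measurableType d) (R : realType) (P : probability T R).
Variables (p : R) (rho : R[i]) (sW sE : R) (H HE W WE : T -> R[i]).
Hypotheses (p0 : 0 < p) (rho1 : cabs rho < 1) (sW0 : 0 < sW) (sE0 : 0 < sE).
Hypothesis gH : zmcscg P (fun i : 'I_2 => if i == ord0 then H else HE) ((p%:C)%C *: corr_mx rho).
Hypotheses (gW : zmcscg1 P W sW) (gWE : zmcscg1 P WE sE).
Hypothesis ind : forall A1 A2 A3 A4 A5 A6 A7 A8 : set R,
  measurable A1 -> measurable A2 -> measurable A3 -> measurable A4 ->
  measurable A5 -> measurable A6 -> measurable A7 -> measurable A8 ->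
  P (cev H A1 A2 `&` cev HE A3 A4 `&` cev W A5 A6 `&` cev WE A7 A8) =
  (P (cev H A1 A2 `&` cev HE A3 A4) * P (cev W A5 A6) * P (cev WE A7 A8))%E.

Let re (X : T -> R[i]) w := complex.Re (X w).
Let im (X : T -> R[i]) w := complex.Im (X w).

(** Testing against the single entry y1 + i y2 makes the real part of the Hermitian product the real
    form y1 Re Z + y2 Im Z. *)
Lemma zmcscg1_charfun (Z : T -> R[i]) (s : R) : zmcscg1 P Z s ->
  [/\ measurable_fun setT (re Z), measurable_fun setT (im Z) &
  forall y1 y2, (\int[P]_w (cos (y1 * re Z w + y2 * im Z w))%:E =
    (expR (- (s * (y1 ^+ 2 + y2 ^+ 2)) / 4))%:E)%E /\
    (\int[P]_w (sin (y1 * re Z w + y2 * im Z w))%:E = 0)%E].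
Proof.
move=> [m1 [m2 h]]; split; [exact: (m1 ord0)|exact: (m2 ord0)|].
move=> y1 y2; have [] := h (fun=> (y1 +i* y2)%C).
have e w : complex.Re (\sum_(i < 1) conjc (y1 +i* y2)%C * Z w) = y1 * re Z w + y2 * im Z w.
  by rewrite big_ord1 /re /im; case: (Z w) => a b /=; ring.
under eq_integral do rewrite e.
move=> hc; under eq_integral do rewrite e.
move=> hs; split => //; rewrite hc; congr (expR _)%:E.
rewrite !big_ord1 mxE eqxx/=; ring.
Qed.

Let cH x1 x2 x3 x4 :
  (\int[P]_w (cos (x1 * re H w + x2 * im H w + x3 * re HE w + x4 * im HE w))%:E =
   (expR (- (p * (x1 ^+ 2 + x2 ^+ 2 + x3 ^+ 2 + x4 ^+ 2) +
      2 * p * (x1 * (complex.Re rho * x3 - complex.Im rho * x4) +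
               x2 * (complex.Re rho * x4 + complex.Im rho * x3))) / 4))%:E)%E.
Proof.
have [_ [_ /(_ (fun i => if i == ord0 then (x1 +i* x2)%C else (x3 +i* x4)%C))[]]] := gH.
have e w : complex.Re (\sum_(i < 2) conjc (if i == ord0 then (x1 +i* x2)%C else (x3 +i* x4)%C) *
    (if i == ord0 then H else HE) w) = x1 * re H w + x2 * im H w + x3 * re HE w + x4 * im HE w.
  rewrite !big_ord_recl big_ord0 /re /im/=; case: (H w) => a b; case: (HE w) => a' b' /=; ring.
under eq_integral do rewrite e.
move=> -> _; congr (expR _)%:E; rewrite !big_ord_recl !big_ord0 !mxE/=.
case: rho => r s /=; ring.
Qed.

Lemma joint_density_envelope : joint_density P (envelope H W) (envelope HE WE)
  (ray2 (p + sW) (p + sE) ((p * cabs rho) ^+ 2)).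
Proof.
have [mW1 mW2 cW] := zmcscg1_charfun gW.
have [mE1 mE2 cE] := zmcscg1_charfun gWE.
have [/(_ ord0) mH1 [/(_ ord0) mH2 _]] := gH.
have [/(_ ord_max) mHE1 [/(_ ord_max) mHE2 _]] := gH.
rewrite /= in mH1 mH2 mHE1 mHE2.
set r := complex.Re rho; set s := complex.Im rho.
have rs : cabs rho ^+ 2 = r ^+ 2 + s ^+ 2.
  by rewrite /cabs sqr_sqrtr// addr_ge0 ?sqr_ge0.
have rs1 : r ^+ 2 + s ^+ 2 < 1.
  by rewrite -rs expr_lt1// sqrtr_ge0.
have SA0 : 0 < p + sW by rewrite addr_gt0.
have SE0 : 0 < p + sE by rewrite addr_gt0.
have cS : p ^+ 2 * (r ^+ 2 + s ^+ 2) < (p + sW) * (p + sE).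
  apply: (@lt_le_trans _ _ (p ^+ 2)).
    by rewrite gtr_pMr// exprn_gt0.
  by rewrite expr2 ler_pM ?(ltW p0)// lerDl ltW.
have cf := @charfun_of_sum _ _ _ P (re H) (im H) (re HE) (im HE) (re W) (im W) (re WE) (im WE)
  p r s sW sE mH1 mH2 mHE1 mHE2 mW1 mW2 mE1 mE2.
have {}cf := cf _ cH (fun y1 y2 => (cW y1 y2).1) (fun y1 y2 => (cW y1 y2).2)
  (fun y1 y2 => (cE y1 y2).1) (fun y1 y2 => (cE y1 y2).2).
have mD (X Y : T -> R) : measurable_fun setT X -> measurable_fun setT Y ->
  measurable_fun setT (fun w => X w + Y w) by exact: measurable_funD.
have envE (X Y : T -> R[i]) w : envelope X Y w = Num.sqrt ((re X w + re Y w) ^+ 2 + (im X w + im Y w) ^+ 2).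
  by rewrite /envelope /cabs /re /im; case: (X w) => a b; case: (Y w).
have env2 (X Y : T -> R[i]) w : envelope X Y w ^+ 2 = (re X w + re Y w) ^+ 2 + (im X w + im Y w) ^+ 2.
  by rewrite envE sqr_sqrtr// addr_ge0 ?sqr_ge0.
have menv (X Y : T -> R[i]) : measurable_fun setT (re X) -> measurable_fun setT (im X) ->
    measurable_fun setT (re Y) -> measurable_fun setT (im Y) -> measurable_fun setT (envelope X Y).
  move=> ? ? ? ?; rewrite (funext (envE X Y)).
  apply: (measurableT_comp (continuous_measurable_fun (@sqrt_continuous R))).
  by apply: measurable_funD; apply: measurable_funX; exact: mD.
rewrite exprMn rs; apply: joint_density_ray2 => //.
- exact: menv.
- exact: menv.
- by move=> w; exact: sqrtr_ge0.
- by move=> w; exact: sqrtr_ge0.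
- by rewrite mulr_ge0 ?sqr_ge0// addr_ge0 ?sqr_ge0.
move=> a b a0 b0.
rewrite -(@laplace_of_charfun _ _ _ P _ _ _ _ (p + sW) (p + sE) p r s (mD _ _ mH1 mW1) (mD _ _ mH2 mW2)
  (mD _ _ mHE1 mE1) (mD _ _ mHE2 mE2) SA0 SE0 cS (cf _) a b a0 b0).
- by apply: eq_integral => w _; rewrite !env2.
- move=> A1 A2 A3 A4 A5 A6 A7 A8 *; have := @ind A1 A2 A3 A4 A5 A6 A7 A8.
  by rewrite /cev !setIA; apply.
Qed.

End channel.

Lemma joint_density_mutual_info d (T : measurableType d) (R : realType) (P : probability T R)
    (X Y : T -> R) (f g : R -> R -> R) :
  joint_density P X Y f -> joint_density P X Y g -> mutual_info f = mutual_info g.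
Proof.
move=> [f0 [mf hf]] [g0 [mg hg]]; apply: mutual_info_unique => //.
  have := hf setT setT measurableT measurableT; rewrite setXTT => <-.
  by rewrite !preimage_setT setTI probability_setT ltry.
by move=> A B mA mB; rewrite -hf// -hg.
Qed.

(** Formulated with a single receiver noise W next to WE, so that it serves both pairs of envelopes;
    delta depends only on p, b and eps, before any probability space is chosen. *)
Lemma envelope_mutual_info_limit (R : realType) (p b eps : R) : 0 < p -> 0 < b -> 0 < eps ->
  exists delta : R, 0 < delta /\
  forall (rho : R[i]) (s : R),
    1 - delta < cabs rho -> cabs rho < 1 -> 0 < s -> s < delta ->
    forall (d : measure_display) (T : measurableType d) (P : probability T R)
        (H HE W WE : T -> R[i]),
      zmcscg P (fun i : 'I_2 => if i == ord0 then H else HE) ((p%:C)%C *: corr_mx rho) ->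
      zmcscg1 P W s -> zmcscg1 P WE (b * s) ->
      (forall A1 A2 A3 A4 A5 A6 A7 A8 : set R,
        measurable A1 -> measurable A2 -> measurable A3 -> measurable A4 ->
        measurable A5 -> measurable A6 -> measurable A7 -> measurable A8 ->
        P (cev H A1 A2 `&` cev HE A3 A4 `&` cev W A5 A6 `&` cev WE A7 A8) =
        (P (cev H A1 A2 `&` cev HE A3 A4) * P (cev W A5 A6) * P (cev WE A7 A8))%E) ->
      (exists f, joint_density P (envelope H W) (envelope HE WE) f) /\
      (forall f, joint_density P (envelope H W) (envelope HE WE) f ->
        (`| mutual_info f - (mi_approx p rho s (b * s))%:E | < eps%:E)%E).
Proof.
move=> p0 b0 e0; have [delta [d0 hd]] := mi_approx_limit p0 b0 e0.
exists delta; split => // rho s r1 r2 s0 sd d T P H HE W WE gH gW gWE ind.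
have [q0 cD hv] := hd _ _ r1 r2 (sqrtr_ge0 _) s0 sd.
have bs0 : 0 < b * s by rewrite mulr_gt0.
have jd := joint_density_envelope p0 r2 s0 bs0 gH gW gWE ind.
split; first by eexists; exact: jd.
move=> f /joint_density_mutual_info /(_ jd) ->.
have SA0 : 0 < p + s by rewrite addr_gt0.
have SE0 : 0 < p + b * s by rewrite addr_gt0.
have c0 : 0 < (p * cabs rho) ^+ 2 by rewrite exprn_gt0// mulr_gt0.
(* Used only to know that the mutual information is a finite real, which carries the real estimate
   over to the extended reals. *)
have [e [_ mi]] := mutual_info_ray2 SA0 SE0 c0 cD.
rewrite [in ltLHS]mi; move: (hv _ (esym mi)); rewrite -lte_fin.
by [].
Qed.

Theorem theorem2 (R : realType) (p : R) (hp : 0 < p) :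
  (* A--E: sigma_E^2 = b sigma_A^2, |rho| -> 1, sigma_A^2 -> 0 *)
  (forall b : R, 0 < b -> forall sB : R, 0 < sB ->
   forall eps : R, 0 < eps ->
   exists delta : R, 0 < delta /\
   forall (rho : R[i]) (sA : R),
     1 - delta < cabs rho -> cabs rho < 1 -> 0 < sA -> sA < delta ->
     forall (d : measure_display) (T : measurableType d)
            (P : probability T R) (H HE WA WB WE : T -> R[i]),
       channel_model P p rho sA sB (b * sA) H HE WA WB WE ->
       (exists f, joint_density P (envelope H WA) (envelope HE WE) f) /\
       (forall f, joint_density P (envelope H WA) (envelope HE WE) f ->
          (`| mutual_info f - (mi_approx p rho sA (b * sA))%:E | < eps%:E)%E))
  /\
  (* B--E: sigma_E^2 = b' sigma_B^2, |rho| -> 1, sigma_B^2 -> 0 *)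
  (forall b' : R, 0 < b' -> forall sA : R, 0 < sA ->
   forall eps : R, 0 < eps ->
   exists delta : R, 0 < delta /\
   forall (rho : R[i]) (sB : R),
     1 - delta < cabs rho -> cabs rho < 1 -> 0 < sB -> sB < delta ->
     forall (d : measure_display) (T : measurableType d)
            (P : probability T R) (H HE WA WB WE : T -> R[i]),
       channel_model P p rho sA sB (b' * sB) H HE WA WB WE ->
       (exists f, joint_density P (envelope H WB) (envelope HE WE) f) /\
       (forall f, joint_density P (envelope H WB) (envelope HE WE) f ->
          (`| mutual_info f - (mi_approx p rho sB (b' * sB))%:E | < eps%:E)%E)).
Proof.
have cevT d (T : measurableType d) (X : T -> R[i]) : cev X setT setT = setT.
  by rewrite /cev !preimage_setT setTI.
split=> b b0 s _ eps e0.
  have [delta [d0 hd]] := envelope_mutual_info_limit hp b0 e0.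
  exists delta; split => // rho sA r1 r2 s0 sd d T P H HE WA WB WE [gH [gA [_ [gE ind]]]].
  apply: hd => // A1 A2 A3 A4 A5 A6 A7 A8 m1 m2 m3 m4 m5 m6 m7 m8.
  (* Taking the full space for the events of the other receiver's noise removes its factor from the
     product rule. *)
  have := ind A1 A2 A3 A4 A5 A6 setT setT A7 A8 m1 m2 m3 m4 m5 m6 measurableT measurableT m7 m8.
  by rewrite cevT setIT probability_setT mule1.
have [delta [d0 hd]] := envelope_mutual_info_limit hp b0 e0.
exists delta; split => // rho sB r1 r2 s0 sd d T P H HE WA WB WE [gH [_ [gB [gE ind]]]].
apply: hd => // A1 A2 A3 A4 A5 A6 A7 A8 m1 m2 m3 m4 m5 m6 m7 m8.
have := ind A1 A2 A3 A4 setT setT A5 A6 A7 A8 m1 m2 m3 m4 measurableT measurableT m5 m6 m7 m8.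
by rewrite cevT setIT probability_setT mule1.
Qed.
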